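(* Let $\Sigma$ be a surface of constant curvature (Euclidean plane, unit sphere or hyperbolic plane). Then each germ of $C^2$-smooth curve in $\Sigma$ (strictly convex, i.e. with positive geodesic curvature) having area Poritsky property is a conic, i.e. is a germ of curve contained in a conic of $\Sigma$.
   Context: Models: consider $\mathbb R^3$ with coordinates $(x_1,x_2,x_3)$, $\langle x,x\rangle=x_1^2+x_2^2+x_3^2$. The surfaces of constant curvature are: the Euclidean plane $\Sigma=\{x_3=1\}$, $Q=\operatorname{diag}(1,1,0)$; the unit sphere $\Sigma=\{x_1^2+x_2^2+x_3^2=1\}$, $Q=\mathrm{Id}$; the hyperbolic plane $\Sigma=\{x_1^2+x_2^2-x_3^2=-1\}\cap\{x_3>0\}$, $Q=\operatorname{diag}(1,1,-1)$. The metric on $\Sigma$ is induced by the quadratic form $\langle Qx,x\rangle$. Geodesics are intersections of $\Sigma$ with two-dimensional vector subspaces of $\mathbb R^3$. Conics on $\Sigma$ are intersections of $\Sigma$ with quadrics $\{\langle Cx,x\rangle=0\}$, where $C$ is a (non-zero) real symmetric $3\times3$ matrix. Area Poritsky property: let $\Gamma$ be a germ at $O\in\Sigma$ of oriented strictly convex curve. A small disk centered at $O$ is split by $\Gamma$ into two components; let $V$ be the convex one. For small $p>0$ consider the geodesic chords $AB$ with endpoints $A,B\in\Gamma$ close to $O$ such that the region of $V$ bounded by the chord $AB$ and the arc $AB$ of $\Gamma$ has area $p$. The envelope of these chords is the curve $\gamma_p$ (area construction), and the outer billiard map generated by $\gamma_p$ leaves $\Gamma$ invariant and acts on it as the map $T_p:\Gamma\to\Gamma$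 sending $A$ to the other endpoint $B$ of the chord $AB$ cutting off area $p$ (with $B$ following $A$ in a fixed orientation of $\Gamma$). The germ $\Gamma$ has area Poritsky property if it admits a local $C^1$-smooth parametrization by a parameter $t$ (a $C^1$-smooth local coordinate, called area Poritsky parameter) such that for every $p>0$ small enough $T_p$ is a translation $t\mapsto t+c_p$ in the coordinate $t$, with $c_p$ a constant depending only on $p$. *)

(* Defs.v *)
From HB Require Import structures.
From mathcomp Require Import all_boot all_order all_algebra.
From mathcomp Require Import all_classical all_reals all_analysis.
Set Implicit Arguments.
Unset Strict Implicit.
Unset Printing Implicit Defensive.
Import Order.TTheory GRing.Theory Num.Theory.
Import numFieldNormedType.Exports.
Local Open Scope classical_set_scope.
Local Open Scope ring_scope.

Inductive geometry := Euclidean | Spherical | Hyperbolic.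

Section Surfaces.
Variable R : realType.
Implicit Types (G : geometry) (x y A B : 'rV[R]_3).

Definition row3 (a b c : R) : 'rV[R]_3 := \row_(j < 3) [:: a; b; c]`_j.

Definition bilin (M : 'M[R]_3) x y : R := (x *m M *m y^T) 0 0.

Definition curvature G : R :=
  match G with Euclidean => 0 | Spherical => 1 | Hyperbolic => -1 end.

Definition Q G : 'M[R]_3 := diag_mx (row3 1 1 (curvature G)).

Definition surface G : set 'rV[R]_3 :=
  match G with
  | Euclidean => [set x | x 0 ord_max = 1]
  | Spherical => [set x | bilin (Q Spherical) x x = 1]
  | Hyperbolic => [set x | bilin (Q Hyperbolic) x x = -1 /\ 0 < x 0 ord_max]
  end.

(* The geodesic segment: the part of the plane section of the surface by
   span(A, B) lying in the angle spanned by A and B (on the sphere, for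
   B <> -A, this is the shorter arc). *)
Definition chord G A B : set 'rV[R]_3 :=
  [set x | surface G x /\
     exists u v : R, [/\ 0 <= u, 0 <= v & x = u *: A + v *: B]].

Definition geod_convex G (V : set 'rV[R]_3) : Prop :=
  forall A B, V A -> V B -> chord G A B `<=` V.

(* <Q(x - O), x - O> equals d^2, 2 - 2 cos d, 2 cosh d - 2 respectively, where d
   is the intrinsic distance from O to x.  So these are the geodesic disks
   centered at O, with r a monotone function of the intrinsic radius. *)
Definition disk G (O : 'rV[R]_3) (r : R) : set 'rV[R]_3 :=
  [set x | surface G x /\ bilin (Q G) (x - O) (x - O) < r ^+ 2].

Definition components (S : set 'rV[R]_3) : set (set 'rV[R]_3) :=
  [set connected_component S x | x in S].

(* Each surface is closed in the ambient space, so that ambient closures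
   of its subsets are closures in the surface. *)
Definition boundary_in (S W : set 'rV[R]_3) : set 'rV[R]_3 :=
  closure W `&` closure (S `\` W).

(* Gram determinant of a pair of vectors for the form <Q x, y>. *)
Definition gram G x y : R :=
  bilin (Q G) x x * bilin (Q G) y y - bilin (Q G) x y ^+ 2.

Definition chart_area G (U : set (R * R)) (phi : R * R -> 'rV[R]_3)
    (W : set 'rV[R]_3) : \bar R :=
  (\int[(@lebesgue_measure R \x @lebesgue_measure R)%E]_(z in U `&` phi @^-1` W)
     (Num.sqrt (gram G ('D_((1, 0) : R * R) phi z)
                       ('D_((0, 1) : R * R) phi z)))%:E)%E.

(* Each surface is covered by graphs over the (x_1, x_2)-plane; for the sphere
   the two open hemispheres miss the equator, which has area zero. *)
Definition area G (W : set 'rV[R]_3) : \bar R :=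
  match G with
  | Euclidean => chart_area G setT (fun z => row3 z.1 z.2 1) W
  | Spherical =>
      let U := [set z : R * R | z.1 ^+ 2 + z.2 ^+ 2 < 1] in
      let h (z : R * R) := Num.sqrt (1 - z.1 ^+ 2 - z.2 ^+ 2) in
      (chart_area G U (fun z => row3 z.1 z.2 (h z)) W +
       chart_area G U (fun z => row3 z.1 z.2 (- h z)) W)%E
  | Hyperbolic =>
      chart_area G setT
        (fun z => row3 z.1 z.2 (Num.sqrt (1 + z.1 ^+ 2 + z.2 ^+ 2))) W
  end.

Definition C2_regular_germ G (g : R -> 'rV[R]_3) : Prop :=
  \forall s \near (0 : R),
    [/\ surface G (g s), derivable g s 1, derivable (derive1 g) s 1,
        {for s, continuous (derive1n 2 g)} & derive1 g s != 0].

(* Covariant acceleration: the Q-orthogonal projection of the second derivative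
   to the tangent plane.  On the two curved models <Q x, x> is the curvature
   K = 1, -1, and the tangent plane at x is the Q-orthogonal of x; on the
   Euclidean plane K = 0 and the second derivative is already tangent. *)
Definition cov_acc G (g : R -> 'rV[R]_3) (s : R) : 'rV[R]_3 :=
  derive1n 2 g s -
  (curvature G * bilin (Q G) (derive1n 2 g s) (g s)) *: g s.

(* Geodesic curvature with respect to the normal on the side to which the curve
   bends, i.e. the norm of the normal component of the covariant acceleration
   divided by the squared speed. *)
Definition geod_curvature G (g : R -> 'rV[R]_3) (s : R) : R :=
  Num.sqrt (gram G (derive1 g s) (cov_acc G g s)) /
  Num.sqrt (bilin (Q G) (derive1 g s) (derive1 g s)) ^+ 3.

Definition strictly_convex_germ G (g : R -> 'rV[R]_3) : Prop :=
  \forall s \near (0 : R), 0 < geod_curvature G g s.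

Definition C1_coordinate_germ (t : R -> R) : Prop :=
  \forall s \near (0 : R),
    [/\ derivable t s 1, {for s, continuous (derive1 t)} & derive1 t s != 0].

Definition convex_side G (D Gam V : set 'rV[R]_3) : Prop :=
  exists V', [/\ V <> V', components (D `\` Gam) = [set V; V']
               & geod_convex G V].

Definition cut_region G (V : set 'rV[R]_3) A B (arc W : set 'rV[R]_3) : Prop :=
  components (V `\` chord G A B) W /\
  boundary_in (surface G) W = chord G A B `|` arc.

(* The arc s in ]-a, a[ represents the germ and r is the radius of the disk;
   the points A = g s1, B = g s2 with s1, s2 in ]-b, b[ are those close to O.
   The last implication says that T_p A = B entails t(B) = t(A) + c. *)
Definition area_Poritsky G (g : R -> 'rV[R]_3) : Prop :=
  exists2 t : R -> R, C1_coordinate_germ t &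
    \forall a \near (0 : R)^'+, \forall r \near (0 : R)^'+,
    exists2 V, convex_side G (disk G (g 0) r) (g @` `]-a, a[) V &
    exists2 b : R, 0 < b &
    \forall p \near (0 : R)^'+,
    exists c : R, forall s1 s2 : R, - b < s1 -> s1 < s2 -> s2 < b ->
      (exists2 W, cut_region G V (g s1) (g s2) (g @` `[s1, s2]) W
                & area G W = p%:E) ->
      t s2 = t s1 + c.

Definition conic G (C : 'M[R]_3) : set 'rV[R]_3 :=
  surface G `&` [set x | bilin C x x = 0].

End Surfaces.

(* Main.v *)
(* In the gnomonic chart (c1/c0, c2/c0) attached to suitable orthogonal
   coordinates c, geodesics are straight lines, conics are conics, and the curve
   is the graph of a strictly convex function f.  Let S(a, b) be the area of the
   cap between the graph over [a, b] and its chord, and N = 1 + K (x^2 + y^2) with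
   K the curvature.  Sweeping the cap by chords gives
     dS/da = D1 / (sqrt N(a) M),  dS/db = D2 / (sqrt N(b) M),
   where D1 = (b - a) f'(a) - (f(b) - f(a)), D2 = (b - a) f'(b) - (f(b) - f(a)) and
   M is symmetric in a and b.  In a Poritsky parameter T the level sets of S lie in
   those of T(b) - T(a), so that w(a) D1 + w(b) D2 = 0 with w = 1 / (T' sqrt N).
   Writing this for the three pairs among a, b, x shows that, as x moves between a
   and b, the conic through (x, f(x)) of the pencil generated by the tangents at a
   and b and their doubled chord is always tangent to the graph, hence constant. *)

(* Three obstacles shape the proof. The area is defined by charts over one fixed coordinate plane,
   so invariance under general rotations is avoided: the frames are signed permutations of the
   coordinates, and for each of them the area is reduced to the integral of the gnomonic density by
   substitutions in one variable. The data have low regularity: the curve is only $C^2$, the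
   parameter $C^1$, and the translation length is an arbitrary function of the area. Hence the
   weight $w$ is never differentiated and no level curve is parametrized: level sets of the cap area
   are followed by the intermediate value theorem and difference quotients, and the conic arises
   from a first integral with zero derivative. Finally, the hypothesis speaks of connected
   components of a disk, so the convex side has to be recognized as the part above the graph, and
   the cap as the component cut off by its chord. The factor $M$ occurs in both partial derivatives
   and cancels; curvature then survives only in $w$, and the final algebra is that of the Euclidean
   plane. *)
Require Import Defs.
From mathcomp Require Import all_boot all_order all_algebra.
From mathcomp Require Import all_classical all_reals all_analysis.
From mathcomp Require Import measurable_realfun.
From mathcomp Require Import ring lra.
Set Implicit Arguments.
Unset Strict Implicit.
Unset Printing Implicit Defensive.
Import Order.TTheory GRing.Theory Num.Theory.
Import numFieldNormedType.Exports.
Local Open Scope classical_set_scope.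
Local Open Scope ring_scope.

(** * Real derivatives *)

(* [is_derive x 1 f a], hidden from type class resolution. *)
Definition der {R : realType} (f : R -> R) (x a : R) : Prop :=
  is_derive (x : R) 1 f a.

Section RealDerive.
Context {R : realType}.
Implicit Types (f g : R -> R) (x a b c : R).

Lemma der_eq f x a b : der f x a -> a = b -> der f x b.
Proof. by move=> + <-. Qed.

Lemma der_cst c x : der (fun _ => c) x 0.
Proof. exact: is_derive_cst. Qed.

Lemma der_id x : der (fun z => z) x 1.
Proof. exact: is_derive_id. Qed.

Lemma derN f x a : der f x a -> der (fun z => - f z) x (- a).
Proof. by move=> fa; exact: is_deriveN. Qed.

Lemma derD f g x a b : der f x a -> der g x b ->
  der (fun z => f z + g z) x (a + b).
Proof. by move=> fa gb; exact: is_deriveD. Qed.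

Lemma derM f g x a b : der f x a -> der g x b ->
  der (fun z => f z * g z) x (a * g x + f x * b).
Proof.
rewrite /der => fa gb; have h := is_deriveM fa gb; apply: (is_derive_eq h).
by rewrite /GRing.scale/= addrC; congr (_ + _); exact: mulrC.
Qed.

Lemma derV f x a : f x != 0 -> der f x a ->
  der (fun z => (f z)^-1) x (- a / f x ^+ 2).
Proof.
rewrite /der => f0 fa; have h := is_deriveV f0 fa; apply: (is_derive_eq h).
by rewrite /GRing.scale/= mulNr mulrC mulNr.
Qed.

Lemma der_comp f g x a b : der f (g x) a -> der g x b ->
  der (fun z => f (g z)) x (a * b).
Proof. by rewrite /der => fa gb; exact: (@is_derive1_comp _ f g). Qed.

Lemma derX f n x a : der f x a ->
  der (fun z => f z ^+ n) x (n%:R * f x ^+ n.-1 * a).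
Proof.
rewrite /der => fa; have := @is_deriveX _ _ f n _ _ _ fa.
by rewrite (_ : f ^+ n = (fun z => f z ^+ n))//; apply/funext => z; rewrite fctE.
Qed.

Lemma der_sqrt f x a : 0 < f x -> der f x a ->
  der (fun z => Num.sqrt (f z)) x (a / (2 * Num.sqrt (f x))).
Proof.
move=> f0 fa; have sd := is_derive1_sqrt f0.
have h := @der_comp Num.sqrt f _ _ _ sd fa; apply: (der_eq h).
by rewrite mulrC.
Qed.

Lemma der_cont f x a : der f x a -> {for x, continuous f}.
Proof. by case=> fa _; exact/differentiable_continuous/derivable1_diffP. Qed.

Lemma der_derive1 f x a : der f x a -> derive1 f x = a.
Proof. by case=> _; rewrite derive1E. Qed.

Lemma derivable_der f x : derivable f x 1 -> der f x (derive1 f x).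
Proof. by move=> df; rewrite derive1E; apply: DeriveDef. Qed.

End RealDerive.

(** Differentiation by the shape of the expression. Known derivatives come from the context; what
    remains is the side conditions of inverses and square roots, then the equality of the computed
    derivative with the stated one. The case [GRing.mul ?c] catches products that were
    eta-reduced. *)
Ltac der_step := match goal with
  | |- der (fun z => (_ + _)%R) _ _ => eapply derD
  | |- der (fun z => (- _)%R) _ _ => eapply derN
  | |- der (fun z => (_ * _)%R) _ _ => eapply derM
  | |- der (fun z => (_ ^-1)%R) _ _ => eapply derV
  | |- der (fun z => (_ ^+ _)%R) _ _ => eapply derX
  | |- der (fun z => Num.sqrt _) _ _ => eapply der_sqrt
  | |- der (GRing.mul ?c) _ _ => eapply (@derM _ (fun _ => c) (fun z => z))
  | |- der (fun z => z) _ _ => eapply der_id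
  | |- der (fun z => ?c) _ _ => eapply der_cst
  end.
Ltac der_auto := eapply der_eq; [repeat first [eassumption | der_step]|].

(** * Change of variable in one-dimensional integrals *)

Section IntegralHelpers.
Context {R : realType}.

Lemma ge0_integral_setIC d (T : measurableType d) (m : {measure set T -> \bar R})
    (D S : set T) (f : T -> \bar R) : measurable (S `&` D) ->
  measurable (~` S `&` D) ->
  measurable_fun D f -> (forall x, D x -> (0 <= f x)%E) ->
  (\int[m]_(x in S `&` D) f x + \int[m]_(x in ~` S `&` D) f x =
   \int[m]_(x in D) f x)%E.
Proof.
move=> mD mS mf f0; rewrite -ge0_integral_setU.
- by rewrite -setIUl setUv setTI.
- exact: mD.
- exact: mS.
- by rewrite -setIUl setUv setTI.
- by rewrite -setIUl setUv setTI.
- by apply/disj_setPS => x [[Sx _] []].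
Qed.

Lemma adde_fin_eq (x y y' : \bar R) : (x + y)%E \is a fin_num ->
  (x + y = x + y')%E -> y = y'.
Proof.
by case: x y y' => [x| |] [y| |] [y'| |]// _ [] /addrI ->.
Qed.

End IntegralHelpers.

Section Substitution.
Context {R : realType}.
Variables (phi dphi k : R -> R) (a b : R).
Hypothesis phi_derive : {in `]a, b[, forall x : R, is_derive x 1 phi (dphi x)}.
Hypothesis dphi_gt0 : {in `]a, b[, forall x, 0 < dphi x}.
Hypothesis dphi_cont : {in `]a, b[, continuous dphi}.
Hypothesis k_cont : {in `]a, b[, forall x, {for phi x, continuous k}}.
Hypothesis k_ge0 : {in `]a, b[, forall x, 0 <= k (phi x)}.
Notation mu := (@lebesgue_measure R).

Let phi_cont : {in `]a, b[, continuous phi}.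
Proof.
move=> x xab; apply/differentiable_continuous/derivable1_diffP.
by have [] := @phi_derive x xab.
Qed.

Let segW c d : a < c -> d < b -> forall x, x \in `[c, d] -> x \in `]a, b[.
Proof. by move=> ac db x; rewrite !in_itv/= => /andP[]; lra. Qed.

Let phi_seg c d : a < c -> d < b -> {within `[c, d], continuous phi}.
Proof.
move=> ac db; apply: derivable_within_continuous => x /(@segW _ _ ac db).
by case/phi_derive.
Qed.

Lemma subst_incr : {in `]a, b[ &, {homo phi : x y / x < y}}.
Proof.
move=> x y xab yab xy.
have ax : a < x by move: xab; rewrite in_itv/= => /andP[].
have yb : y < b by move: yab; rewrite in_itv/= => /andP[].
have sub z : z \in `]x, y[ -> z \in `]a, b[.
  by rewrite !in_itv/= => /andP[]; lra.
have [|c /sub cxy e] := @MVT _ phi dphi x y xy _ (@phi_seg _ _ ax yb).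
  by move=> z /sub; exact: phi_derive.
rewrite -subr_gt0 e; apply: mulr_gt0; first exact: dphi_gt0.
by rewrite subr_gt0.
Qed.

Let phi_le : {in `]a, b[ &, {mono phi : x y / x <= y}}.
Proof. exact: le_mono_in subst_incr. Qed.

Let dphi_eq : {in `]a, b[, forall x, \forall y \near x, derive1 phi y = dphi y}.
Proof.
move=> x xab; apply: filterS (near_in_itvoo xab) => y yab.
by rewrite derive1E; have [_ ->] := @phi_derive y yab.
Qed.

Let dphi'_cont : {in `]a, b[, continuous (derive1 phi)}.
Proof.
move=> x xab; rewrite /continuous_at.
have e := @dphi_eq x xab.
rewrite (nbhs_singleton e).
apply: cvg_trans (@dphi_cont x xab); apply: near_eq_cvg.
by apply: filterS e => y ->.
Qed.

Let subst_segment c d : a < c -> c <= d -> d < b ->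
  (\int[mu]_(x in `[phi c, phi d]) (k x)%:E =
   \int[mu]_(x in `[c, d]) (k (phi x) * dphi x)%:E)%E.
Proof.
move=> ac cd db.
have sub := @segW c d ac db.
have cin : c \in `]a, b[ by apply: sub; rewrite in_itv/= lexx.
have din : d \in `]a, b[ by apply: sub; rewrite in_itv/= lexx andbT.
have subo x : x \in `]c, d[ -> x \in `]a, b[.
  by rewrite !in_itv/= => /andP[]; lra.
etransitivity.
  apply: (@integration_by_substitution_increasing _ phi k c d cd).
  - by move=> x y /sub xab /sub yab; exact: subst_incr.
  - by move=> x /subo; exact: dphi'_cont.
  - apply/cvg_ex; exists (derive1 phi c); apply: cvg_at_right_filter.
    exact: dphi'_cont.
  - apply/cvg_ex; exists (derive1 phi d); apply: cvg_at_left_filter.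
    exact: dphi'_cont.
  - split; first by move=> x /subo /phi_derive[].
      by apply: cvg_at_right_filter; exact: phi_cont.
    by apply: cvg_at_left_filter; exact: phi_cont.
  - apply: continuous_in_subspaceT => x; rewrite inE/= => xcd.
    have [|y yin <-] := @IVT _ phi c d x cd (@phi_seg c d ac db).
      move: xcd; rewrite in_itv/=; have := @phi_le c d cin din; rewrite cd => cd'.
      by rewrite (min_idPl _)// (max_idPr _).
    exact/k_cont/sub.
apply: eq_integral => x; rewrite inE/= => /sub xab.
by rewrite /= !fctE (nbhs_singleton (@dphi_eq x xab)).
Qed.

Let cont_measurable (f : R -> R) : {in `]a, b[, continuous f} ->
  measurable_fun `]a, b[ f.
Proof.
by move=> cf; apply: open_continuous_measurable_fun => // x /[!inE]; exact: cf.
Qed.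

Let mdens : measurable_fun `]a, b[ (fun x => (k (phi x) * dphi x)%:E).
Proof.
apply/measurable_EFinP; apply: cont_measurable => x xab; apply: cvgM.
  by apply: continuous_comp; [exact: phi_cont|exact: k_cont].
exact: dphi_cont.
Qed.

Let dens_ge0 x : x \in `]a, b[ -> (0 <= (k (phi x) * dphi x)%:E)%E.
Proof.
by move=> xab; rewrite lee_fin mulr_ge0//; [exact: k_ge0|apply/ltW; exact: dphi_gt0].
Qed.

Let mpre A : measurable A -> measurable (`]a, b[ `&` phi @^-1` A).
Proof. by move=> mA; apply: (cont_measurable phi_cont) => //. Qed.

(** Later integrands carry the indicator of a measurable set, so the formula on segments is not
    enough. Both sides behave as finite measures in [A], so Dynkin induction applies, with the open
    rays $]-\infty, x[$ as pi-system. *)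
Let dyn c d (ac : a < c) (cd : c <= d) (db : d < b) A : measurable A ->
  (\int[mu]_(x in A `&` `[phi c, phi d]) (k x)%:E =
   \int[mu]_(x in phi @^-1` A `&` `[c, d]) (k (phi x) * dphi x)%:E)%E.
Proof.
have sub := @segW c d ac db.
have cin : c \in `]a, b[ by apply: sub; rewrite in_itv/= lexx.
have din : d \in `]a, b[ by apply: sub; rewrite in_itv/= lexx andbT.
have imgseg x : x \in `[phi c, phi d] -> exists2 y, y \in `[c, d] & phi y = x.
  move=> xcd; have [|y yin <-] := @IVT _ phi c d x cd (@phi_seg c d ac db).
    move: xcd; rewrite in_itv/=; have := @phi_le c d cin din; rewrite cd => cd'.
    by rewrite (min_idPl _)// (max_idPr _).
  by exists y.
have phiseg x : x \in `[c, d] -> phi x \in `[phi c, phi d].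
  by move=> xcd; have := xcd; rewrite !in_itv/= !phi_le// sub.
have kseg : {within `[phi c, phi d], continuous k}.
  apply: continuous_in_subspaceT => x; rewrite inE/= => /imgseg[y yin <-].
  exact/k_cont/sub.
have mk : measurable_fun `[phi c, phi d] (fun x => (k x)%:E).
  by apply/measurable_EFinP; apply: subspace_continuous_measurable_fun.
have kk x : x \in `[phi c, phi d] -> (0 <= (k x)%:E)%E.
  by move=> /imgseg[y yin <-]; rewrite lee_fin; exact/k_ge0/sub.
have subset_ab : `[c, d] `<=` `]a, b[ by move=> x /= /sub.
have mp A' : measurable A' -> measurable (phi @^-1` A' `&` `[c, d]).
  move=> mA'; rewrite setIC -(setIidl subset_ab) -setIA.
  by apply: measurableI => //; exact: mpre.
have mD : measurable_fun `[c, d] (fun x => (k (phi x) * dphi x)%:E).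
  exact: measurable_funS mdens.
have fin : (\int[mu]_(x in `[phi c, phi d]) (k x)%:E \is a fin_num)%E.
  apply: integrable_fin_num => //; apply: continuous_compact_integrable.
    exact: segment_compact.
  exact: kseg.
pose P A := (\int[mu]_(x in A `&` `[phi c, phi d]) (k x)%:E =
   \int[mu]_(x in phi @^-1` A `&` `[c, d]) (k (phi x) * dphi x)%:E)%E.
have PT : P setT by rewrite /P preimage_setT !setTI; exact: subst_segment.
have mE : (measurable : set (set R)) = <<s @RGenInftyO.G R >>.
  exact: RGenInftyO.measurableE.
rewrite mE; suff H S : <<s @RGenInftyO.G R >> S -> P S by exact: H.
move: S; apply: (@dynkin_induction _ _ (@RGenInftyO.G R) P mE _ PT).
- move=> _ _ [x ->] [y ->]; exists (Num.min x y).
  by apply/seteqP; split => z /=; rewrite !in_itv/= lt_min => /andP.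
- move=> _ [x ->]; rewrite /P.
  (* The ray misses the image of the segment, contains it, or ends inside it at some [phi e]; the
     last case is the segment formula between [c] and [e]. *)
  have [xc|cx] := leP x (phi c).
    rewrite [X in integral mu X](_ : _ = set0); last first.
      by apply/seteqP; split => z //=; rewrite !in_itv/= => -[zx /andP[cz _]]; lra.
    rewrite [X in _ = integral mu X _](_ : _ = set0) ?integral_set0//.
    apply/seteqP; split => z //= -[+ zcd]; rewrite in_itv/= => zx.
    by have := phiseg _ zcd; rewrite in_itv/= => /andP[]; lra.
  have [dx|xd] := ltP (phi d) x.
    rewrite [X in integral mu X](_ : _ = `[phi c, phi d]%classic); last first.
      apply/seteqP; split => z /=; rewrite !in_itv/=; first by case.
      by move=> /andP[-> zd]; rewrite zd; split => //; exact: le_lt_trans dx.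
    rewrite [X in _ = integral mu X _](_ : _ = `[c, d]%classic) ?subst_segment//.
    apply/seteqP; split => z /=; rewrite !in_itv/=; first by case.
    move=> zcd; split => //; have := phiseg z; rewrite !in_itv/= => /(_ zcd) /andP[_ zd].
    exact: le_lt_trans dx.
  have /imgseg[e ecd ex] : x \in `[phi c, phi d] by rewrite in_itv/= xd ltW.
  have eab := sub _ ecd.
  move: (ecd); rewrite in_itv/= => /andP[ce ed].
  rewrite [X in integral mu X](_ : _ = `[phi c, x[%classic); last first.
    apply/seteqP; split => z /=; rewrite !in_itv/=.
      by move=> [zx /andP[-> _]].
    by move=> /andP[-> zx]; split => //; rewrite (le_trans (ltW zx)).
  rewrite [X in _ = integral mu X _](_ : _ = `[c, e[%classic); last first.
    apply/seteqP; split => z /=; rewrite !in_itv/=.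
      move=> [zx zcd]; case/andP: (zcd) => -> zd /=.
      by move: zx; rewrite -ex !ltNge phi_le ?sub// in_itv/=.
    move=> /andP[cz ze]; have zcd : z \in `[c, d] by rewrite in_itv/=; lra.
    by split => //; rewrite -ex subst_incr// sub.
  rewrite integral_itv_bndo_bndc; last first.
    apply: measurable_funS mk => // z /=; rewrite !in_itv/=; lra.
  rewrite integral_itv_bndo_bndc; last first.
    apply: measurable_funS mD => // z /=; rewrite !in_itv/=; lra.
  by rewrite -ex subst_segment//; lra.
- move=> S mS PS; rewrite /P.
  have mS' : measurable (S `&` `[phi c, phi d]) by exact: measurableI.
  have mSc : measurable (~` S `&` `[phi c, phi d]).
    by apply: measurableI => //; exact: measurableC.
  (* The whole integral is finite, so the part over [S] can be cancelled. *)
  apply: (@adde_fin_eq R (\int[mu]_(x in S `&` `[phi c, phi d]) (k x)%:E)%E).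
    by rewrite ge0_integral_setIC.
  have mpc : measurable (~` (phi @^-1` S) `&` `[c, d]).
    by rewrite preimage_setC; apply: mp; exact: measurableC.
  have mpS := mp _ mS.
  have ge0 x : x \in `[c, d] -> (0 <= (k (phi x) * dphi x)%:E)%E.
    by move=> /sub /dens_ge0.
  rewrite ge0_integral_setIC// PS -preimage_setC ge0_integral_setIC//.
  exact: subst_segment.
- move=> F mF tF PF; rewrite /P preimage_bigcup !setI_bigcupl.
  have triv (G : (set R)^nat) D : trivIset setT G -> trivIset setT (fun n => G n `&` D).
    by move=> tG i j _ _ [x [[Gi _] [Gj _]]]; apply: tG => //; exists x.
  have mFI n : measurable (F n `&` `[phi c, phi d]) by exact: measurableI.
  rewrite ge0_integral_bigcup; last 4 first.
  - exact: mFI.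
  - by apply: measurable_funS mk => // x [n _ []].
  - by move=> x [n _ [_ /kk]].
  - exact: triv.
  rewrite ge0_integral_bigcup; last 4 first.
  - by move=> n; exact: mp.
  - by apply: measurable_funS mD => // x [n _ []].
  - by move=> x [n _ [_ /sub /dens_ge0]].
  - apply: triv => i j _ _ [x [Fi Fj]]; apply: tF => //; by exists (phi x).
  by apply: eq_eseriesr => n _; exact: PF.
Qed.

(* Exhaustion of the open interval by segments. *)
Lemma integral_subst A : measurable A ->
  (\int[mu]_(x in A `&` phi @` `]a, b[) (k x)%:E =
   \int[mu]_(x in phi @^-1` A `&` `]a, b[) (k (phi x) * dphi x)%:E)%E.
Proof.
move=> mA.
have [ba|ab] := leP b a.
  rewrite (_ : `]a, b[%classic = set0); last first.
    by apply/seteqP; split => z //=; rewrite in_itv/= => /andP[]; lra.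
  by rewrite image_set0 !setI0 !integral_set0.
(* With 3 in the denominator, [h n * 2 < b - a] holds from [n = 0] on, so that every segment from
   [a + h n] to [b - h n] is nonempty. *)
pose h n : R := (b - a) / (n%:R + 3).
have h0 n : 0 < h n.
  by rewrite /h divr_gt0// ?subr_gt0// ltr_wpDl.
have h3 n : h n * 2 < b - a.
  rewrite /h -mulrA gtr_pMr ?subr_gt0// ltr_pdivrMl ?mulr1 ltr_wpDl//.
  by rewrite ltr_nat.
have hle m n : (m <= n)%N -> h n <= h m.
  move=> mn; rewrite /h ler_pM2l ?subr_gt0// lef_pV2 ?posrE ?ltr_wpDl//.
  by rewrite lerD2r ler_nat.
have hlim e : 0 < e -> exists n, h n < e.
  move=> e0; exists (Num.trunc ((b - a) / e)).
  rewrite /h ltr_pdivrMr ?ltr_wpDl// mulrC -ltr_pdivrMr//.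
  apply: (lt_le_trans (truncnS_gt _)).
  by rewrite -natr1 lerD2l ler1n.
pose c n := a + h n; pose d n := b - h n.
have ac n : a < c n by rewrite /c ltrDl.
have db n : d n < b by rewrite /d ltrBlDr ltrDl.
have cd n : c n <= d n by have := h3 n; rewrite /c /d; lra.
have sub n := @segW (c n) (d n) (ac n) (db n).
have ex x : x \in `]a, b[ -> exists n, x \in `[c n, d n].
  rewrite in_itv/= => /andP[ax xb].
  have [|n hn] := hlim (Num.min (x - a) (b - x)).
    by rewrite lt_min !subr_gt0 ax.
  exists n; move: hn; rewrite lt_min /c /d in_itv/= => /andP[]; lra.
have EL : A `&` phi @` `]a, b[ = \bigcup_n (A `&` `[phi (c n), phi (d n)]).
  rewrite -setI_bigcupr; congr (_ `&` _); apply/seteqP; split => z /=.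
    move=> [x /ex[n xn] <-]; exists n => //=; rewrite in_itv/=.
    move: (xn); rewrite in_itv/= => /andP[cx xd].
    by rewrite !phi_le ?cx// (sub n)// in_itv/= ?lexx ?cd.
  move=> [n _ /= zn].
  have cin : c n \in `]a, b[ by apply: (sub n); rewrite in_itv/= lexx cd.
  have din : d n \in `]a, b[ by apply: (sub n); rewrite in_itv/= lexx cd.
  have [|y /(sub n) yin <-] := @IVT _ phi _ _ z (cd n) (@phi_seg _ _ (ac n) (db n)).
    move: zn; rewrite in_itv/=; have := @phi_le (c n) (d n) cin din.
    by rewrite cd => cd'; rewrite (min_idPl _)// (max_idPr _).
  by exists y.
have ER : phi @^-1` A `&` `]a, b[ = \bigcup_n (phi @^-1` A `&` `[c n, d n]).
  rewrite -setI_bigcupr; congr (_ `&` _); apply/seteqP; split => z /=.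
    by move=> /ex[n zn]; exists n.
  by move=> [n _ /= /(sub n)].
have ccl m n : (m <= n)%N -> c n <= c m by move=> /hle; rewrite /c lerD2l.
have ddl m n : (m <= n)%N -> d m <= d n by move=> /hle; rewrite /d lerD2l lerN2.
have mI n : measurable (`[phi (c n), phi (d n)]%classic : set R) by [].
have cin n : c n \in `]a, b[ by apply: (sub n); rewrite in_itv/= lexx cd.
have din n : d n \in `]a, b[ by apply: (sub n); rewrite in_itv/= lexx cd.
have imgseg n x : x \in `[phi (c n), phi (d n)] -> exists2 y, y \in `]a, b[ & phi y = x.
  move=> zn; have [|y /(sub n) yin <-] := @IVT _ phi _ _ x (cd n) (@phi_seg _ _ (ac n) (db n)).
    move: zn; rewrite in_itv/=; have := @phi_le (c n) (d n) (cin n) (din n).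
    by rewrite cd => cd'; rewrite (min_idPl _)// (max_idPr _).
  by exists y.
have mAI n : measurable (A `&` `[phi (c n), phi (d n)]) by exact: measurableI.
have cvL := @ge0_nondecreasing_set_cvg_integral _ (measurableTypeR R) R
   (fun n => A `&` `[phi (c n), phi (d n)]) (fun x => (k x)%:E) mu.
have cvR := @ge0_nondecreasing_set_cvg_integral _ (measurableTypeR R) R
   (fun n => phi @^-1` A `&` `[c n, d n]) (fun x => (k (phi x) * dphi x)%:E) mu.
rewrite EL ER.
transitivity (limn (fun n => \int[mu]_(x in A `&` `[phi (c n), phi (d n)]) (k x)%:E)%E).
  apply/esym/cvg_lim => //; refine (cvL _ _ _ _).
  - move=> m n mn; apply/subsetPset => x /= [Ax]; rewrite !in_itv/= => /andP[cx xd].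
    split => //; apply/andP; split.
      by apply: le_trans cx; rewrite phi_le ?ccl.
    by apply: (le_trans xd); rewrite phi_le ?ddl.
  - by move=> n; exact: measurableI.
  - move=> n; apply/measurable_EFinP.
    apply: (@measurable_funS _ _ _ _ `[phi (c n), phi (d n)]%classic) => //.
    apply: subspace_continuous_measurable_fun => //.
    apply: continuous_in_subspaceT => x; rewrite inE/= => /imgseg[y yin <-].
    exact/k_cont.
  - by move=> n x [_ /imgseg[y yin <-]]; rewrite lee_fin; exact: k_ge0.
transitivity (limn (fun n => \int[mu]_(x in phi @^-1` A `&` `[c n, d n]) (k (phi x) * dphi x)%:E)%E).
  by congr (limn _); apply/funext => n; exact: dyn.
apply/cvg_lim => //; refine (cvR _ _ _ _).
  - move=> m n mn; apply/subsetPset => x /= [Ax]; rewrite !in_itv/= => /andP[cx xd].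
    by split => //; rewrite (le_trans (ccl _ _ mn))// (le_trans xd)// ddl.
  - move=> n; rewrite (_ : _ `&` _ = (`]a, b[ `&` phi @^-1` A) `&` `[c n, d n]).
      by apply: measurableI => //; exact: mpre.
    by apply/seteqP; split => x /= []; [move=> ? /[dup] /sub|move=> []].
  - by move=> n; apply: measurable_funS mdens => // x [_ /sub].
  - by move=> n x [_ /sub /dens_ge0].
Qed.

End Substitution.

(** * Area in the gnomonic chart *)

Section IntegralTools.
Context {R : realType}.
Notation mu := (@lebesgue_measure R).
Notation mR := (measurableTypeR R).

Lemma measurable_invr : measurable_fun [set: R] (@GRing.inv R).
Proof.
rewrite -(setvU [set 0%R]); apply/measurable_funU => //; first exact: measurableC.
split; last exact: measurable_fun_set1.
apply: open_continuous_measurable_fun.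
  by apply: closed_openC; exact: closed_eq.
by move=> x; rewrite inE/= => /eqP x0; exact: inv_continuous.
Qed.

Lemma measurable_sqrtr : measurable_fun [set: R] (@Num.sqrt R).
Proof. by apply: continuous_measurable_fun; exact: sqrt_continuous. Qed.

(** Domains are carried as indicator factors: a change of domain becomes a pointwise comparison, and
    the integrand may take any default value outside. *)
Lemma integral_indicM d (T : measurableType d) (m : {measure set T -> \bar R})
    (D : set T) (f : T -> R) :
  (\int[m]_(x in D) (f x)%:E = \int[m]_x (\1_D x * f x)%:E)%E.
Proof.
rewrite integral_mkcond; apply: eq_integral => x _.
by rewrite patchE indicE; case: ifPn => _; rewrite ?mul1r ?mul0r.
Qed.

Lemma integral_reflect (f : R -> \bar R) : measurable_fun setT f ->
  (forall x, (0 <= f x)%E) -> (\int[mu]_x f (- x)%R = \int[mu]_x f x)%E.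
Proof.
move=> mf f0.
transitivity (\int[pushforward mu (-%R : R -> mR)]_x f x)%E.
  by rewrite ge0_integral_pushforward// preimage_setT.
by apply: eq_measure_integral => //= A mA _; exact: lebesgue_measureN.
Qed.

Lemma integral_subst_indic (phi dphi k : R -> R) (a b : R) (D : set R) :
  {in `]a, b[, forall x : R, is_derive x 1 phi (dphi x)} ->
  {in `]a, b[, forall x, 0 < dphi x} ->
  {in `]a, b[, continuous dphi} ->
  {in `]a, b[, forall x, {for phi x, continuous k}} ->
  {in `]a, b[, forall x, 0 <= k (phi x)} ->
  measurable D -> D `<=` phi @` `]a, b[ ->
  (\int[mu]_u (\1_D u * k u)%:E =
   \int[mu]_x (\1_(phi @^-1` D `&` `]a, b[) x * (k (phi x) * dphi x))%:E)%E.
Proof.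
move=> dp p0 cp ck k0 mD Dab.
by rewrite -!integral_indicM -(integral_subst dp p0 cp ck k0)// setIidl.
Qed.

End IntegralTools.

Ltac mfun := repeat lazymatch goal with
  | |- measurable_fun _ (fun x => (_ * _)%R) => apply: measurable_funM
  | |- measurable_fun _ (fun x => (_ + - _)%R) => apply: measurable_funB
  | |- measurable_fun _ (fun x => (_ + _)%R) => apply: measurable_funD
  | |- measurable_fun _ (fun x => (- _)%R) => apply: measurable_funN
  | |- measurable_fun _ (fun x => (_ ^+ _)%R) => apply: measurable_funX
  | |- measurable_fun _ (fun x => (_ ^-1)%R) =>
      apply: (measurableT_comp measurable_invr)
  | |- measurable_fun _ (fun x => Num.sqrt _) =>
      apply: (measurableT_comp measurable_sqrtr)
  | |- measurable_fun _ (fun x => x.1) => exact: measurable_fst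
  | |- measurable_fun _ (fun x => x.2) => exact: measurable_snd
  | |- measurable_fun _ fst => exact: measurable_fst
  | |- measurable_fun _ snd => exact: measurable_snd
  | |- measurable_fun _ (fun x => x) => exact: measurable_id
  | |- measurable_fun _ _ => exact: measurable_cst
  end.

Section GnomonicArea.
Context {R : realType}.
Notation mu := (@lebesgue_measure R).
Notation mR := (measurableTypeR R).
Implicit Types K x y : R.

Lemma measurable_ltr_set d (T : measurableType d) (f g : T -> R) :
  measurable_fun setT f -> measurable_fun setT g ->
  measurable [set x | f x < g x].
Proof.
move=> mf mg; have := measurable_fun_ltr mf mg => /(_ measurableT [set true]).
rewrite setTI; exact.
Qed.

Lemma measurable_set_pair d (T : measurableType d) (f g : T -> R) (E : set (mR * mR)) :
  measurable_fun setT f -> measurable_fun setT g -> measurable E ->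
  measurable [set x | E (f x, g x)].
Proof.
move=> mf mg mE.
have := measurable_fun_pair mf mg => /(_ measurableT E mE).
by rewrite setTI.
Qed.

Definition gN (K x y : R) := 1 + K * (x ^+ 2 + y ^+ 2).
(* Riemannian area density of the gnomonic chart: the power -3/2 of [gN]. *)
Definition gdens (K x y : R) := (gN K x y * Num.sqrt (gN K x y))^-1.
Definition garea (K : R) (E : set (mR * mR)) : \bar R :=
  (\int[(mu \x mu)%E]_z (\1_E z * gdens K z.1 z.2)%:E)%E.

(* [lifted K E] is [E] in the coordinates [(x, y / sqrt (gN K x y))]; they reduce
   each change of chart to two substitutions in one variable. *)
Definition unlift (K x y : R) :=
  y * Num.sqrt (1 + K * x ^+ 2) / Num.sqrt (1 - K * y ^+ 2).
Definition lifted (K : R) (E : set (mR * mR)) (z : mR * mR) : Prop :=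
  0 < 1 - K * z.2 ^+ 2 /\ E (z.1, unlift K z.1 z.2).

Definition in_box (a1 b1 a2 b2 : R) (E : set (mR * mR)) :=
  forall z, E z -> (z.1 \in `]a1, b1[) /\ (z.2 \in `]a2, b2[).

(** For [K = -1] the chart is the open unit disk. The sets considered lie in rectangles inside it,
    so that the variables range over intervals, as the substitutions in one variable require. *)
Definition good_box (K a1 b1 a2 b2 : R) :=
  forall x y : R, x \in `]a1, b1[ -> y \in `]a2, b2[ -> 0 < gN K x y.

Lemma measurable_lifted K E : measurable E -> measurable (lifted K E).
Proof.
move=> mE; apply: measurableI.
  by apply: measurable_ltr_set; mfun.
by apply: measurable_set_pair => //; rewrite /unlift; mfun.
Qed.

Lemma gdens_ge0 K x y : 0 < gN K x y -> 0 <= gdens K x y.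
Proof. by move=> N0; rewrite invr_ge0 mulr_ge0 ?sqrtr_ge0// ltW. Qed.

Lemma gN_gt0_1 K x y : 0 < gN K x y -> 0 < 1 + K * x ^+ 2.
Proof.
rewrite /gN => N0; have [K0|K0] := leP 0 K.
  by rewrite ltr_wpDr// mulr_ge0// sqr_ge0.
have : K * y ^+ 2 <= 0 by rewrite mulr_le0_ge0 ?sqr_ge0// ltW.
by move: N0; rewrite mulrDr; lra.
Qed.

Lemma measurable_garea_fun K (E : set (mR * mR)) : measurable E ->
  measurable_fun setT (fun z : mR * mR => (\1_E z * gdens K z.1 z.2)%:E).
Proof.
move=> mE; apply/measurable_EFinP; apply: measurable_funM.
  exact: measurable_indic.
by rewrite /gdens /gN; mfun.
Qed.

Lemma indic_mul_ge0 (T : Type) (E : set T) (f : T -> R) (z : T) :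
  (E z -> 0 <= f z) -> (0 <= (\1_E z * f z)%:E)%E.
Proof.
move=> f0; rewrite lee_fin indicE; case: (boolP (z \in E)) => [/set_mem/f0|_].
  by rewrite mul1r.
by rewrite mul0r.
Qed.

Lemma garea_ge0 K a1 b1 a2 b2 (E : set (mR * mR)) z :
  good_box K a1 b1 a2 b2 -> in_box a1 b1 a2 b2 E ->
  (0 <= (\1_E z * gdens K z.1 z.2)%:E)%E.
Proof.
move=> gb ib; apply: (@indic_mul_ge0 _ E (fun z => gdens K z.1 z.2)).
by move=> /ib[z1 z2]; exact/gdens_ge0/gb.
Qed.

Lemma der_gN K x y : der (gN K x) y (2 * K * y).
Proof. by rewrite /gN; der_auto => /=; ring. Qed.

(** Up to the factor [1 + K * x ^+ 2], the quotient is a primitive of the density in [y]; this is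
    the reason for the coordinates of [lifted]. *)
Lemma der_gproj K x y : 0 < gN K x y ->
  der (fun z => z / Num.sqrt (gN K x z)) y ((1 + K * x ^+ 2) * gdens K x y).
Proof.
move=> N0; have s0 : 0 < Num.sqrt (gN K x y) by rewrite sqrtr_gt0.
have dN := der_gN K x y.
der_auto => //; first by rewrite gt_eqF.
have NE : 1 + K * x ^+ 2 = gN K x y - K * y ^+ 2 by rewrite /gN; ring.
rewrite NE /gdens /=; have sE : gN K x y = Num.sqrt (gN K x y) ^+ 2.
  by rewrite sqr_sqrtr// ltW.
move: sE s0; generalize (Num.sqrt (gN K x y)) => s -> s0; field.
by rewrite gt_eqF.
Qed.

(** At fixed [x] the new variable is the primitive of [der_gproj], so the density becomes constant
    on the slice. *)
Lemma lifted_area K a1 b1 a2 b2 E : measurable E -> a2 < b2 ->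
  good_box K a1 b1 a2 b2 -> in_box a1 b1 a2 b2 E ->
  (\int[mu]_x \int[mu]_y (\1_(lifted K E) (x, y) * (1 + K * x ^+ 2)^-1)%:E =
   garea K E)%E.
Proof.
move=> mE ab2 gb ib.
rewrite /garea fubini_tonelli1; last 2 first.
  exact: measurable_garea_fun.
  by move=> z; exact: garea_ge0 gb ib.
apply: eq_integral => x _; rewrite /fubini_F/=.
have [x1|x1] := boolP (x \in `]a1, b1[); last first.
  apply: eq_integral => y _; rewrite !indicE !memNset ?mul0r//.
    by move=> /ib[]; rewrite (negbTE x1).
  by move=> [_ /ib[]]; rewrite (negbTE x1).
have N0 y : y \in `]a2, b2[ -> 0 < gN K x y by move=> ?; exact: gb.
have A0 : 0 < 1 + K * x ^+ 2.
  apply: (@gN_gt0_1 K x ((a2 + b2) / 2)); apply: N0.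
  by rewrite in_itv/= midf_lt// midf_lt.
pose D : set R := [set y | lifted K E (x, y)].
have mD : measurable D.
  rewrite (_ : D = xsection (lifted K E) x).
    by apply: measurable_xsection; exact: measurable_lifted.
  by apply/seteqP; split => y; rewrite /xsection/= inE.
pose phi y := y / Num.sqrt (gN K x y).
pose dphi y := (1 + K * x ^+ 2) * gdens K x y.
pose k (_ : R) := (1 + K * x ^+ 2)^-1.
transitivity (\int[mu]_y (\1_D y * k y)%:E)%E.
  by apply: eq_integral => y _; rewrite !indicE; congr ((_ _)%:R * _)%:E; rewrite !inE.
have dp : {in `]a2, b2[, forall y : R, is_derive y 1 phi (dphi y)}.
  by move=> y /N0; exact: der_gproj.
have NE y : 1 + K * x ^+ 2 = gN K x y - K * y ^+ 2 by rewrite /gN; ring.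
have phi1 y : y \in `]a2, b2[ -> 1 - K * phi y ^+ 2 = (1 + K * x ^+ 2) / gN K x y.
  move=> /N0 Ny; rewrite /phi expr_div_n sqr_sqrtr ?(ltW Ny)// (NE y).
  by field; rewrite gt_eqF.
have unphi y : y \in `]a2, b2[ -> unlift K x (phi y) = y.
  move=> yab; have Ny := N0 y yab; rewrite /unlift phi1// sqrtrM ?(ltW A0)//.
  rewrite sqrtrV ?(ltW Ny)// /phi; field.
  by rewrite !gt_eqF ?sqrtr_gt0.
rewrite (@integral_subst_indic _ phi dphi k a2 b2 D) //.
- apply: eq_integral => y _.
  have [yab|yab] := boolP (y \in `]a2, b2[); last first.
    rewrite !indicE !memNset ?mul0r//; first by move=> /ib[]; rewrite (negbTE yab).
    by move=> []; rewrite /= (negbTE yab).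
  congr (_%:E); rewrite /k /dphi mulKf ?gt_eqF//; congr (_ * _).
  rewrite !indicE; congr ((_ _)%:R); apply/idP/idP; rewrite !inE /D /lifted/=.
    by move=> [[_]]; rewrite unphi.
  move=> Exy; rewrite unphi// phi1//; split => //; split => //.
  by rewrite divr_gt0// N0.
- move=> y yab; have Ny := N0 y yab.
  by rewrite /dphi /gdens mulr_gt0// invr_gt0 mulr_gt0 ?sqrtr_gt0.
- move=> y yab; apply: cvgM; first exact: cvg_cst.
  have Ny := N0 y yab.
  have cN : {for y, continuous (gN K x)}.
    by apply: der_cont (der_gN K x y).
  apply: cvgV; first by rewrite mulf_neq0 ?gt_eqF ?sqrtr_gt0.
  by apply: cvgM => //; apply: continuous_comp => //; exact: sqrt_continuous.
- by move=> y yab; exact: cvg_cst.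
- by move=> y yab; rewrite invr_ge0 ltW.
- move=> y [y0 Ey]; exists (unlift K x y); first by case/ib: Ey.
  have [_ /N0] := ib _ Ey; rewrite /= => Nu.
  have eN : gN K x (unlift K x y) = (1 + K * x ^+ 2) / (1 - K * y ^+ 2).
    rewrite /gN /unlift !expr_div_n exprMn !sqr_sqrtr ?ltW//; field.
    by rewrite gt_eqF.
  rewrite /phi eN sqrtrM ?(ltW A0)// sqrtrV ?ltW// /unlift; field.
  by rewrite !gt_eqF ?sqrtr_gt0.
Qed.

End GnomonicArea.

(** * The gnomonic chart centred on the third axis *)

Section PoleChart.
Context {R : realType}.
Notation mu := (@lebesgue_measure R).
Notation mR := (measurableTypeR R).
Implicit Types K x y : R.

(** Square of the third coordinate of a point of the surface over [z], in the three models at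
    once. *)
Definition hgt2 K (z : mR * mR) : R := 1 - K * z.1 ^+ 2 - K * z.2 ^+ 2.
Definition hgt K (z : mR * mR) : R := Num.sqrt (hgt2 K z).

(** In both charts treated below, the second lifted coordinate is the second coordinate of the plane
    chart. Integrating over it last leaves a substitution in the first coordinate only. *)
Lemma lifted_area_swap K a1 b1 a2 b2 E : measurable E -> a2 < b2 ->
  good_box K a1 b1 a2 b2 -> in_box a1 b1 a2 b2 E ->
  (\int[mu]_y \int[mu]_x (\1_(lifted K E) (x, y) * (1 + K * x ^+ 2)^-1)%:E =
   garea K E)%E.
Proof.
move=> mE ab2 gb ib; rewrite -(lifted_area mE ab2 gb ib).
pose f (z : mR * mR) := (\1_(lifted K E) z * (1 + K * z.1 ^+ 2)^-1)%:E.
rewrite -[LHS]/(\int[mu]_y \int[mu]_x f (x, y))%E -fubini_tonelli//.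
  apply/measurable_EFinP; apply: measurable_funM; last by mfun.
  by apply: measurable_indic; exact: measurable_lifted.
move=> z; apply: (@indic_mul_ge0 _ _ _ (fun z => (1 + K * z.1 ^+ 2)^-1)).
move=> [_ /ib[z1 z2]]; rewrite invr_ge0 ltW//.
exact/gN_gt0_1/(gb _ _ z1 z2).
Qed.

(* Both area computations below substitute in the first coordinate, the second
   one being fixed. *)
Lemma slice_subst_area K a1 b1 a2 b2 (E D : set (mR * mR)) (k : R -> R -> R)
    (phi dphi : R -> R -> R) :
  measurable E -> a2 < b2 -> good_box K a1 b1 a2 b2 -> in_box a1 b1 a2 b2 E ->
  measurable D ->
  measurable_fun setT (fun z : mR * mR => k z.1 z.2) ->
  (forall x y, D (x, y) -> 0 < 1 - K * y ^+ 2) ->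
  (forall x y, 0 <= k x y) ->
  (forall x y, 0 < 1 - K * y ^+ 2 -> x \in `]a1, b1[ ->
    [/\ der (phi^~ y) x (dphi x y), 0 < dphi x y,
        {for x, continuous (dphi ^~ y)},
        {for phi x y, continuous (k ^~ y)} &
        k (phi x y) y * dphi x y = (1 + K * x ^+ 2)^-1 ]) ->
  (forall x y, 0 < 1 - K * y ^+ 2 -> x \in `]a1, b1[ ->
     D (phi x y, y) <-> E (x, unlift K x y)) ->
  (forall x y, D (x, y) -> exists2 v, v \in `]a1, b1[ & phi v y = x) ->
  (\int[mu]_y \int[mu]_x (\1_D (x, y) * k x y)%:E = garea K E)%E.
Proof.
move=> mE ab2 gb ib mD mk Dy k0 phiP phiD Dphi.
rewrite -(lifted_area_swap mE ab2 gb ib).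
apply: eq_integral => y _.
have [y0|y0] := ltP 0 (1 - K * y ^+ 2); last first.
  apply: eq_integral => x _; rewrite !indicE !memNset ?mul0r//.
    by move=> []; rewrite /= ltNge y0.
  by move=> /Dy; rewrite ltNge y0.
pose Dsl : set R := [set x | D (x, y)].
have mDsl : measurable Dsl.
  rewrite (_ : Dsl = ysection D y); first exact: measurable_ysection.
  by apply/seteqP; split => x; rewrite /ysection/= inE.
transitivity (\int[mu]_x (\1_Dsl x * k x y)%:E)%E.
  by apply: eq_integral => x _; rewrite !indicE; congr ((_ _)%:R * _)%:E; rewrite !inE.
rewrite (@integral_subst_indic _ (phi ^~ y) (dphi ^~ y) (k ^~ y) a1 b1 Dsl) //.
- apply: eq_integral => x _.
  have [xab|xab] := boolP (x \in `]a1, b1[); last first.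
    rewrite !indicE !memNset ?mul0r//; first by move=> [_ /ib[]]; rewrite (negbTE xab).
    by move=> []; rewrite /= (negbTE xab).
  have [_ _ _ _ ->] := phiP x y y0 xab; congr (_ * _)%:E.
  rewrite !indicE; congr ((_ _)%:R); apply/idP/idP; rewrite !inE.
    by move=> [/= Dx _]; split => //; apply/(phiD x y y0 xab).
  by move=> [_ /(phiD x y y0 xab) Dx]; split.
- by move=> x xab; have [] := phiP x y y0 xab.
- by move=> x xab; have [] := phiP x y y0 xab.
- by move=> x xab; have [] := phiP x y y0 xab.
- by move=> x xab; have [] := phiP x y y0 xab.
- by move=> x /Dphi[v vab <-]; exists v.
Qed.

(** The gnomonic coordinates are here $(x_1, x_2) / |x_3|$. *)
Definition pole_dom K (E : set (mR * mR)) (z : mR * mR) : Prop :=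
  0 < hgt2 K z /\ E (z.1 / hgt K z, z.2 / hgt K z).

Lemma measurable_pole_dom K E : measurable E -> measurable (pole_dom K E).
Proof.
move=> mE; apply: measurableI.
  by apply: measurable_ltr_set; rewrite /hgt2; mfun.
by apply: measurable_set_pair => //; rewrite /hgt /hgt2; mfun.
Qed.

Lemma hgt_cont K x y : 0 < hgt2 K (x, y) ->
  {for x, continuous (fun x => (hgt K (x, y))^-1)}.
Proof.
move=> h0; have sh : hgt K (x, y) != 0 by rewrite gt_eqF// sqrtr_gt0.
by apply: der_cont; move: h0 sh; rewrite /hgt /hgt2/= => h0 sh; der_auto.
Qed.

Lemma gdens_cont K y : 0 < gN K 0 y -> {for y, continuous (gdens K 0)}.
Proof.
move=> N0; have s0 : 0 < Num.sqrt (gN K 0 y) by rewrite sqrtr_gt0.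
have dN := der_gN K 0 y.
apply: der_cont; rewrite /gdens; der_auto => //.
by rewrite mulf_neq0// gt_eqF.
Qed.

Lemma pole_area K a1 b1 a2 b2 E : measurable E -> a2 < b2 ->
  good_box K a1 b1 a2 b2 -> in_box a1 b1 a2 b2 E ->
  (\int[(mu \x mu)%E]_z (\1_(pole_dom K E) z * (hgt K z)^-1)%:E = garea K E)%E.
Proof.
move=> mE ab2 gb ib.
have mD := measurable_pole_dom K mE.
rewrite fubini_tonelli2; last 2 first.
  apply/measurable_EFinP; apply: measurable_funM; first exact: measurable_indic.
  by rewrite /hgt /hgt2; mfun.
  move=> z; apply: (@indic_mul_ge0 _ _ _ (fun z => (hgt K z)^-1)) => _.
  by rewrite invr_ge0 sqrtr_ge0.
have J0 x : x \in `]a1, b1[ -> 0 < 1 + K * x ^+ 2.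
  move=> x1; apply: (@gN_gt0_1 _ K x ((a2 + b2) / 2)); apply: gb => //.
  by rewrite in_itv/= midf_lt// midf_lt.
have gN0 x : gN K 0 x = 1 + K * x ^+ 2 by rewrite /gN; ring.
have hphi x y : 0 < 1 - K * y ^+ 2 -> x \in `]a1, b1[ ->
    hgt2 K (x / Num.sqrt (gN K 0 x) * Num.sqrt (1 - K * y ^+ 2), y) = (1 - K * y ^+ 2) / (1 + K * x ^+ 2).
  move=> y0 /J0 x0; rewrite /hgt2/= exprMn expr_div_n gN0 !sqr_sqrtr ?(ltW y0) ?(ltW x0)//.
  by field; rewrite gt_eqF.
have hE x y : 0 < 1 - K * y ^+ 2 -> x \in `]a1, b1[ ->
    hgt K (x / Num.sqrt (gN K 0 x) * Num.sqrt (1 - K * y ^+ 2), y) =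
    Num.sqrt (1 - K * y ^+ 2) / Num.sqrt (1 + K * x ^+ 2).
  move=> y0 xab; rewrite /hgt hphi// sqrtrM ?(ltW y0)// sqrtrV//.
  by rewrite ltW// J0.
(* Solving [x = x_1 / hgt K (x_1, y)] at fixed [y] gives $x_1 = x \sqrt{1 - K y^2} / \sqrt{1 + K
   x^2}$, the substitution used here. *)
apply: (@slice_subst_area K a1 b1 a2 b2 E _ (fun x y => (hgt K (x, y))^-1)
  (fun x y => x / Num.sqrt (gN K 0 x) * Num.sqrt (1 - K * y ^+ 2))
  (fun x y => gdens K 0 x * Num.sqrt (1 - K * y ^+ 2))) => //.
- by rewrite /hgt /hgt2/=; mfun.
- move=> x y [+ _]; rewrite /hgt2/= => h0.
  have [K0|K0] := leP 0 K.
    by have : 0 <= K * x ^+ 2; [rewrite mulr_ge0// sqr_ge0|lra].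
  have : K * y ^+ 2 <= 0; last by lra.
  by rewrite mulr_le0_ge0 ?sqr_ge0// ltW.
- by move=> x y; rewrite invr_ge0 sqrtr_ge0.
- move=> x y y0 xab; have x0 := J0 x xab.
  have sx : 0 < Num.sqrt (1 + K * x ^+ 2) by rewrite sqrtr_gt0.
  have sy : 0 < Num.sqrt (1 - K * y ^+ 2) by rewrite sqrtr_gt0.
  split.
  + have := @der_gproj _ K 0 x; rewrite gN0 => /(_ x0) d1.
    by der_auto => /=; ring.
  + by rewrite mulr_gt0// invr_gt0 gN0 mulr_gt0.
  + by apply: cvgM; [apply: gdens_cont; rewrite gN0|exact: cvg_cst].
  + by apply: hgt_cont; rewrite hphi// divr_gt0.
  + rewrite hE// /gdens gN0.
    by field; rewrite !gt_eqF.
- move=> x y y0 xab; have x0 := J0 x xab.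
  have sx : 0 < Num.sqrt (1 + K * x ^+ 2) by rewrite sqrtr_gt0.
  have sy : 0 < Num.sqrt (1 - K * y ^+ 2) by rewrite sqrtr_gt0.
  rewrite /pole_dom hphi// hE//= gN0.
  rewrite (_ : x / _ * _ / _ = x); last by field; rewrite !gt_eqF.
  rewrite (_ : y / _ = unlift K x y); last by rewrite /unlift; field; rewrite !gt_eqF.
  by split => [[]//|Exy]; split => //; rewrite divr_gt0.
- move=> x y [h0 Exy]; exists (x / hgt K (x, y)); first by case/ib: Exy.
  have [xab _] := ib _ Exy; have := J0 _ xab; rewrite /= => x0.
  have sh : 0 < hgt K (x, y) by rewrite sqrtr_gt0.
  have BE : 1 + K * (x / hgt K (x, y)) ^+ 2 = (1 - K * y ^+ 2) / hgt2 K (x, y).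
    rewrite expr_div_n sqr_sqrtr ?(ltW h0)// /hgt2/=; field.
    by rewrite gt_eqF.
  have y0 : 0 < 1 - K * y ^+ 2.
    by move: x0; rewrite BE; rewrite pmulr_lgt0// invr_gt0.
  rewrite gN0 BE sqrtrM ?(ltW y0)// sqrtrV ?(ltW h0)// -/(hgt K (x, y)); field.
  by rewrite !gt_eqF ?sqrtr_gt0.
Qed.

End PoleChart.

(** * Reflections, and gnomonic charts centred on the equator of the sphere *)

Section Reflections.
Context {R : realType}.
Notation mu := (@lebesgue_measure R).
Notation mR := (measurableTypeR R).
Implicit Types K x y : R.

Definition flip1 (E : set (mR * mR)) (z : mR * mR) : Prop := E (- z.1, z.2).
Definition flip2 (E : set (mR * mR)) (z : mR * mR) : Prop := E (z.1, - z.2).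
Definition flip12 (E : set (mR * mR)) (z : mR * mR) : Prop := E (z.2, z.1).

Lemma measurable_flip1 E : measurable E -> measurable (flip1 E).
Proof. by move=> mE; apply: measurable_set_pair => //; mfun. Qed.

Lemma measurable_flip2 E : measurable E -> measurable (flip2 E).
Proof. by move=> mE; apply: measurable_set_pair => //; mfun. Qed.

Lemma measurable_flip12 E : measurable E -> measurable (flip12 E).
Proof. by move=> mE; apply: measurable_set_pair => //; mfun. Qed.

Definition pos_on K (E : set (mR * mR)) := forall z, E z -> 0 < gN K z.1 z.2.

Lemma pos_garea_ge0 K E z : pos_on K E -> (0 <= (\1_E z * gdens K z.1 z.2)%:E)%E.
Proof.
move=> pE; apply: (@indic_mul_ge0 _ _ E (fun z => gdens K z.1 z.2)).
by move=> /pE; exact: gdens_ge0.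
Qed.

Lemma gN_flip1 K x y : gN K (- x) y = gN K x y.
Proof. by rewrite /gN sqrrN. Qed.

Lemma gN_flip12 K x y : gN K y x = gN K x y.
Proof. by rewrite /gN [y ^+ 2 + _]addrC. Qed.

Lemma indic_mem (T U : Type) (A : set T) (B : set U) a b : (A a <-> B b) ->
  \1_A a = \1_B b :> R.
Proof.
move=> AB; rewrite !indicE; congr ((_ _)%:R).
by apply/idP/idP; rewrite !inE => /AB.
Qed.

Lemma garea_flip1 K E : measurable E -> pos_on K E -> garea K (flip1 E) = garea K E.
Proof.
move=> mE pE.
have pF : pos_on K (flip1 E) by move=> z /pE /=; rewrite gN_flip1.
rewrite /garea fubini_tonelli1; [|by apply: measurable_garea_fun; exact: measurable_flip1|by move=> z; exact: pos_garea_ge0].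
rewrite fubini_tonelli1; [|exact: measurable_garea_fun|by move=> z; exact: pos_garea_ge0].
rewrite -integral_reflect; last 2 first.
- by apply: (measurable_fun_fubini_tonelli_F (fun z => (\1_(flip1 E) z * gdens K z.1 z.2)%:E)); last (by move=> z; exact: pos_garea_ge0); apply: measurable_garea_fun; exact: measurable_flip1.
- by move=> x; apply: integral_ge0 => y _; exact: (pos_garea_ge0 (x, y)).
apply: eq_integral => x _; apply: eq_integral => y _.
rewrite /= /gdens gN_flip1; congr (_ * _)%:E; apply: indic_mem.
by rewrite /flip1/= opprK.
Qed.

Lemma garea_flip12 K E : measurable E -> pos_on K E -> garea K (flip12 E) = garea K E.
Proof.
move=> mE pE.
have pF : pos_on K (flip12 E) by move=> z /pE /=; rewrite gN_flip12.
rewrite /garea fubini_tonelli2; [|by apply: measurable_garea_fun; exact: measurable_flip12|by move=> z; exact: pos_garea_ge0].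
rewrite fubini_tonelli1; [|exact: measurable_garea_fun|by move=> z; exact: pos_garea_ge0].
apply: eq_integral => x _; apply: eq_integral => y _.
rewrite /= /gdens gN_flip12; congr (_ * _)%:E; exact: indic_mem.
Qed.

Lemma garea_flip2 K E : measurable E -> pos_on K E -> garea K (flip2 E) = garea K E.
Proof.
move=> mE pE; have p12 : pos_on K (flip12 E) by move=> z /pE /=; rewrite gN_flip12.
have p1 : pos_on K (flip1 (flip12 E)) by move=> z /p12 /=; rewrite gN_flip1.
rewrite -[LHS]/(garea K (flip12 (flip1 (flip12 E)))) garea_flip12//; last first.
  by apply: measurable_flip1; exact: measurable_flip12.
by rewrite garea_flip1 ?garea_flip12//; exact: measurable_flip12.
Qed.

(* The points with [0 < d * x_1] and [x_3 = - d * hgt 1 (x_1, x_2)]: their gnomonic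
   coordinates [(x_3, x_2) / (d * x_1)] are computed in the chart over the
   [(x_1, x_2)]-plane. *)
Definition hemi_dom (d : R) (E : set (mR * mR)) (z : mR * mR) : Prop :=
  [/\ 0 < hgt2 1 z, 0 < d * z.1 & E (- hgt 1 z / z.1, z.2 / (d * z.1))].

Lemma measurable_hemi_dom d E : measurable E -> measurable (hemi_dom d E).
Proof.
move=> mE.
have -> : hemi_dom d E = [set z | 0 < hgt2 1 z] `&` ([set z | 0 < d * z.1] `&`
    [set z | E (- hgt 1 z / z.1, z.2 / (d * z.1))]).
  by apply/seteqP; split => z; [case|move=> [? []]].
apply: measurableI; first by apply: measurable_ltr_set; rewrite /hgt2; mfun.
apply: measurableI; first by apply: measurable_ltr_set; mfun.
by apply: measurable_set_pair => //; rewrite /hgt /hgt2; mfun.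
Qed.

Lemma gN0E K x : gN K 0 x = 1 + K * x ^+ 2.
Proof. by rewrite /gN; ring. Qed.

Lemma der_gsqrtV x : der (fun z => (Num.sqrt (gN 1 0 z))^-1) x (- x * gdens 1 0 x).
Proof.
have N0 : 0 < gN 1 0 x by rewrite gN0E mul1r ltr_wpDr// sqr_ge0.
have s0 : 0 < Num.sqrt (gN 1 0 x) by rewrite sqrtr_gt0.
have dN := der_gN 1 0 x.
der_auto => //; first by rewrite gt_eqF.
rewrite /gdens /=; have sE : gN 1 0 x = Num.sqrt (gN 1 0 x) ^+ 2.
  by rewrite sqr_sqrtr// ltW.
move: sE s0; generalize (Num.sqrt (gN 1 0 x)) => s -> s0; field.
by rewrite gt_eqF.
Qed.

(** As for [pole_area]: solving $x = -h / x_1$ at fixed $y$, with $h$ the height, gives $x_1 = d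
    \sqrt{1 - y^2} / \sqrt{1 + x^2}$. This increases with $x$ because [d * x < 0], which explains
    the sign chosen in [hemi_dom]. *)
Lemma hemi_area d a1 b1 a2 b2 E : d = 1 \/ d = -1 -> measurable E -> a2 < b2 ->
  {in `]a1, b1[, forall v, d * v < 0} ->
  in_box a1 b1 a2 b2 E ->
  (\int[mu]_y \int[mu]_x (\1_(hemi_dom d E) (x, y) * (hgt 1 (x, y))^-1)%:E = garea 1 E)%E.
Proof.
move=> d1 mE ab2 dv ib.
have dd : d * d = 1 by case: d1 => ->; lra.
have d0 : d != 0 by case: d1 => ->; rewrite ?oppr_eq0 oner_eq0.
have gb : good_box 1 a1 b1 a2 b2.
  by move=> x y _ _; rewrite /gN mul1r ltr_wpDr// addr_ge0// sqr_ge0.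
have mD := measurable_hemi_dom d mE.
have J0 x : 0 < 1 + 1 * x ^+ 2 :> R by rewrite mul1r ltr_wpDr// sqr_ge0.
pose phi x y := d * (Num.sqrt (gN 1 0 x))^-1 * Num.sqrt (1 - 1 * y ^+ 2).
have phiE x y : phi x y = d * Num.sqrt (1 - 1 * y ^+ 2) / Num.sqrt (1 + 1 * x ^+ 2).
  by rewrite /phi gN0E mulrAC.
have hphi x y : 0 < 1 - 1 * y ^+ 2 ->
    hgt2 1 (phi x y, y) = (1 - 1 * y ^+ 2) * x ^+ 2 / (1 + 1 * x ^+ 2).
  move=> y0; have x0 := J0 x.
  rewrite /hgt2/= phiE expr_div_n exprMn -[d ^+ 2]/(d * d) dd.
  rewrite !sqr_sqrtr ?(ltW y0) ?(ltW x0)//.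
  by field; rewrite mul1r in x0; rewrite gt_eqF.
have hE x y : 0 < 1 - 1 * y ^+ 2 -> x \in `]a1, b1[ ->
    hgt 1 (phi x y, y) = - d * x * Num.sqrt (1 - 1 * y ^+ 2) / Num.sqrt (1 + 1 * x ^+ 2).
  move=> y0 /dv dx; have x0 := J0 x.
  rewrite /hgt hphi// sqrtrM; last by rewrite mulr_ge0 ?sqr_ge0// ltW.
  rewrite sqrtrM ?(ltW y0)// sqrtrV ?(ltW x0)//.
  suff -> : Num.sqrt (x ^+ 2) = - d * x by congr (_ / _); rewrite mulrC.
  rewrite -[x ^+ 2]mul1r -dd (_ : d * d * x ^+ 2 = (- d * x) ^+ 2); last by ring.
  by rewrite sqrtr_sqr ger0_norm// mulNr oppr_ge0 ltW.
apply: (@slice_subst_area _ 1 a1 b1 a2 b2 E _ (fun x y => (hgt 1 (x, y))^-1)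
  phi (fun x y => d * (- x * gdens 1 0 x) * Num.sqrt (1 - 1 * y ^+ 2))) => //.
- by rewrite /hgt /hgt2/=; mfun.
- move=> x y [+ _ _]; rewrite /hgt2/= => h0.
  by have := sqr_ge0 x; lra.
- by move=> x y; rewrite invr_ge0 sqrtr_ge0.
- move=> x y y0 xab; have x0 := J0 x; have dx := dv x xab.
  have sx : 0 < Num.sqrt (1 + 1 * x ^+ 2) by rewrite sqrtr_gt0.
  have sy : 0 < Num.sqrt (1 - 1 * y ^+ 2) by rewrite sqrtr_gt0.
  have xn0 : x != 0 by apply/eqP => x00; move: dx; rewrite x00 mulr0 ltxx.
  split.
  + by have d1' := der_gsqrtV x; rewrite /phi; der_auto => /=; ring.
  + rewrite mulr_gt0// mulrA mulr_gt0//; first by rewrite mulrN oppr_gt0.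
    by rewrite invr_gt0 gN0E mulr_gt0.
  + apply: cvgM; last exact: cvg_cst.
    apply: cvgM; first exact: cvg_cst.
    by apply: cvgM; [exact: cvgN|apply: gdens_cont; rewrite gN0E].
  + by apply: hgt_cont; rewrite hphi// divr_gt0// mulr_gt0// exprn_even_gt0.
  + rewrite hE// /gdens gN0E; field.
    have x0' : 0 < 1 + x ^+ 2 by move: x0; rewrite mul1r.
    by rewrite d0 xn0 !gt_eqF.
- move=> x y y0 xab; have x0 := J0 x; have dx := dv x xab.
  have sx : 0 < Num.sqrt (1 + 1 * x ^+ 2) by rewrite sqrtr_gt0.
  have sy : 0 < Num.sqrt (1 - 1 * y ^+ 2) by rewrite sqrtr_gt0.
  have xn0 : x != 0 by apply/eqP => x00; move: dx; rewrite x00 mulr0 ltxx.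
  rewrite /hemi_dom hphi// hE//=.
  have dphi : d * phi x y = Num.sqrt (1 - 1 * y ^+ 2) / Num.sqrt (1 + 1 * x ^+ 2).
    by rewrite phiE !mulrA dd mul1r.
  have e2 : y / (d * phi x y) = unlift 1 x y.
    rewrite dphi /unlift; field.
    by rewrite !gt_eqF.
  have e1 : - (- d * x * Num.sqrt (1 - 1 * y ^+ 2) / Num.sqrt (1 + 1 * x ^+ 2)) / phi x y = x.
    rewrite phiE; field.
    by rewrite d0 !gt_eqF.
  rewrite e1 e2; split => [[]//|Exy]; split => //.
    by rewrite divr_gt0// mulr_gt0// exprn_even_gt0.
  by rewrite dphi divr_gt0.
- move=> x y [h0 dx Exy]; exists (- hgt 1 (x, y) / x); first by case/ib: Exy.
  have xn0 : x != 0 by apply/eqP => x00; move: dx; rewrite x00 mulr0 ltxx.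
  have y0 : 0 < 1 - 1 * y ^+ 2.
    by move: h0; rewrite /hgt2/=; have := sqr_ge0 x; lra.
  have BE : 1 + 1 * (- hgt 1 (x, y) / x) ^+ 2 = (1 - 1 * y ^+ 2) / (d * x) ^+ 2.
    rewrite expr_div_n sqrrN sqr_sqrtr ?(ltW h0)// /hgt2/= exprMn.
    by rewrite -[d ^+ 2]/(d * d) dd; field.
  have sy : 0 < Num.sqrt (1 - 1 * y ^+ 2) by rewrite sqrtr_gt0.
  rewrite phiE BE sqrtrM ?(ltW y0)// sqrtrV ?sqr_ge0// sqrtr_sqr gtr0_norm//=.
  rewrite (_ : _ / _ = d * d * x); first by rewrite dd mul1r.
  by field; rewrite xn0 d0 gt_eqF.
Qed.

End Reflections.

(** * Riemannian density of the charts over the coordinate plane *)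

Section AreaCharts.
Context {R : realType}.
Notation mu := (@lebesgue_measure R).
Notation mR := (measurableTypeR R).
Implicit Types (K x y : R) (G : geometry) (p q : 'rV[R]_3).

Lemma row3E (a b c : R) : (row3 a b c 0 0 = a) * (row3 a b c 0 1 = b) * (row3 a b c 0 ord_max = c).
Proof. by rewrite !mxE. Qed.

Lemma ord3_ind (T : 'I_3 -> Prop) : T 0 -> T 1 -> T ord_max -> forall i, T i.
Proof.
move=> T0 T1 T2 [[|[|[|//]]] i3].
- by rewrite (_ : Ordinal i3 = 0)//; exact: val_inj.
- by rewrite (_ : Ordinal i3 = 1)//; exact: val_inj.
- by rewrite (_ : Ordinal i3 = ord_max)//; exact: val_inj.
Qed.

Lemma sum3 (F : 'I_3 -> R) : \sum_i F i = F 0 + F 1 + F ord_max.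
Proof.
rewrite !big_ord_recl big_ord0 addr0 addrA; congr (_ + _ + _); congr F; exact: val_inj.
Qed.

Lemma bilinQ G p q : bilin (Q R G) p q =
  p 0 0 * q 0 0 + p 0 1 * q 0 1 + curvature R G * (p 0 ord_max * q 0 ord_max).
Proof.
rewrite /bilin /Q mul_mx_diag mxE sum3 !mxE/=; ring.
Qed.

Lemma curvature3 G : curvature R G ^+ 3 = curvature R G.
Proof. by case: G => /=; ring. Qed.

Lemma der_derive (f : R * R -> R) (z v : R * R) (d : R) :
  der (fun t => f (t *: v + z)) 0 d -> derivable f z v /\ 'D_v f z = d.
Proof.
have E : (fun h : R => h^-1 *: ((f \o shift z) (h *: v) - f z)) =
   (fun h : R => h^-1 *: (((fun t : R => f (t *: v + z)) \o shift 0) (h *: (1:R)) - f (0 *: v + z))).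
  by apply/funext => h /=; rewrite addr0 scale0r add0r /GRing.scale/= mulr1.
rewrite /der => -[dv <-]; rewrite /derivable /derive E; split => //.
Qed.

Definition chart_map K (e : R) (z : R * R) : 'rV[R]_3 := row3 z.1 z.2 (e * hgt K z).

Lemma der_chart K (e : R) (z v : R * R) : 0 < hgt2 K z ->
  'D_v (chart_map K e) z = row3 v.1 v.2 (- e * K * (z.1 * v.1 + z.2 * v.2) / hgt K z).
Proof.
move=> h0; have s0 : 0 < hgt K z by rewrite sqrtr_gt0.
have d0 : derivable (fun w => chart_map K e w 0 0) z v /\
    'D_v (fun w => chart_map K e w 0 0) z = v.1.
  apply: der_derive; under eq_fun do rewrite row3E.
  change (der (fun t : R => t * v.1 + z.1) 0 v.1); der_auto => /=; ring.
have d1 : derivable (fun w => chart_map K e w 0 1) z v /\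
    'D_v (fun w => chart_map K e w 0 1) z = v.2.
  apply: der_derive; under eq_fun do rewrite row3E.
  change (der (fun t : R => t * v.2 + z.2) 0 v.2); der_auto => /=; ring.
have d2 : derivable (fun w => chart_map K e w 0 ord_max) z v /\
    'D_v (fun w => chart_map K e w 0 ord_max) z = - e * K * (z.1 * v.1 + z.2 * v.2) / hgt K z.
  apply: der_derive; under eq_fun do rewrite row3E.
  change (der (fun t : R => e * Num.sqrt (1 - K * (t * v.1 + z.1) ^+ 2
    - K * (t * v.2 + z.2) ^+ 2)) 0 (- e * K * (z.1 * v.1 + z.2 * v.2) / hgt K z)).
  der_auto; rewrite /= !mul0r !add0r// -/(hgt2 K z) -/(hgt K z); field.
  by rewrite gt_eqF.
have dv : derivable (chart_map K e) z v.
  apply/derivable_mxP => i; rewrite (ord1 i).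
  by elim/ord3_ind; [case: d0|case: d1|case: d2].
rewrite derive_mx//; apply/rowP; elim/ord3_ind; rewrite !row3E mxE.
- by case: d0.
- by case: d1.
- by case: d2.
Qed.

(** The curvature enters three times, once through the form and twice through the third components
    of the tangent vectors. As $K^3 = K$, the Gram determinant is $1 + K (z_1^2 + z_2^2) / h^2 =
    h^{-2}$ in all three models. *)
Lemma gram_chart G (e : R) (z : R * R) : e * e = 1 -> 0 < hgt2 (curvature R G) z ->
  Num.sqrt (gram G ('D_((1, 0) : R * R) (chart_map (curvature R G) e) z)
     ('D_((0, 1) : R * R) (chart_map (curvature R G) e) z)) = (hgt (curvature R G) z)^-1.
Proof.
move=> ee h0; have s0 : 0 < hgt (curvature R G) z by rewrite sqrtr_gt0.
rewrite !der_chart// /gram !bilinQ !row3E/=.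
set K := curvature R G in h0 s0 *; set h := hgt K z in s0 *.
have hh : h ^+ 2 = 1 - K * z.1 ^+ 2 - K * z.2 ^+ 2 by rewrite sqr_sqrtr// ltW.
set X := (X in Num.sqrt X).
have -> : X = (h^-1) ^+ 2.
  have K3 : K * K * K = K by rewrite -[RHS](curvature3 G) -/K; ring.
  have -> : X = 1 + (e * e) * (K * K * K) * (z.1 ^+ 2 + z.2 ^+ 2) / h ^+ 2.
    by rewrite /X; field; rewrite gt_eqF.
  rewrite K3 ee; have -> : 1 * K * (z.1 ^+ 2 + z.2 ^+ 2) = 1 - h ^+ 2 by rewrite hh; ring.
  by field; rewrite gt_eqF.
by rewrite sqrtr_sqr ger0_norm// invr_ge0 ltW.
Qed.

End AreaCharts.

Section ChartArea.
Context {R : realType}.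
Notation mu := (@lebesgue_measure R).
Notation mR := (measurableTypeR R).
Implicit Types (K x y e d : R) (G : geometry) (p q : 'rV[R]_3).

(** Trace of a chart centred on the half-axis $d x_1 > 0$ on the hemisphere where $x_3$ has the sign
    [e]. *)
Definition piv_dom e d (E : set (mR * mR)) (z : mR * mR) : Prop :=
  [/\ 0 < hgt2 1 z, 0 < d * z.1 & E (e * hgt 1 z / (d * z.1), z.2 / (d * z.1))].

(** [hemi_area] covers [e * d = -1]; the other sign is reduced to it by reflecting the first chart
    coordinate. *)
Lemma piv_area e d a1 b1 a2 b2 E : e = 1 \/ e = -1 -> d = 1 \/ d = -1 ->
  measurable E -> a2 < b2 ->
  {in `]a1, b1[, forall v, 0 < e * v} -> in_box a1 b1 a2 b2 E ->
  measurable (piv_dom e d E) /\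
  (\int[mu]_y \int[mu]_x (\1_(piv_dom e d E) (x, y) * (hgt 1 (x, y))^-1)%:E = garea 1 E)%E.
Proof.
move=> e1 d1 mE ab2 ev ib.
have inv_d z1 : e * hgt 1 z1 / (d * z1.1) = e * d * hgt 1 z1 / z1.1.
  by case: d1 => ->; rewrite ?mul1r ?mulr1// !mulN1r invrN mulrN mulrN1 !mulNr.
have [ed|ed] : e * d = -1 \/ e * d = 1.
  by case: e1 d1 => -> [] ->; [right|left|left|right]; ring.
  have -> : piv_dom e d E = hemi_dom d E.
    by apply/funext => z; rewrite /piv_dom /hemi_dom inv_d ed mulN1r.
  split; first exact: measurable_hemi_dom.
  apply: hemi_area ib => // v /ev.
  by case: e1 d1 ed => -> [] ->; lra.
have -> : piv_dom e d E = hemi_dom d (flip1 E).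
  apply/funext => z; rewrite /piv_dom /hemi_dom inv_d ed mul1r /flip1/=.
  by rewrite mulNr opprK.
split; first by apply: measurable_hemi_dom; exact: measurable_flip1.
rewrite (@hemi_area _ d (- b1) (- a1) a2 b2)//.
- by rewrite garea_flip1// => z /ib _; rewrite /gN mul1r ltr_wpDr// addr_ge0// sqr_ge0.
- exact: measurable_flip1.
- move=> v; rewrite in_itv/= => /andP[v1 v2].
  have /ev : - v \in `]a1, b1[ by rewrite in_itv/=; apply/andP; split; lra.
  by case: e1 d1 ed => -> [] ->; lra.
- move=> z /ib [/= z1 z2]; split => //; move: z1; rewrite !in_itv/= => /andP[]; lra.
Qed.

(** In the charts centred on the equator, the line [z.1 = 0] is the equator itself, which the two
    open hemispheres omit. *)
Lemma garea_set0x K E : measurable E -> pos_on K E ->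
  garea K (E `&` [set z : mR * mR | z.1 = 0%R]) = 0%E.
Proof.
move=> mE pE.
have mE0 : measurable (E `&` [set z : mR * mR | z.1 = 0%R]).
  apply: measurableI => //.
  have := @measurable_fst _ _ mR mR measurableT [set 0] (measurable_set1 _).
  by rewrite setTI.
have pE0 : pos_on K (E `&` [set z : mR * mR | z.1 = 0%R]) by move=> z [/pE].
rewrite /garea fubini_tonelli1; [|exact: measurable_garea_fun|by move=> z; exact: pos_garea_ge0].
pose f (z : mR * mR) := (\1_(E `&` [set z : mR * mR | z.1 = 0%R]) z * gdens K z.1 z.2)%:E.
transitivity (\int[mu]_(x in [set (0%R : R)]) fubini_F mu f x)%E.
  rewrite [RHS]integral_mkcond; apply: eq_integral => x _.
  rewrite patchE; case: ifPn => //.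
  rewrite notin_setE /= => x0; rewrite /fubini_F integral0_eq// => y _.
  by rewrite /f indicE memNset ?mul0r// => -[].
exact: integral_set1.
Qed.

Lemma garea_split K E : measurable E -> pos_on K E ->
  garea K E = (garea K (E `&` [set z : mR * mR | (0 < z.1)%R]) + garea K (E `&` [set z : mR * mR | (z.1 < 0)%R]))%E.
Proof.
move=> mE pE.
have mp : measurable (E `&` [set z : mR * mR | (0 < z.1)%R]).
  by apply: measurableI => //; apply: measurable_ltr_set; mfun.
have mn : measurable (E `&` [set z : mR * mR | (z.1 < 0)%R]).
  by apply: measurableI => //; apply: measurable_ltr_set; mfun.
have mE0 : measurable (E `&` [set z : mR * mR | z.1 = 0%R]).
  apply: measurableI => //.
  have := @measurable_fst _ _ mR mR measurableT [set 0] (measurable_set1 _).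
  by rewrite setTI.
have pp D : pos_on K (E `&` D) by move=> z [/pE].
rewrite -[RHS]adde0 -(garea_set0x mE pE) /garea.
rewrite -ge0_integralD//; last 4 first.
- by move=> z _; exact: pos_garea_ge0.
- exact: measurable_garea_fun.
- by move=> z _; exact: pos_garea_ge0.
- exact: measurable_garea_fun.
rewrite -ge0_integralD//; last 4 first.
- by move=> z _; rewrite adde_ge0//; exact: pos_garea_ge0.
- by apply: emeasurable_funD; exact: measurable_garea_fun.
- by move=> z _; exact: pos_garea_ge0.
- exact: measurable_garea_fun.
apply: eq_integral => z _; rewrite -!EFinD -!mulrDl; congr (_ * _)%:E.
rewrite !indicE !in_setI.
case: (z \in E) => /=; last by rewrite !addr0.
have [z0|z0|z0] := ltgtP z.1 0.
- rewrite (_ : z \in [set z : mR * mR | (0 < z.1)%R] = false); last by apply: memNset => /=; rewrite ltNge ltW.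
  rewrite (_ : z \in [set z : mR * mR | z.1 = 0%R] = false); last by apply: memNset => /= z0'; rewrite z0' ltxx in z0.
  by rewrite (_ : z \in [set z : mR * mR | (z.1 < 0)%R]) ?inE// add0r addr0.
- rewrite (_ : z \in [set z : mR * mR | (z.1 < 0)%R] = false); last by apply: memNset => /=; rewrite ltNge ltW.
  rewrite (_ : z \in [set z : mR * mR | z.1 = 0%R] = false); last by apply: memNset => /= z0'; rewrite z0' ltxx in z0.
  by rewrite (_ : z \in [set z : mR * mR | (0 < z.1)%R]) ?inE// !addr0.
- rewrite (_ : z \in [set z : mR * mR | (z.1 < 0)%R] = false); last by apply: memNset => /=; rewrite z0 ltxx.
  rewrite (_ : z \in [set z : mR * mR | (0 < z.1)%R] = false); last by apply: memNset => /=; rewrite z0 ltxx.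
  by rewrite (_ : z \in [set z : mR * mR | z.1 = 0%R]) ?inE// !add0r.
Qed.

Lemma chart_areaE G e W : e * e = 1 ->
  chart_area G [set z | 0 < hgt2 (curvature R G) z] (chart_map (curvature R G) e) W =
  (\int[(mu \x mu)%E]_z (\1_([set z : mR * mR | (0 < hgt2 (curvature R G) z)%R] `&`
     chart_map (curvature R G) e @^-1` W) z * (hgt (curvature R G) z)^-1)%:E)%E.
Proof.
move=> ee; rewrite -integral_indicM; apply: eq_integral => z; rewrite inE => -[h0 _].
by rewrite gram_chart.
Qed.

Definition charts_area G W : \bar R :=
  let K := curvature R G in
  let A e := chart_area G [set z | 0 < hgt2 K z] (chart_map K e) W in
  match G with Spherical => (A 1%R + A (-1)%R)%E | _ => A 1 end.

Lemma areaE G W : area G W = charts_area G W.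
Proof.
case: G; rewrite /area /charts_area /=.
- have -> : [set z | 0 < hgt2 0 z] = setT :> set (R * R).
    by apply/seteqP; split => z //= _; rewrite /hgt2 !mul0r !subr0.
  have -> // : chart_map (0 : R) 1 = (fun z : R * R => row3 z.1 z.2 1).
  apply/funext => z.
  by rewrite /chart_map /hgt /hgt2 !mul0r !subr0 sqrtr1 mulr1.
- have -> : [set z : R * R | 0 < hgt2 1 z] = [set z : R * R | z.1 ^+ 2 + z.2 ^+ 2 < 1].
    by apply/seteqP; split => z /=; rewrite /hgt2; lra.
  have -> : chart_map 1 1 = (fun z : R * R => row3 z.1 z.2 (Num.sqrt (1 - z.1 ^+ 2 - z.2 ^+ 2))).
    by apply/funext => z; rewrite /chart_map /hgt /hgt2 !mul1r.
  have -> // : chart_map 1 (-1) = (fun z : R * R => row3 z.1 z.2 (- Num.sqrt (1 - z.1 ^+ 2 - z.2 ^+ 2))).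
  by apply/funext => z; rewrite /chart_map /hgt /hgt2 !mul1r mulN1r.
- have -> : [set z | 0 < hgt2 (-1) z] = setT :> set (R * R).
    apply/seteqP; split => z //= _; rewrite /hgt2 !mulN1r !opprK.
    by rewrite -addrA ltr_wpDr// addr_ge0// sqr_ge0.
  have -> // : chart_map (-1) 1 = (fun z : R * R => row3 z.1 z.2 (Num.sqrt (1 + z.1 ^+ 2 + z.2 ^+ 2))).
  by apply/funext => z; rewrite /chart_map /hgt /hgt2 !mulN1r mul1r !opprK.
Qed.

End ChartArea.

(** * Frames adapted to a surface *)

Section Frames.
Context {R : realType}.
Notation mu := (@lebesgue_measure R).
Notation mR := (measurableTypeR R).
Implicit Types (K x y e d : R) (G : geometry) (p q : 'rV[R]_3) (P : 'M[R]_3).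

Definition crd P (k : 'I_3) p : R := (p *m P) 0 k.

Lemma crdE P k p : crd P k p =
  p 0 0 * P 0 k + p 0 1 * P 1 k + p 0 ord_max * P ord_max k.
Proof. by rewrite /crd mxE sum3. Qed.

Definition frameset G P (E : set (mR * mR)) p : Prop :=
  [/\ surface G p, 0 < crd P 0 p &
      E (crd P 1 p / crd P 0 p, crd P ord_max p / crd P 0 p)].

(* [P] is an orthogonal change of coordinates; over [0 < crd P 0 p] the gnomonic
   chart [(crd P 1 p / crd P 0 p, crd P 2 p / crd P 0 p)] straightens geodesics. *)
Record frame G P : Prop := Frame {
  frame_orth : P *m P^T = 1%:M;
  frame_bilin : forall p q, bilin (Q R G) p q =
    crd P 1 p * crd P 1 q + crd P ord_max p * crd P ord_max q +
    curvature R G * (crd P 0 p * crd P 0 q);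
  frame_surface : forall p, 0 < crd P 0 p -> surface G p <->
    crd P 0 p ^+ 2 + curvature R G * (crd P 1 p ^+ 2 + crd P ord_max p ^+ 2) = 1;
  frame_pos : G <> Spherical -> forall p, surface G p -> 0 < crd P 0 p;
  frame_area : forall E a1 b1 a2 b2, measurable E -> a1 < b1 -> a2 < b2 ->
    good_box (curvature R G) a1 b1 a2 b2 -> in_box a1 b1 a2 b2 E ->
    area G (frameset G P E) = garea (curvature R G) E }.

Definition mx33 (l : seq (seq R)) : 'M[R]_3 := \matrix_(i < 3, j < 3) (nth [::] l i)`_j.

Definition swap_mx := mx33 [:: [:: 1; 0; 0]; [:: 0; 0; 1]; [:: 0; 1; 0]].
Definition sign_mx e d := mx33 [:: [:: 1; 0; 0]; [:: 0; e; 0]; [:: 0; 0; d]].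

Lemma crdM P S k p : crd (P *m S) k p =
  crd P 0 p * S 0 k + crd P 1 p * S 1 k + crd P ord_max p * S ord_max k.
Proof. by rewrite /crd mulmxA mxE sum3. Qed.

Lemma crd_swap P p : (crd (P *m swap_mx) 0 p = crd P 0 p) *
  (crd (P *m swap_mx) 1 p = crd P ord_max p) *
  (crd (P *m swap_mx) ord_max p = crd P 1 p).
Proof. by do !split; rewrite crdM !mxE/=; ring. Qed.

Lemma crd_sign P e d p : (crd (P *m sign_mx e d) 0 p = crd P 0 p) *
  (crd (P *m sign_mx e d) 1 p = crd P 1 p * e) *
  (crd (P *m sign_mx e d) ord_max p = crd P ord_max p * d).
Proof. by do !split; rewrite crdM !mxE/=; ring. Qed.

Lemma swap_mx_orth : swap_mx *m swap_mx^T = 1%:M.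
Proof.
apply/matrixP; elim/ord3_ind; elim/ord3_ind; rewrite !mxE sum3 !mxE/=; ring.
Qed.

Lemma sign_mx_orth e d : e * e = 1 -> d * d = 1 -> sign_mx e d *m (sign_mx e d)^T = 1%:M.
Proof.
move=> ee dd.
apply/matrixP; elim/ord3_ind; elim/ord3_ind; rewrite !mxE sum3 !mxE/= ?ee ?dd; ring.
Qed.

Lemma orthM P (S : 'M[R]_3) : P *m P^T = 1%:M -> S *m S^T = 1%:M ->
  (P *m S) *m (P *m S)^T = 1%:M.
Proof. by move=> PP SS; rewrite trmx_mul mulmxA -(mulmxA P) SS mulmx1. Qed.

Lemma good_box_pos K a1 b1 a2 b2 E : good_box K a1 b1 a2 b2 -> in_box a1 b1 a2 b2 E ->
  pos_on K E.
Proof. by move=> gb ib z /ib[z1 z2]; exact: gb. Qed.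

(** Swaps and sign changes of the two chart coordinates will turn the germ into a convex graph
    traversed to the right. The area formula follows them because the density is symmetric. *)
Lemma frame_swap G P : frame G P -> frame G (P *m swap_mx).
Proof.
case=> orth b s pos A; split.
- exact: orthM orth swap_mx_orth.
- by move=> p q; rewrite b !crd_swap; ring.
- by move=> p; rewrite !crd_swap => /s ->; rewrite [in X in _ * X]addrC.
- by move=> GS p /(pos GS); rewrite crd_swap.
- move=> E a1 b1 a2 b2 mE ab1 ab2 gb ib.
  rewrite -(garea_flip12 mE (good_box_pos gb ib)).
  rewrite -(A _ a2 b2 a1 b1)//.
  + by congr area; apply/funext => p; rewrite /frameset !crd_swap.
  + exact: measurable_flip12.
  + by move=> x y xb yb; rewrite gN_flip12; exact: gb.
  + by move=> z /ib[].
Qed.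

Lemma frame_sign G P e d : e = 1 \/ e = -1 -> d = 1 \/ d = -1 -> frame G P ->
  frame G (P *m sign_mx e d).
Proof.
move=> e1 d1 [orth b s pos A].
have ee : e * e = 1 by case: e1 => ->; ring.
have dd : d * d = 1 by case: d1 => ->; ring.
split.
- exact: orthM orth (sign_mx_orth ee dd).
- move=> p q; rewrite b !crd_sign.
  rewrite -[crd P 1 p * crd P 1 q]mulr1 -[crd P ord_max p * crd P ord_max q]mulr1.
  by rewrite -{1}ee -{1}dd; ring.
- by move=> p; rewrite !crd_sign !exprMn -[e ^+ 2]/(e * e) -[d ^+ 2]/(d * d) ee dd !mulr1 => /s.
- by move=> GS p /(pos GS); rewrite crd_sign.
- move=> E a1 b1 a2 b2 mE ab1 ab2 gb ib.
  have pE := good_box_pos gb ib.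
  pose E1 : set (mR * mR) := fun z => E (z.1 * e, z.2).
  have [mE1 pE1 gE1] : [/\ measurable E1, pos_on (curvature R G) E1
      & garea (curvature R G) E1 = garea (curvature R G) E].
    case: e1 => e1; rewrite /E1 e1.
      by under eq_fun do rewrite mulr1 -surjective_pairing.
    have -> : (fun z => E (z.1 * -1, z.2)) = flip1 E.
      by apply/funext => z; rewrite /flip1 mulrN1.
    split; [exact: measurable_flip1| |exact: garea_flip1].
    by move=> z /pE/=; rewrite gN_flip1.
  pose E2 : set (mR * mR) := fun z => E1 (z.1, z.2 * d).
  have [mE2 gE2] : measurable E2 /\ garea (curvature R G) E2 = garea (curvature R G) E1.
    case: d1 => d1; rewrite /E2 d1.
      by under eq_fun do rewrite mulr1 -surjective_pairing.
    have -> : (fun z => E1 (z.1, z.2 * -1)) = flip2 E1.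
      by apply/funext => z; rewrite /flip2 mulrN1.
    by split; [exact: measurable_flip2|exact: garea_flip2].
  have -> : frameset G (P *m sign_mx e d) E = frameset G P E2.
    apply/funext => p; rewrite /frameset !crd_sign /E2 /E1/=.
    by rewrite !(mulrAC _ _^-1).
  rewrite -gE1 -gE2.
  (* For the sign -1 this gives the bounds of the reflected interval, in the right order. *)
  pose m (u v s : R) : R := if s == 1 then u else - v.
  apply: (A _ (m a1 b1 e) (m b1 a1 e) (m a2 b2 d) (m b2 a2 d)) => //.
  + by rewrite /m; case: ifP => // _; lra.
  + by rewrite /m; case: ifP => // _; lra.
  + move=> x y xb yb.
    have -> : gN (curvature R G) x y = gN (curvature R G) (x * e) (y * d).
      by rewrite /gN !exprMn -[e ^+ 2]/(e * e) -[d ^+ 2]/(d * d) ee dd !mulr1.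
    apply: gb.
      move: xb; rewrite /m; case: e1 => ->; rewrite ?eqxx ?mulr1//.
      rewrite (_ : (-1 == 1 :> R) = false) ?mulrN1 ?in_itv/=; last by apply/eqP; lra.
      by move=> /andP[]; lra.
    move: yb; rewrite /m; case: d1 => ->; rewrite ?eqxx ?mulr1//.
    rewrite (_ : (-1 == 1 :> R) = false) ?mulrN1 ?in_itv/=; last by apply/eqP; lra.
    by move=> /andP[]; lra.
  + move=> z; rewrite /E2 /E1/= => /ib[/=]; rewrite /m => z1 z2; split.
      move: z1; case: e1 => ->; rewrite ?eqxx ?mulr1//.
      rewrite (_ : (-1 == 1 :> R) = false) ?mulrN1 ?in_itv/=; last by apply/eqP; lra.
      by move=> /andP[]; lra.
    move: z2; case: d1 => ->; rewrite ?eqxx ?mulr1//.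
    rewrite (_ : (-1 == 1 :> R) = false) ?mulrN1 ?in_itv/=; last by apply/eqP; lra.
    by move=> /andP[]; lra.
Qed.

End Frames.

Section FrameExistence.
Context {R : realType}.
Notation mu := (@lebesgue_measure R).
Notation mR := (measurableTypeR R).
Implicit Types (K x y e d : R) (G : geometry) (p q : 'rV[R]_3) (P : 'M[R]_3).

(** Signed permutations that bring a chosen coordinate, up to sign, to position 0: the third one
    here, the first and the second one in the next two matrices. *)
Definition pole_mx e : 'M[R]_3 := mx33 [:: [:: 0; 1; 0]; [:: 0; 0; 1]; [:: e; 0; 0]].
Definition piv1_mx d : 'M[R]_3 := mx33 [:: [:: d; 0; 0]; [:: 0; 0; 1]; [:: 0; 1; 0]].
Definition piv2_mx d : 'M[R]_3 := mx33 [:: [:: 0; 0; 1]; [:: d; 0; 0]; [:: 0; 1; 0]].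

Lemma crd_pole e p : (crd (pole_mx e) 0 p = e * p 0 ord_max) *
  (crd (pole_mx e) 1 p = p 0 0) * (crd (pole_mx e) ord_max p = p 0 1).
Proof. by do !split; rewrite crdE !mxE/=; ring. Qed.

Lemma crd_piv1 d p : (crd (piv1_mx d) 0 p = d * p 0 0) *
  (crd (piv1_mx d) 1 p = p 0 ord_max) * (crd (piv1_mx d) ord_max p = p 0 1).
Proof. by do !split; rewrite crdE !mxE/=; ring. Qed.

Lemma crd_piv2 d p : (crd (piv2_mx d) 0 p = d * p 0 1) *
  (crd (piv2_mx d) 1 p = p 0 ord_max) * (crd (piv2_mx d) ord_max p = p 0 0).
Proof. by do !split; rewrite crdE !mxE/=; ring. Qed.

Lemma surface_sphere p : surface Spherical p <->
  p 0 0 ^+ 2 + p 0 1 ^+ 2 + p 0 ord_max ^+ 2 = 1.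
Proof. by rewrite /surface/= bilinQ/= mul1r -!expr2. Qed.

Lemma pole_surface G e p : e = 1 \/ (G = Spherical /\ e = -1) ->
  0 < crd (pole_mx e) 0 p -> surface G p <->
    crd (pole_mx e) 0 p ^+ 2 + curvature R G *
     (crd (pole_mx e) 1 p ^+ 2 + crd (pole_mx e) ord_max p ^+ 2) = 1.
Proof.
move=> e1; rewrite !crd_pole; case: G e1 => e1.
- have -> : e = 1 by case: e1 => // -[].
  rewrite mul1r /= mul0r addr0 => p0; split => [->|]; first by rewrite expr1n.
  by move=> /eqP; rewrite sqrf_eq1 => /orP[/eqP//|/eqP p1]; move: p0; rewrite p1; lra.
- have ee : e * e = 1 by case: e1 => [->|[_ ->]]; ring.
  move=> _; rewrite surface_sphere exprMn -[e ^+ 2]/(e * e) ee /=.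
  by split => h; rewrite -[RHS]h; ring.
- have -> : e = 1 by case: e1 => // -[].
  rewrite mul1r /= => p0; rewrite bilinQ/=; split => [[h _]|h].
    by move: h; rewrite !expr2; lra.
  by split => //; move: h; rewrite !expr2; lra.
Qed.

Lemma pole_frame G e : e = 1 \/ (G = Spherical /\ e = -1) -> frame G (pole_mx e).
Proof.
move=> e1; have ee : e * e = 1 by case: e1 => [->|[_ ->]]; ring.
split.
- by apply/matrixP; elim/ord3_ind; elim/ord3_ind; rewrite !mxE sum3 !mxE/= ?ee; ring.
- move=> p q; rewrite bilinQ !crd_pole.
  rewrite (_ : e * _ * (e * _) = (e * e) * (p 0 ord_max * q 0 ord_max)); last by ring.
  by rewrite ee; ring.
- by move=> p; exact: pole_surface.
- move=> GS p; rewrite crd_pole.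
  have -> : e = 1 by case: e1 => // -[].
  by rewrite mul1r; case: (G) GS => [_ /= ->|//|_ []].
move=> E a1 b1 a2 b2 mE ab1 ab2 gb ib; rewrite areaE.
have chart_same : chart_area G [set z | 0 < hgt2 (curvature R G) z]
    (chart_map (curvature R G) e) (frameset G (pole_mx e) E) = garea (curvature R G) E.
  rewrite chart_areaE// -(pole_area mE ab2 gb ib); apply: eq_integral => z _.
  congr (_ * _)%:E; apply: indic_mem; rewrite /pole_dom /frameset/= !crd_pole.
  rewrite !row3E mulrA ee mul1r; split => [[h0 [_ _]]//|[h0 Ez]].
  split => //; have h1 : 0 < hgt (curvature R G) z by rewrite sqrtr_gt0.
  split => //; apply/(pole_surface e1).
    by rewrite crd_pole !row3E mulrA ee mul1r.
  rewrite !crd_pole !row3E mulrA ee mul1r sqr_sqrtr ?(ltW h0)// /hgt2; ring.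
(* The half-space [0 < crd P 0 p] misses the sheet of opposite sign. *)
have chart_other e' : e' * e' = 1 -> e * e' = -1 ->
  chart_area G [set z | 0 < hgt2 (curvature R G) z]
    (chart_map (curvature R G) e') (frameset G (pole_mx e) E) = 0%E.
  move=> ee' eN; rewrite chart_areaE// integral0_eq// => z _.
  rewrite indicE memNset ?mul0r// /frameset/= => -[h0 [_ + _]].
  rewrite crd_pole !row3E mulrA eN mulN1r oppr_gt0.
  by rewrite ltNge sqrtr_ge0.
rewrite /charts_area; case: e1 chart_same chart_other => [->|[GE ->]] cs co.
  have N1 : (-1) * (-1) = 1 :> R by ring.
  have N2 : 1 * (-1) = -1 :> R by ring.
  by rewrite cs (co (-1) N1 N2) adde0; case: (G).
have N1 : 1 * 1 = 1 :> R by ring.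
have N2 : (-1) * 1 = -1 :> R by ring.
by rewrite cs (co 1 N1 N2) add0e GE.
Qed.

Lemma measurable_half e : measurable [set z : mR * mR | 0 < e * z.1].
Proof. by apply: measurable_ltr_set; mfun. Qed.

(* A chart over one hemisphere only meets the points whose third coordinate
   has the sign [e]. *)
Lemma half_box e a1 b1 : e = 1 \/ e = -1 -> exists a1' b1' : R,
  (forall v, (v \in `]a1', b1'[) <-> (v \in `]a1, b1[) /\ 0 < e * v).
Proof.
case=> ->.
  exists (Num.max a1 0), b1 => v; rewrite !in_itv/= mul1r gt_max.
  by split => [/andP[/andP[-> ->] ->]//|[/andP[-> ->] ->]].
exists a1, (Num.min b1 0) => v; rewrite !in_itv/= mulN1r oppr_gt0 lt_min.
by split => [/andP[-> /andP[-> ->]]//|[/andP[-> ->] ->]].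
Qed.

Lemma sphere_pos_on (E : set (mR * mR)) : pos_on 1 E.
Proof. by move=> z _; rewrite /gN mul1r ltr_wpDr// addr_ge0// sqr_ge0. Qed.

(** The first equality serves the chart centred on the first axis; the second one, with $x_1$ and
    $x_2$ exchanged, serves the chart centred on the second axis. *)
Lemma piv_chart e d a1 b1 a2 b2 E : e = 1 \/ e = -1 -> d = 1 \/ d = -1 ->
  measurable E -> a2 < b2 -> in_box a1 b1 a2 b2 E ->
  (\int[(mu \x mu)%E]_z (\1_(piv_dom e d E) z * (hgt 1 z)^-1)%:E =
     garea 1 (E `&` [set z : mR * mR | (0 < e * z.1)%R]))%E /\
  (\int[(mu \x mu)%E]_z (\1_(flip12 (piv_dom e d E)) z * (hgt 1 z)^-1)%:E =
     garea 1 (E `&` [set z : mR * mR | (0 < e * z.1)%R]))%E.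
Proof.
move=> e1 d1 mE ab2 ib; pose E' := E `&` [set z : mR * mR | 0 < e * z.1].
have mE' : measurable E' by apply: measurableI => //; exact: measurable_half.
have [a1' [b1' ab']] := half_box a1 b1 e1.
have ib' : in_box a1' b1' a2 b2 E'.
  by move=> z [Ez z0]; have [z1 z2] := ib z Ez; split => //; apply/ab'.
have [mD <-] := piv_area e1 d1 mE' ab2 (fun v vab => proj2 (proj1 (ab' v) vab)) ib'.
have -> : piv_dom e d E = piv_dom e d E'.
  apply/funext => z; apply/propext; rewrite /piv_dom; split => [[h0 dz Ez]|[h0 dz [Ez _]]]//.
  split => //; split => //=.
  have ee : e * e = 1 by case: e1 => ->; ring.
  by rewrite !mulrA ee mul1r divr_gt0// sqrtr_gt0.
have hsym z : hgt 1 (z.2, z.1) = hgt 1 z :> R.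
  by rewrite /hgt /hgt2/=; congr Num.sqrt; ring.
have mF (D : set (mR * mR)) : measurable D ->
    measurable_fun setT (fun z => (\1_D z * (hgt 1 z)^-1)%:E).
  move=> mD'; apply/measurable_EFinP; apply: measurable_funM.
    exact: measurable_indic.
  by rewrite /hgt /hgt2; mfun.
have pF (D : set (mR * mR)) z : (0 <= (\1_D z * (hgt 1 z)^-1)%:E)%E.
  apply: (@indic_mul_ge0 _ _ D (fun z => (hgt 1 z)^-1)) => _.
  by rewrite invr_ge0 sqrtr_ge0.
split.
  by rewrite fubini_tonelli2; [|exact: (mF _ mD)|move=> z; exact: pF].
have mDf := measurable_flip12 mD.
rewrite fubini_tonelli1; [|exact: (mF _ mDf)|by move=> z; exact: pF].
apply: eq_integral => y _; apply: eq_integral => x _ /=.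
by rewrite -(hsym (x, y)).
Qed.

Lemma piv_frame d : d = 1 \/ d = -1 ->
  frame Spherical (piv1_mx d) /\ frame Spherical (piv2_mx d).
Proof.
move=> d1; have dd : d * d = 1 by case: d1 => ->; ring.
(* The boolean selects the axis, the first one if [true], so that both matrices are treated at
   once. *)
have A P (j : bool) : (forall p, 0 < crd P 0 p -> surface Spherical p <->
    crd P 0 p ^+ 2 + curvature R Spherical * (crd P 1 p ^+ 2 + crd P ord_max p ^+ 2) = 1) ->
  (forall p, crd P 0 p = d * p 0 (if j then 0 else 1)) ->
  (forall p, crd P 1 p = p 0 ord_max) ->
  (forall p, crd P ord_max p = p 0 (if j then 1 else 0)) ->
  forall E a1 b1 a2 b2, measurable E -> a1 < b1 -> a2 < b2 ->
    in_box a1 b1 a2 b2 E -> area Spherical (frameset Spherical P E) = garea 1 E.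
  move=> s c0 c1 c2 E a1 b1 a2 b2 mE ab1 ab2 ib; rewrite areaE /charts_area /=.
  rewrite !(@chart_areaE _ Spherical)//=; [|ring|ring].
  have dom e : e = 1 \/ e = -1 -> [set z : mR * mR | (0 < hgt2 1 z)%R] `&`
     chart_map 1 e @^-1` frameset Spherical P E =
     if j then piv_dom e d E else flip12 (piv_dom e d E).
    move=> e1; have ee : e * e = 1 by case: e1 => ->; ring.
    have hsym z : hgt2 1 (z.2, z.1) = hgt2 1 z :> R by rewrite /hgt2/=; ring.
    apply/funext => z; apply/propext; rewrite /frameset/= c0 c1 c2.
    rewrite (fun_if (fun w => w z)) /flip12 /piv_dom /hgt hsym -/(hgt 1 z).
    have sf : 0 < hgt2 1 z -> 0 < crd P 0 (chart_map 1 e z) ->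
        surface Spherical (chart_map 1 e z).
      move=> h0 cp; apply/(s _ cp); rewrite c0 c1 c2 !exprMn -[d ^+ 2]/(d * d) dd.
      by rewrite !row3E exprMn -[e ^+ 2]/(e * e) ee sqr_sqrtr ?(ltW h0)//; case: j {c0 c2 s cp}; rewrite !row3E /hgt2/=; ring.
    move: sf; rewrite c0; case: (j); rewrite !row3E/= => sf.
      by split => [[h0 [_ d0 Ez]]|[h0 d0 Ez]]; split => //; split => //; exact: sf.
    by split => [[h0 [_ d0 Ez]]|[h0 d0 Ez]]; split => //; split => //; exact: sf.
  rewrite !dom; [|by right|by left].
  (* Each hemisphere accounts for the half of [E] where the first chart coordinate, which is a
     positive multiple of $x_3$, has the corresponding sign. *)
  rewrite (garea_split mE (@sphere_pos_on E)).
  have [p1 p2] := piv_chart (or_introl erefl) d1 mE ab2 ib.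
  have [n1 n2] := piv_chart (or_intror erefl) d1 mE ab2 ib.
  have Ep : [set z : mR * mR | 0 < 1 * z.1] = [set z : mR * mR | 0 < z.1].
    by apply/seteqP; split => z /=; rewrite mul1r.
  have En : [set z : mR * mR | 0 < -1 * z.1] = [set z : mR * mR | z.1 < 0].
    by apply/seteqP; split => z /=; rewrite mulN1r oppr_gt0.
  rewrite Ep in p1 p2; rewrite En in n1 n2.
  by case: (j); rewrite ?p1 ?p2 ?n1 ?n2.
have s1 p : 0 < crd (piv1_mx d) 0 p -> surface Spherical p <->
    crd (piv1_mx d) 0 p ^+ 2 + curvature R Spherical *
     (crd (piv1_mx d) 1 p ^+ 2 + crd (piv1_mx d) ord_max p ^+ 2) = 1.
  move=> _; rewrite surface_sphere !crd_piv1 exprMn -[d ^+ 2]/(d * d) dd/=.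
  by split => h; rewrite -[RHS]h; ring.
have s2 p : 0 < crd (piv2_mx d) 0 p -> surface Spherical p <->
    crd (piv2_mx d) 0 p ^+ 2 + curvature R Spherical *
     (crd (piv2_mx d) 1 p ^+ 2 + crd (piv2_mx d) ord_max p ^+ 2) = 1.
  move=> _; rewrite surface_sphere !crd_piv2 exprMn -[d ^+ 2]/(d * d) dd/=.
  by split => h; rewrite -[RHS]h; ring.
split; split.
- by apply/matrixP; elim/ord3_ind; elim/ord3_ind; rewrite !mxE sum3 !mxE/= ?dd; ring.
- move=> p q; rewrite bilinQ !crd_piv1.
  rewrite (_ : d * _ * (d * _) = (d * d) * (p 0 0 * q 0 0)); last by ring.
  by rewrite dd/=; ring.
- exact: s1.
- by [].
- move=> E a1 b1 a2 b2 mE ab1 ab2 _ ib.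
  by apply: (A _ true s1 _ _ _ E a1 b1 a2 b2) => // p; rewrite crd_piv1.
- by apply/matrixP; elim/ord3_ind; elim/ord3_ind; rewrite !mxE sum3 !mxE/= ?dd; ring.
- move=> p q; rewrite bilinQ !crd_piv2.
  rewrite (_ : d * _ * (d * _) = (d * d) * (p 0 1 * q 0 1)); last by ring.
  by rewrite dd/=; ring.
- exact: s2.
- by [].
- move=> E a1 b1 a2 b2 mE ab1 ab2 _ ib.
  by apply: (A _ false s2 _ _ _ E a1 b1 a2 b2) => // p; rewrite crd_piv2.
Qed.

Lemma sign_mul (x : R) : x != 0 -> exists2 e : R, e = 1 \/ e = -1 & 0 < e * x.
Proof.
move=> x0; have [xp|xn|xe] := ltgtP x 0; last by rewrite xe eqxx in x0.
  by exists (-1); [right|rewrite mulN1r oppr_gt0].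
by exists 1; [left|rewrite mul1r].
Qed.

(** On the sphere some coordinate of [p] is nonzero and selects the axis; in the other two models
    the third axis always works. *)
Lemma exists_frame G p : surface G p -> exists2 P, frame G P & 0 < crd P 0 p.
Proof.
case: G.
- move=> /= p1; exists (pole_mx 1); first by apply: pole_frame; left.
  by rewrite crd_pole mul1r p1.
- move=> /surface_sphere p1.
  have [/eqP p00|/sign_mul[d d1 dp]] := boolP (p 0 0 == 0); last first.
    by exists (piv1_mx d); [case: (piv_frame d1)|rewrite crd_piv1].
  have [/eqP p01|/sign_mul[d d1 dp]] := boolP (p 0 1 == 0); last first.
    by exists (piv2_mx d); [case: (piv_frame d1)|rewrite crd_piv2].
  have [/eqP p02|/sign_mul[d d1 dp]] := boolP (p 0 ord_max == 0); last first.
    exists (pole_mx d); last by rewrite crd_pole.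
    by apply: pole_frame; case: d1; [left|right].
  by move: p1; rewrite p00 p01 p02; rewrite !expr0n/= !addr0 => /eqP; rewrite eq_sym oner_eq0.
- move=> [_ p1]; exists (pole_mx 1); first by apply: pole_frame; left.
  by rewrite crd_pole mul1r.
Qed.

End FrameExistence.

(** * Area of the cap between a chord and its arc *)

Section Fan.
Context {R : realType}.
Notation mu := (@lebesgue_measure R).
Notation mR := (measurableTypeR R).
Implicit Types K x y : R.

Definition gB K x y x' y' : R := 1 + K * (x * x' + y * y').

Lemma gB_gN K x y : gB K x y x y = gN K x y.
Proof. by rewrite /gB /gN !expr2. Qed.

(* Primitive of [gdens] against [x - a] along the line of slope [m] through
   [(a, ya)]. *)
Definition psi K a ya e m : R :=
  let ye := ya + m * (e - a) in
  (e - a) ^+ 2 / (Num.sqrt (gN K e ye) *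
    (Num.sqrt (gN K a ya) * Num.sqrt (gN K e ye) + gB K a ya e ye)).

Lemma der_psi K a ya x m : let y := ya + m * (x - a) in
  0 < gN K a ya -> 0 < gN K x y -> 0 < gB K a ya x y ->
  der (fun z => psi K a ya z m) x (gdens K x y * (x - a)).
Proof.
move=> y Na N0 B0; have s0 : 0 < Num.sqrt (gN K x y) by rewrite sqrtr_gt0.
have sa0 : 0 < Num.sqrt (gN K a ya) by rewrite sqrtr_gt0.
have dN : der (fun z => gN K z (ya + m * (z - a))) x (2 * K * (x + m * y)).
  by rewrite /gN /y; der_auto => /=; ring.
have dB : der (fun z => gB K a ya z (ya + m * (z - a))) x (K * (a + ya * m)).
  by rewrite /gB /y; der_auto => /=; ring.
have den0 : 0 < Num.sqrt (gN K x y) *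
    (Num.sqrt (gN K a ya) * Num.sqrt (gN K x y) + gB K a ya x y).
  by rewrite mulr_gt0// addr_gt0// mulr_gt0.
rewrite /psi /=.
der_auto => //; first by rewrite gt_eqF.
rewrite /= -/y /gdens.
have E1 : gN K x y = Num.sqrt (gN K x y) ^+ 2 by rewrite sqr_sqrtr// ltW.
have E2 : gN K a ya = Num.sqrt (gN K a ya) ^+ 2 by rewrite sqr_sqrtr// ltW.
move: E1 E2 s0 sa0 den0.
move: (Num.sqrt (gN K x y)) (Num.sqrt (gN K a ya)) => s r E1 E2 s0 r0 den0.
have e1 : s ^+ 2 = 1 + K * (x ^+ 2 + y ^+ 2) by rewrite -E1.
have e2 : r ^+ 2 = 1 + K * (a ^+ 2 + ya ^+ 2) by rewrite -E2.
rewrite E1.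
have h1 : s * (r * s + gB K a ya x y) != 0 by rewrite gt_eqF.
have h2 : s != 0 by rewrite gt_eqF.
have h3 : r * s + gB K a ya x y != 0 by move: h1; rewrite mulf_eq0 negb_or => /andP[].
set b := gB K a ya x y in h1 h3 *.
(* [P] is half the derivative of [gN] along the line and [Q] the derivative of [gB]. As the line
   passes through [(a, ya)], multiplying them by [u] gives differences of $s^2$, $b$ and $r^2$; this
   eliminates [K] and [m]. *)
pose u := x - a; pose P := K * (x + m * y); pose Q := K * (a + ya * m).
have hP : u * P = s ^+ 2 - b by rewrite e1 /b /gB /u /P /y; ring.
have hQ : u * Q = b - r ^+ 2 by rewrite e2 /b /gB /u /Q /y; ring.
pose D' := P / s * (r * s + b) + s * (r * (P / s) + Q).
have uD' : u * D' = (s ^+ 2 - b) / s * (r * s + b) + s * (r * ((s ^+ 2 - b) / s) + (b - r ^+ 2)).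
  by rewrite -hP -hQ /D'; field.
transitivity (u * (2 * (s * (r * s + b)) - u * D') / (s * (r * s + b)) ^+ 2).
  by rewrite /D' /u /P /Q; field; rewrite h2 h3 (gt_eqF r0).
by rewrite uD' -/u; field; rewrite h2 h3.
Qed.

Section Triangle.
Variables (K l r lo hi nu : R).
Hypothesis nu0 : 0 < nu.
Hypothesis box : forall x x' y y' : R, x \in `]l, r[ -> x' \in `]l, r[ ->
  y \in `]lo, hi[ -> y' \in `]lo, hi[ -> nu <= gB K x y x' y'.

(** Closed below and open above, so that the difference of two caps with the same left end contains
    one such triangle and is contained in another. *)
Definition tri (a ya e m m' : R) (z : mR * mR) : Prop :=
  (a < z.1 /\ z.1 < e) /\
  (ya + m * (z.1 - a) <= z.2 /\ z.2 < ya + m' * (z.1 - a)).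

Lemma measurable_ler_set d (T : measurableType d) (f g : T -> R) :
  measurable_fun setT f -> measurable_fun setT g ->
  measurable [set x | f x <= g x].
Proof.
move=> mf mg; rewrite (_ : [set z | _] = ~` [set z | g z < f z]).
  by apply: measurableC; exact: measurable_ltr_set.
by apply/seteqP; split => z /=; rewrite leNgt => /negP.
Qed.

Lemma measurable_tri a ya e m m' : measurable (tri a ya e m m').
Proof.
apply: measurableI; apply: measurableI.
- by apply: measurable_ltr_set; mfun.
- by apply: measurable_ltr_set; mfun.
- by apply: measurable_ler_set; mfun.
- by apply: measurable_ltr_set; mfun.
Qed.

Let box_gN x y : x \in `]l, r[ -> y \in `]lo, hi[ -> 0 < gN K x y.
Proof. by move=> xI yJ; rewrite -gB_gN (lt_le_trans nu0)// box. Qed.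

Lemma int_psi a ya e m : a < e -> a \in `]l, r[ -> e \in `]l, r[ ->
  (forall x, x \in `[a, e] -> ya + m * (x - a) \in `]lo, hi[) ->
  (\int[mu]_(x in `]a, e[) (gdens K x (ya + m * (x - a)) * (x - a))%:E = (psi K a ya e m)%:E)%E.
Proof.
move=> ae aI eI J.
have sub x : x \in `[a, e] -> x \in `]l, r[.
  by move: aI eI; rewrite !in_itv/= => /andP[? ?] /andP[? ?] /andP[]; lra.
have yaJ : ya \in `]lo, hi[.
  by have := J a; rewrite subrr mulr0 addr0; apply; rewrite in_itv/= lexx ltW.
have dpsi x : x \in `[a, e] ->
    der (fun z => psi K a ya z m) x (gdens K x (ya + m * (x - a)) * (x - a)).
  move=> xae; apply: der_psi.
  - exact: box_gN.
  - by apply: box_gN; [exact: sub|exact: J].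
  - by rewrite (lt_le_trans nu0)// box// ?sub ?J.
have cint : {within `[a, e], continuous (fun x => gdens K x (ya + m * (x - a)) * (x - a))}.
  apply: continuous_in_subspaceT => x; rewrite inE/= => xae.
  have N0 := box_gN (sub x xae) (J x xae).
  have s0 : Num.sqrt (gN K x (ya + m * (x - a))) != 0 by rewrite gt_eqF ?sqrtr_gt0.
  have dN : der (fun z => gN K z (ya + m * (z - a))) x (2 * K * (x + m * (ya + m * (x - a)))).
    by rewrite /gN; der_auto => /=; ring.
  by apply: der_cont; rewrite /gdens; der_auto => //; rewrite mulf_neq0// gt_eqF.
have mg : measurable_fun setT (fun x : mR => (gdens K x (ya + m * (x - a)) * (x - a) : mR)).
  by rewrite /gdens /gN; mfun.
have mg' (D : set R) : measurable_fun D (fun x => (gdens K x (ya + m * (x - a)) * (x - a))%:E).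
  by apply/measurable_EFinP; exact: measurable_funTS.
rewrite integral_itv_obnd_cbnd; last exact: mg'.
rewrite integral_itv_bndo_bndc; last exact: mg'.
rewrite (@continuous_FTC2 _ _ (fun z => psi K a ya z m) a e ae)//.
- rewrite [X in (_ - X%:E)%E](_ : _ = 0) ?sube0//.
  by rewrite /psi subrr expr0n/= mul0r.
- split.
  + by move=> x /subset_itv_oo_cc /dpsi [].
  + have aae : a \in `[a, e] by rewrite in_itv/= lexx ltW.
    by apply: cvg_at_right_filter; exact: (der_cont (dpsi a aae)).
  + have eae : e \in `[a, e] by rewrite in_itv/= lexx ltW.
    by apply: cvg_at_left_filter; exact: (der_cont (dpsi e eae)).
- by move=> x /subset_itv_oo_cc /dpsi /der_derive1.
Qed.

(* The triangle is swept by the lines through the apex [(a, ya)]. *)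
Lemma tri_area a ya e m0 m m' m1 : a < e -> a \in `]l, r[ -> e \in `]l, r[ ->
  m0 < m -> m' < m1 ->
  (forall x k, x \in `[a, e] -> k \in `]m0, m1[ -> ya + k * (x - a) \in `]lo, hi[) ->
  garea K (tri a ya e m m') = (\int[mu]_(k in `[m, m'[) (psi K a ya e k)%:E)%E.
Proof.
move=> ae aI eI mm0 mm1 J.
have sub x : x \in `[a, e] -> x \in `]l, r[.
  by move: aI eI; rewrite !in_itv/= => /andP[? ?] /andP[? ?] /andP[]; lra.
have [m'm|mm'] := leP m' m.
  have -> : `[m, m'[%classic = set0 :> set R.
    by apply/seteqP; split => z //=; rewrite in_itv/= => /andP[]; lra.
  rewrite integral_set0 /garea integral0_eq// => z _.
  rewrite indicE memNset ?mul0r// => -[[az ze] [h1 h2]].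
  have := le_lt_trans h1 h2; rewrite ltrD2l ltr_pM2r ?subr_gt0//.
  by rewrite ltNge m'm.
have Tpos : pos_on K (tri a ya e m m').
  move=> z [[az ze] [h1 h2]].
  have zae : z.1 \in `[a, e] by rewrite in_itv/= !ltW.
  apply: box_gN; first exact: sub.
  have := J z.1 m zae; have := J z.1 m' zae; rewrite !in_itv/= => j1 j2.
  have /andP[_ hh] := j1 (introT andP (conj (lt_trans mm0 mm') mm1)).
  have /andP[ll _] := j2 (introT andP (conj mm0 (lt_trans mm' mm1))).
  by rewrite (lt_le_trans ll h1) (lt_trans h2 hh).
rewrite /garea fubini_tonelli1; [|by apply: measurable_garea_fun; exact: measurable_tri|by move=> z; exact: pos_garea_ge0].
(* At fixed [x] the ordinate [ya + k * (x - a)] has derivative [x - a] in the slope [k]. The order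
   of integration is then exchanged, so that [int_psi] can be applied on each line. *)
pose g (x k : R) := \1_`]a, e[%classic x * (\1_`[m, m'[%classic k * (gdens K x (ya + k * (x - a)) * (x - a))) : R.
transitivity (\int[mu]_x \int[mu]_k (g x k)%:E)%E.
  apply: eq_integral => x _; rewrite /fubini_F/=.
  have [xae|xae] := boolP (x \in `]a, e[); last first.
    rewrite integral0_eq; last first.
      move=> y _; rewrite indicE memNset ?mul0r// => -[[/= az ze] _].
      by move: xae; rewrite in_itv/= az ze.
    rewrite integral0_eq// => k _; rewrite /g indicE memNset ?mul0r//=.
    exact/negP.
  have xae' := subset_itv_oo_cc xae.
  have ax : 0 < x - a by move: xae; rewrite in_itv/= subr_gt0 => /andP[].
  pose D : set R := [set y | tri a ya e m m' (x, y)].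
  have mD : measurable D.
    rewrite (_ : D = xsection (tri a ya e m m') x).
      by apply: measurable_xsection; exact: measurable_tri.
    by apply/seteqP; split => y; rewrite /xsection/= inE.
  transitivity (\int[mu]_y (\1_D y * gdens K x y)%:E)%E.
    by apply: eq_integral => y _; congr (_ * _)%:E; apply: indic_mem.
  have dphi k : der (fun k => ya + k * (x - a)) k (x - a) by der_auto => /=; ring.
  rewrite (@integral_subst_indic _ (fun k => ya + k * (x - a)) (fun=> x - a) (gdens K x) m0 m1 D)//.
  - apply: eq_integral => k _; rewrite /g (_ : \1__ x = 1) ?mul1r; last first.
      by rewrite indicE mem_set.
    congr (_ * _)%:E; apply: indic_mem; rewrite /D /tri/= !in_itv/=.
    rewrite lerD2l ltrD2l ler_pM2r// ltr_pM2r//.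
    move: xae; rewrite in_itv/= => /andP[ax' xe]; split.
      by move=> [[_ [h1 h2]] _]; apply/andP.
    by move=> /andP[h1 h2]; split => //; apply/andP; split; [exact: lt_le_trans h1|exact: lt_trans mm1].
  - by move=> k _; exact: dphi.
  - by move=> k _; exact: cvg_cst.
  - move=> k kk.
    have N0 := box_gN (sub x xae') (J x k xae' kk).
    have s0 : Num.sqrt (gN K x (ya + k * (x - a))) != 0 by rewrite gt_eqF ?sqrtr_gt0.
    have dN := der_gN K x (ya + k * (x - a)).
    by apply: der_cont; rewrite /gdens; der_auto => //; rewrite mulf_neq0// gt_eqF.
  - by move=> k kk; apply/gdens_ge0/box_gN; [exact: sub|exact: J].
  - move=> y [_ [/= h1 h2]]; exists ((y - ya) / (x - a)); last by field; rewrite gt_eqF.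
    rewrite /= in_itv/= ltr_pdivlMr// ltr_pdivrMr//; apply/andP; split.
      rewrite ltrBrDl; apply: lt_le_trans h1; rewrite ltrD2l ltr_pM2r//.
    rewrite ltrBlDl; apply: lt_trans h2 _; rewrite ltrD2l ltr_pM2r//.
rewrite (fubini_tonelli (fun z : mR * mR => (g z.1 z.2)%:E)) /=; last 2 first.
- apply/measurable_EFinP; rewrite /g; apply: measurable_funM.
    by apply: measurableT_comp; [exact: measurable_indic|exact: measurable_fst].
  apply: measurable_funM.
    by apply: measurableT_comp; [exact: measurable_indic|exact: measurable_snd].
  by rewrite /gdens /gN; mfun.
- move=> [x k]/=; rewrite lee_fin /g !indicE.
  have [xae|] := boolP (x \in `]a, e[%classic); last by rewrite mul0r.
  have [kk|] := boolP (k \in `[m, m'[%classic); last by rewrite mul0r mulr0.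
  rewrite !mul1r; move: xae kk; rewrite !inE/= => xae kk.
  have xae' := subset_itv_oo_cc xae.
  rewrite mulr_ge0//; last by move: xae; rewrite in_itv/= subr_ge0 => /andP[/ltW].
  apply/gdens_ge0/box_gN; [exact: sub|apply: J => //].
  move: kk; rewrite !in_itv/= => /andP[h1 h2].
  by rewrite (lt_le_trans mm0 h1) (lt_trans h2 mm1).
rewrite [RHS]integral_mkcond; apply: eq_integral => k _; rewrite patchE.
case: ifPn => kk; last first.
  rewrite integral0_eq// => x _.
  by rewrite /g [X in _ * (X * _)]indicE (negbTE kk) mul0r mulr0.
rewrite -int_psi//; last first.
  move=> x xae; apply: J => //; move: kk; rewrite inE/= !in_itv/= => /andP[h1 h2].
  by rewrite (lt_le_trans mm0 h1) (lt_trans h2 mm1).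
rewrite [RHS]integral_indicM; apply: eq_integral => x _; congr _%:E; rewrite /g.
by rewrite [X in _ * (X * _)]indicE kk mul1r.
Qed.

End Triangle.
End Fan.

Section Caps.
Context {R : realType}.
Notation mu := (@lebesgue_measure R).
Notation mR := (measurableTypeR R).
Implicit Types K x y : R.

Lemma garea_subset K (A B : set (mR * mR)) : measurable A -> measurable B ->
  pos_on K B -> A `<=` B -> (garea K A <= garea K B)%E.
Proof.
move=> mA mB pB AB; have pA : pos_on K A by move=> z /AB /pB.
apply: ge0_le_integral => //.
- by move=> z _; exact: pos_garea_ge0.
- exact: measurable_garea_fun.
- exact: measurable_garea_fun.
- move=> z _; rewrite lee_fin !indicE.
  have [zA|zA] := boolP (z \in A).
    by rewrite (mem_set (AB _ (set_mem zA))).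
  rewrite mul0r; have [/set_mem/pB N0|_] := boolP (z \in B); last by rewrite mul0r.
  by rewrite mul1r gdens_ge0.
Qed.

Lemma garea_setD K (A B : set (mR * mR)) : measurable A -> measurable B ->
  pos_on K B -> A `<=` B -> garea K B = (garea K A + garea K (B `\` A))%E.
Proof.
move=> mA mB pB AB; have pA : pos_on K A by move=> z /AB /pB.
have mD : measurable (B `\` A) by exact: measurableD.
have pD : pos_on K (B `\` A) by move=> z [/pB].
rewrite /garea -ge0_integralD//; last 4 first.
- by move=> z _; exact: pos_garea_ge0.
- exact: measurable_garea_fun.
- by move=> z _; exact: pos_garea_ge0.
- exact: measurable_garea_fun.
apply: eq_integral => z _; rewrite -EFinD -mulrDl; congr (_ * _)%:E.
rewrite !indicE in_setD; have [zA|zA] := boolP (z \in A).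
  by rewrite (mem_set (AB _ (set_mem zA)))/= addr0.
by rewrite andbT add0r.
Qed.

Section Cap.
Variables (K l r lo hi nu : R) (f df : R -> R).
Hypothesis nu0 : 0 < nu.
Hypothesis box : forall x x' y y' : R, x \in `]l, r[ -> x' \in `]l, r[ ->
  y \in `]lo, hi[ -> y' \in `]lo, hi[ -> nu <= gB K x y x' y'.
Hypothesis fd : forall x, x \in `]l, r[ -> der f x (df x).
Hypothesis df_incr : forall x y, x \in `]l, r[ -> y \in `]l, r[ -> x < y -> df x < df y.
Hypothesis lines : forall a x xi, a \in `]l, r[ -> x \in `]l, r[ -> xi \in `]l, r[ ->
  f a + df xi * (x - a) \in `]lo, hi[.

Definition slope a b : R := (f b - f a) / (b - a).

Lemma itv_between a b x : a \in `]l, r[ -> b \in `]l, r[ -> a <= x -> x <= b -> x \in `]l, r[.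
Proof. by rewrite !in_itv/= => /andP[? ?] /andP[? ?] ? ?; apply/andP; split; lra. Qed.

Lemma slope_df a b : a \in `]l, r[ -> b \in `]l, r[ -> a < b ->
  exists2 xi, a < xi < b & slope a b = df xi.
Proof.
move=> aI bI ab.
have sub x : x \in `[a, b] -> x \in `]l, r[.
  by rewrite in_itv/= => /andP[? ?]; exact: (itv_between aI bI).
have [|xi xiab e] := @MVT _ f df a b ab (fun x xab => fd (sub _ (subset_itv_oo_cc xab))).
  by apply: derivable_within_continuous => x /sub /fd [].
exists xi; first by move: xiab; rewrite in_itv.
by rewrite /slope e mulfK// subr_eq0 gt_eqF.
Qed.

Lemma slope_mul a b : a < b -> slope a b * (b - a) = f b - f a.
Proof. by move=> ab; rewrite /slope divfK// subr_eq0 gt_eqF. Qed.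

Lemma slope_lt a c d : a \in `]l, r[ -> d \in `]l, r[ -> a < c -> c < d ->
  slope a c < slope a d.
Proof.
move=> aI dI ac cd.
have cI := itv_between aI dI (ltW ac) (ltW cd).
have [x1 /andP[ax1 x1c] e1] := slope_df aI cI ac.
have [x2 /andP[cx2 x2d] e2] := slope_df cI dI cd.
have s12 : slope a c < slope c d.
  rewrite e1 e2; apply: df_incr; last exact: lt_trans cx2.
    exact: (itv_between aI cI (ltW ax1) (ltW x1c)).
  exact: (itv_between cI dI (ltW cx2) (ltW x2d)).
have h1 := slope_mul ac; have h2 := slope_mul cd; have h3 := slope_mul (lt_trans ac cd).
rewrite -(@ltr_pM2r _ (d - a)) ?subr_gt0 ?(lt_trans ac)// h3.
rewrite (_ : f d - f a = slope c d * (d - c) + slope a c * (c - a)); last first.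
  by rewrite h1 h2; ring.
rewrite -subr_gt0 (_ : _ - _ = (slope c d - slope a c) * (d - c)); last by ring.
by rewrite mulr_gt0// subr_gt0.
Qed.

Lemma df_lt_slope a b : a \in `]l, r[ -> b \in `]l, r[ -> a < b -> df a < slope a b.
Proof.
move=> aI bI ab; have [xi /andP[axi xib] ->] := slope_df aI bI ab.
by apply: df_incr => //; apply: (itv_between aI bI); exact: ltW.
Qed.

Lemma slope_lt_df a b : a \in `]l, r[ -> b \in `]l, r[ -> a < b -> slope a b < df b.
Proof.
move=> aI bI ab; have [xi /andP[axi xib] ->] := slope_df aI bI ab.
by apply: df_incr => //; apply: (itv_between aI bI); exact: ltW.
Qed.

Definition cap a b (z : mR * mR) : Prop :=
  (a < z.1 /\ z.1 < b) /\ (f z.1 < z.2 /\ z.2 < f a + slope a b * (z.1 - a)).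

Lemma measurable_cap a b : a \in `]l, r[ -> b \in `]l, r[ -> measurable (cap a b).
Proof.
(* Nothing is known of [f] outside the interval; its extension by 0 is measurable and agrees with it
   over the cap. *)
move=> aI bI; pose h : R -> R := f \_ `]l, r[%classic.
have mh : measurable_fun setT h.
  apply: (proj1 (measurable_restrictT f (measurable_itv `]l, r[))).
  by apply: open_continuous_measurable_fun => // x; rewrite inE/= => /fd /der_cont.
have -> : cap a b = ([set z : mR * mR | a < z.1] `&` [set z | z.1 < b]) `&`
   ([set z : mR * mR | h z.1 < z.2] `&` [set z | z.2 < f a + slope a b * (z.1 - a)]).
  apply/seteqP; split => z [[/= az zb] [h1 h2]].
    have zI := itv_between aI bI (ltW az) (ltW zb).
    by do 2 split => //=; rewrite /h patchE mem_set.
  have zI := itv_between aI bI (ltW az) (ltW zb).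
  by do 2 split => //=; move: h1; rewrite /h patchE mem_set.
apply: measurableI; apply: measurableI.
- by apply: measurable_ltr_set; mfun.
- by apply: measurable_ltr_set; mfun.
- by apply: measurable_ltr_set; [exact: measurableT_comp|mfun].
- by apply: measurable_ltr_set; mfun.
Qed.

Lemma line_cmp a x m k : a < x -> (f a + m * (x - a) < f a + k * (x - a)) = (m < k).
Proof. by move=> ax; rewrite ltrD2l ltr_pM2r// subr_gt0. Qed.

Lemma line_cmpe a x m k : a < x -> (f a + m * (x - a) <= f a + k * (x - a)) = (m <= k).
Proof. by move=> ax; rewrite lerD2l ler_pM2r// subr_gt0. Qed.

Lemma f_line a x : a < x -> f x = f a + slope a x * (x - a).
Proof. by move=> ax; rewrite slope_mul//; ring. Qed.

Lemma f_lo a : a \in `]l, r[ -> f a \in `]lo, hi[.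
Proof. by move=> aI; have := lines aI aI aI; rewrite subrr mulr0 addr0. Qed.

Lemma fan_box a x xi0 xi1 k : a \in `]l, r[ -> x \in `]l, r[ -> a <= x ->
  xi0 \in `]l, r[ -> xi1 \in `]l, r[ -> df xi0 <= k -> k <= df xi1 ->
  f a + k * (x - a) \in `]lo, hi[.
Proof.
move=> aI xI ax x0 x1 k0 k1.
have := lines aI xI x0; have := lines aI xI x1; rewrite !in_itv/= => /andP[_ h1] /andP[h2 _].
apply/andP; split.
  by apply: (lt_le_trans h2); rewrite lerD2l ler_wpM2r// subr_ge0.
by apply: le_lt_trans h1; rewrite lerD2l ler_wpM2r// subr_ge0.
Qed.

Lemma in_itv_mid : forall a, a \in `]l, r[ -> exists2 a', a' \in `]l, r[ & a' < a.
Proof.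
move=> a; rewrite in_itv/= => /andP[la ar]; exists ((l + a) / 2); last by rewrite midf_lt.
by rewrite in_itv/=; apply/andP; split; lra.
Qed.

Lemma in_itv_midr : forall a, a \in `]l, r[ -> exists2 a', a' \in `]l, r[ & a < a'.
Proof.
move=> a; rewrite in_itv/= => /andP[la ar]; exists ((a + r) / 2); last by rewrite midf_lt.
by rewrite in_itv/=; apply/andP; split; lra.
Qed.

Lemma tri_bounds a e m m' c1 c2 xi0 xi1 : a \in `]l, r[ -> e \in `]l, r[ -> a < e ->
  xi0 \in `]l, r[ -> xi1 \in `]l, r[ -> df xi0 < m -> m' < df xi1 -> m <= m' ->
  0 <= c1 -> (forall k, m <= k -> k <= m' -> c1 <= psi K a (f a) e k <= c2) ->
  ((c1 * (m' - m))%:E <= garea K (tri a (f a) e m m') <= (c2 * (m' - m))%:E)%E.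
Proof.
move=> aI eI ae x0 x1 mm0 mm1 mm' c10 cb.
rewrite (tri_area nu0 box ae aI eI mm0 mm1); last first.
  move=> x k; rewrite !in_itv/= => /andP[ax xe] /andP[k0 k1].
  have xI := itv_between aI eI ax xe.
  by have := fan_box aI xI ax x0 x1 (ltW k0) (ltW k1); rewrite in_itv.
have mpsi : measurable_fun setT (psi K a (f a) e : mR -> mR).
  by rewrite /psi /gB /gN; mfun.
have cst (c : R) : ((c * (m' - m))%:E = \int[mu]_(k in `[m, m'[) (c%:E))%E.
  rewrite integral_cst//= lebesgue_measure_itv/= lte_fin.
  case: ltP => [_|m'm]; first by rewrite -EFinD -EFinM.
  by have -> : m' = m; [apply/le_anti/andP|rewrite subrr mulr0 mule0].
apply/andP; split; rewrite cst.
  apply: ge0_le_integral => //.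
  - by apply/measurable_EFinP; exact: measurable_funTS.
  - by move=> k; rewrite /= in_itv/= => /andP[k1 k2]; rewrite lee_fin; case/andP: (cb k k1 (ltW k2)).
apply: ge0_le_integral => //.
- by move=> k; rewrite /= in_itv/= => /andP[k1 k2]; rewrite lee_fin; case/andP: (cb k k1 (ltW k2)) => /(le_trans c10).
- by apply/measurable_EFinP; exact: measurable_funTS.
- by move=> k; rewrite /= in_itv/= => /andP[k1 k2]; rewrite lee_fin; case/andP: (cb k k1 (ltW k2)).
Qed.

Lemma cap_tri a b : a \in `]l, r[ -> b \in `]l, r[ -> a < b ->
  cap a b `<=` tri a (f a) b (df a) (slope a b).
Proof.
move=> aI bI ab z [[az zb] [h1 h2]]; split => //; split => //.
have zI := itv_between aI bI (ltW az) (ltW zb).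
rewrite (le_trans _ (ltW h1))// (f_line az) line_cmpe//.
by rewrite ltW// df_lt_slope.
Qed.

Lemma cap_pos a b : a \in `]l, r[ -> b \in `]l, r[ -> a < b -> pos_on K (cap a b).
Proof.
move=> aI bI ab z [[az zb] [h1 h2]].
have zI := itv_between aI bI (ltW az) (ltW zb).
rewrite -gB_gN (lt_le_trans nu0)//; apply: box => //.
all: have := f_lo zI; have [xi /andP[x1 x2] e] := slope_df aI bI ab.
all: have xI := itv_between aI bI (ltW x1) (ltW x2).
all: have := lines aI zI xI; rewrite -e !in_itv/= => /andP[_ u1] /andP[u2 _].
all: by rewrite (lt_trans u2 h1) (lt_trans h2 u1).
Qed.

Lemma cap_sub a c d : a \in `]l, r[ -> d \in `]l, r[ -> a < c -> c < d ->
  cap a c `<=` cap a d.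
Proof.
move=> aI dI ac cd z [[az zc] [h1 h2]]; split; split => //.
  exact: lt_trans cd.
by apply: (lt_trans h2); rewrite line_cmp// slope_lt.
Qed.

Lemma tri_cap a c d : a \in `]l, r[ -> d \in `]l, r[ -> a < c -> c < d ->
  tri a (f a) c (slope a c) (slope a d) `<=` cap a d `\` cap a c.
Proof.
move=> aI dI ac cd z [[az zc] [h1 h2]].
have cI := itv_between aI dI (ltW ac) (ltW cd).
split; last by move=> [_ [_]]; rewrite ltNge h1.
split; split => //; first exact: lt_trans cd.
apply: lt_le_trans h1; rewrite (f_line az) line_cmp//.
exact: slope_lt.
Qed.

Lemma capD_tri a c d : a \in `]l, r[ -> d \in `]l, r[ -> a < c -> c < d ->
  cap a d `\` cap a c `<=` tri a (f a) d (slope a c) (slope a d).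
Proof.
move=> aI dI ac cd z [[[az zd] [h1 h2]] nc].
have zI := itv_between aI dI (ltW az) (ltW zd).
split => //; split => //; rewrite leNgt; apply/negP => h3; apply: nc.
split => //; split => //; rewrite ltNge; apply/negP => cz.
have := lt_trans h1 h3; rewrite (f_line az) line_cmp// => h4.
move: cz; rewrite le_eqVlt => /orP[/eqP cz|cz]; first by move: h4; rewrite cz ltxx.
by have := slope_lt aI zI ac cz; rewrite ltNge ltW.
Qed.

(** On the box the denominator of [psi] is at least [Num.sqrt nu * nu]: one square root and [gB] are
    bounded below, the remaining product is nonnegative. *)
Lemma psi_bounds a e k xi0 xi1 : a \in `]l, r[ -> e \in `]l, r[ -> a < e ->
  xi0 \in `]l, r[ -> xi1 \in `]l, r[ -> df xi0 <= k -> k <= df xi1 ->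
  0 < psi K a (f a) e k <= (e - a) ^+ 2 / (Num.sqrt nu * nu).
Proof.
move=> aI eI ae x0 x1 k0 k1; have yI := fan_box aI eI (ltW ae) x0 x1 k0 k1.
rewrite /psi; set y := f a + _ in yI *.
have B := box aI eI (f_lo aI) yI; have N := box eI eI yI yI; rewrite gB_gN in N.
have N0 := lt_le_trans nu0 N; have B0 := lt_le_trans nu0 B.
have d0 : 0 < Num.sqrt (gN K e y) *
    (Num.sqrt (gN K a (f a)) * Num.sqrt (gN K e y) + gB K a (f a) e y).
  by rewrite mulr_gt0 ?sqrtr_gt0// ltr_wpDl// mulr_ge0// sqrtr_ge0.
apply/andP; split; first by rewrite divr_gt0// exprn_gt0// subr_gt0.
rewrite ler_wpM2l ?sqr_ge0// lef_pV2 ?posrE//; last by rewrite mulr_gt0// sqrtr_gt0.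
apply: ler_pM; rewrite ?sqrtr_ge0 ?(ltW nu0)//; first by rewrite ler_wsqrtr.
by rewrite (le_trans B)// lerDr mulr_ge0// sqrtr_ge0.
Qed.

Definition carea a b : R := fine (garea K (cap a b)).

Lemma tri_pos a e m m' xi0 xi1 : a \in `]l, r[ -> e \in `]l, r[ ->
  xi0 \in `]l, r[ -> xi1 \in `]l, r[ -> df xi0 <= m -> m' <= df xi1 ->
  pos_on K (tri a (f a) e m m').
Proof.
move=> aI eI x0 x1 k0 k1 z [[az ze] [h1 h2]].
have zI := itv_between aI eI (ltW az) (ltW ze).
rewrite -gB_gN (lt_le_trans nu0)//; apply: box => //.
all: have := lines aI zI x0; have := lines aI zI x1; rewrite !in_itv/= => /andP[_ u1] /andP[u2 _].
all: have l1 : f a + df xi0 * (z.1 - a) <= f a + m * (z.1 - a) by rewrite line_cmpe.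
all: have l2 : f a + m' * (z.1 - a) <= f a + df xi1 * (z.1 - a) by rewrite line_cmpe.
all: by rewrite (lt_le_trans u2 (le_trans l1 h1)) (lt_trans (lt_le_trans h2 l2) u1).
Qed.

(** The cap lies in the triangle with apex over [a] between the tangent there and the chord. This
    makes the area finite, and small for short caps. *)
Lemma cap_area_le a b : a \in `]l, r[ -> b \in `]l, r[ -> a < b ->
  (0 <= garea K (cap a b) <= (((b - a) ^+ 2 / (Num.sqrt nu * nu)) * (slope a b - df a))%:E)%E.
Proof.
move=> aI bI ab; apply/andP; split.
  by apply: integral_ge0 => z _; apply: pos_garea_ge0; exact: cap_pos.
have [a' a'I a'a] := in_itv_mid aI.
have dfs := df_lt_slope aI bI ab; have sdf := slope_lt_df aI bI ab.
have := @tri_bounds a b (df a) (slope a b) 0 ((b - a) ^+ 2 / (Num.sqrt nu * nu)) a' b aI bI ab a'I bI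
  (df_incr a'I aI a'a) sdf (ltW dfs) (lexx _).
case/(_ _)/andP => [k k1 k2|_]; last first.
  apply: le_trans; apply: garea_subset.
  - exact: measurable_cap.
  - exact: measurable_tri.
  - exact: (tri_pos aI bI aI bI (lexx _) (ltW sdf)).
  - exact: cap_tri.
have /andP[p0 ->] := psi_bounds aI bI ab aI bI k1 (le_trans k2 (ltW sdf)).
by rewrite ltW.
Qed.

Lemma careaE a b : a \in `]l, r[ -> b \in `]l, r[ -> a < b ->
  garea K (cap a b) = (carea a b)%:E.
Proof.
move=> aI bI ab; rewrite /carea fineK//.
have /andP[h1 h2] := cap_area_le aI bI ab.
by rewrite ge0_fin_numE// (le_lt_trans h2)// ltry.
Qed.

Lemma carea_le a b : a \in `]l, r[ -> b \in `]l, r[ -> a < b ->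
  carea a b <= ((b - a) ^+ 2 / (Num.sqrt nu * nu)) * (slope a b - df a).
Proof.
move=> aI bI ab; rewrite -lee_fin -careaE//.
by case/andP: (cap_area_le aI bI ab).
Qed.

(** Moving the right end from [c] to [d] adds a region squeezed between two triangles with apex over
    [a]. Both lie between the two chord directions; one stops at abscissa [c], the other at [d]. *)
Lemma carea_incr a c d c1 c2 : a \in `]l, r[ -> d \in `]l, r[ -> a < c -> c < d ->
  0 <= c1 ->
  (forall k, slope a c <= k -> k <= slope a d ->
     c1 <= psi K a (f a) c k /\ psi K a (f a) d k <= c2) ->
  c1 * (slope a d - slope a c) <= carea a d - carea a c <= c2 * (slope a d - slope a c).
Proof.
move=> aI dI ac cd c10 cb; have ad := lt_trans ac cd.
have cI := itv_between aI dI (ltW ac) (ltW cd).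
have [d' d'I dd'] := in_itv_midr dI.
have s1 := slope_lt aI dI ac cd.
have s0 := df_lt_slope aI cI ac.
have s2 := slope_lt_df aI dI ad.
have mD : measurable (cap a d `\` cap a c).
  by apply: measurableD; apply: measurable_cap.
have pD : pos_on K (cap a d `\` cap a c) by move=> z [/(cap_pos aI dI ad)].
have eD : (garea K (cap a d `\` cap a c) = (carea a d - carea a c)%:E)%E.
  have := @garea_setD K _ _ (measurable_cap aI cI) (measurable_cap aI dI)
    (cap_pos aI dI ad) (cap_sub aI dI ac cd).
  rewrite !careaE// => e; rewrite EFinB e addeAC subee ?add0e//.
have psiP e k : e \in `]l, r[ -> a < e -> slope a c <= k -> k <= slope a d ->
    0 < psi K a (f a) e k <= (e - a) ^+ 2 / (Num.sqrt nu * nu).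
  move=> eI ae k1 k2; apply: (psi_bounds aI eI ae aI dI).
    exact: (ltW (lt_le_trans s0 k1)).
  exact: (ltW (le_lt_trans k2 s2)).
rewrite -!lee_fin -eD; apply/andP; split.
  have /andP[+ _] := @tri_bounds a c _ _ c1 ((c - a) ^+ 2 / (Num.sqrt nu * nu)) a d
    aI cI ac aI dI s0 s2 (ltW s1) c10
    (fun k k1 k2 => introT andP (conj (cb k k1 k2).1 (proj2 (andP (psiP c k cI ac k1 k2))))).
  move=> /le_trans; apply; apply: garea_subset => //.
  - exact: measurable_tri.
  - exact: tri_cap.
have /andP[_] := @tri_bounds a d _ _ 0 c2 a d aI dI ad aI dI s0 s2 (ltW s1) (lexx _)
  (fun k k1 k2 => introT andP (conj (ltW (proj1 (andP (psiP d k dI ad k1 k2)))) (cb k k1 k2).2)).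
apply: le_trans; apply: garea_subset => //.
- exact: measurable_tri.
- exact: (tri_pos aI dI aI dI (ltW s0) (ltW s2)).
- exact: capD_tri.
Qed.

End Cap.
End Caps.

(** * Partial derivatives of the cap area *)

Section Limits.
Context {R : realType}.

Lemma cvg_sqrt (T : Type) (F : set_system T) {FF : Filter F} (u : T -> R) (a : R) :
  u x @[x --> F] --> a -> Num.sqrt (u x) @[x --> F] --> Num.sqrt a.
Proof. by move=> ua; apply: continuous_cvg => //; exact: sqrt_continuous. Qed.

Lemma der_cvg (f : R -> R) (x a : R) : der f x a ->
  (fun h : R => h^-1 * (f (h + x) - f x)) @ 0^' --> a.
Proof.
case=> /cvg_ex[/= l fl] <-; have e : (fun h : R => h^-1 * (f (h + x) - f x)) =
   (fun h : R => h^-1 *: ((f \o shift x) (h *: (1 : R)) - f x)).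
  by apply/funext => h /=; rewrite /GRing.scale/= mulr1.
by rewrite e; have := fl; rewrite /derive => fl'; rewrite (cvg_lim _ fl').
Qed.

Lemma cvg_der (f : R -> R) (x a : R) :
  (fun h : R => h^-1 * (f (h + x) - f x)) @ 0^' --> a -> der f x a.
Proof.
have e : (fun h : R => h^-1 * (f (h + x) - f x)) =
   (fun h : R => h^-1 *: ((f \o shift x) (h *: (1 : R)) - f x)).
  by apply/funext => h /=; rewrite /GRing.scale/= mulr1.
rewrite e => fa; apply: DeriveDef; first by apply/cvg_ex; exists a.
exact: cvg_lim.
Qed.

(** A chain rule that does not require [S] to be a function of [m]: it is enough that the increments
    of [S] be proportional to those of [m] up to a small relative error. *)
Lemma der_little (S m : R -> R) (b P m1 : R) : der m b m1 ->
  (forall e : R, 0 < e -> \forall c \near b,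
     `|S c - S b - P * (m c - m b)| <= e * `|m c - m b|) ->
  der S b (P * m1).
Proof.
move=> dm Se; apply: cvg_der; have cm := der_cvg dm.
apply/cvgrPdist_le => e e0.
have cP : (fun h : R => P * (h^-1 * (m (h + b) - m b))) @ 0^' --> P * m1.
  by apply: cvgM => //; exact: cvg_cst.
(* Near [b] the difference quotient of [m] stays below $|m_1| + 1$ in absolute value, so an error
   [e'] relative to [m] costs at most [e / 2]. *)
pose e' := e / 2 / (`|m1| + 1).
have m10 : 0 < `|m1| + 1 by rewrite ltr_wpDl.
have e'0 : 0 < e' by rewrite !divr_gt0.
have bound : \forall h \near (0 : R)^', `|h^-1 * (m (h + b) - m b)| <= `|m1| + 1.
  move/cvgrPdist_le : cm => /(_ 1 ltr01); apply: filterS => h hh.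
  rewrite -[X in `|X|](subrK m1) (le_trans (ler_normD _ _))// addrC lerD2l.
  by rewrite distrC.
have Sn : \forall h \near (0 : R)^', `|S (h + b) - S b - P * (m (h + b) - m b)| <= e' * `|m (h + b) - m b|.
  apply: nbhs_dnbhs.
  have /(_ _ e'0) := Se; rewrite -[X in nbhs X]add0r.
  by rewrite (near_shift 0 b) /= add0r subr0.
move/cvgrPdist_le : cP => /(_ (e / 2)); rewrite divr_gt0// => /(_ isT) cP.
near=> h.
rewrite -[X in X - _ * (S _ - _)](subrK (P * (h^-1 * (m (h + b) - m b)))).
rewrite -addrA (le_trans (ler_normD _ _))// (splitr e) lerD//.
  by near: h.
rewrite distrC (_ : _ - _ = h^-1 * (S (h + b) - S b - P * (m (h + b) - m b))); last by ring.
rewrite normrM (@le_trans _ _ (`|h^-1| * (e' * `|m (h + b) - m b|)))//.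
  by rewrite ler_wpM2l//; near: h.
rewrite mulrCA -normrM (@le_trans _ _ (e' * (`|m1| + 1)))//.
  by rewrite ler_wpM2l ?(ltW e'0)//; near: h.
by rewrite /e' divfK// gt_eqF.
Unshelve. all: by end_near. Qed.

End Limits.

Section CapDerivative.
Context {R : realType}.
Notation mR := (measurableTypeR R).

Lemma norm_bound (A P e s : R) : (P - e) * s <= A -> A <= (P + e) * s ->
  `|A - P * s| <= e * s.
Proof. by move=> h1 h2; rewrite ler_norml; apply/andP; split; lra. Qed.

Definition mden (K : R) (f : R -> R) a b : R :=
  Num.sqrt (gN K a (f a)) * Num.sqrt (gN K b (f b)) + gB K a (f a) b (f b).
Definition carea_d2 K (f df : R -> R) a b : R :=
  ((b - a) * df b - (f b - f a)) / (Num.sqrt (gN K b (f b)) * mden K f a b).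
Definition carea_d1 K (f df : R -> R) a b : R :=
  ((b - a) * df a - (f b - f a)) / (Num.sqrt (gN K a (f a)) * mden K f a b).

(* [gB] is the polarization of [gN]; its lower bound [nu] on the box keeps all
   chords and tangents of the graph of [f] over [`]l, r[] inside the chart. *)
Record setting (K l r lo hi nu : R) (f df : R -> R) : Prop := Setting {
  set_nu : 0 < nu;
  set_box : forall x x' y y' : R, x \in `]l, r[ -> x' \in `]l, r[ ->
    y \in `]lo, hi[ -> y' \in `]lo, hi[ -> nu <= gB K x y x' y';
  set_der : forall x, x \in `]l, r[ -> der f x (df x);
  set_incr : forall x y, x \in `]l, r[ -> y \in `]l, r[ -> x < y -> df x < df y;
  set_lines : forall a x xi, a \in `]l, r[ -> x \in `]l, r[ -> xi \in `]l, r[ ->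
    f a + df xi * (x - a) \in `]lo, hi[ }.

Section Deriv.
Variables (K l r lo hi nu : R) (f df : R -> R).
Hypothesis S : setting K l r lo hi nu f df.

Let nu0 := set_nu S.
Let box := @set_box _ _ _ _ _ _ _ _ S.
Let fd := @set_der _ _ _ _ _ _ _ _ S.
Let df_incr := @set_incr _ _ _ _ _ _ _ _ S.
Let lines := @set_lines _ _ _ _ _ _ _ _ S.

Lemma gN_gt0 a : a \in `]l, r[ -> 0 < gN K a (f a).
Proof.
move=> aI; have yI := f_lo lines aI.
by rewrite -gB_gN (lt_le_trans nu0)// box.
Qed.

Lemma mden_gt0 a b : a \in `]l, r[ -> b \in `]l, r[ -> 0 < mden K f a b.
Proof.
move=> aI bI; rewrite /mden ltr_wpDl ?mulr_ge0 ?sqrtr_ge0//.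
by rewrite (lt_le_trans nu0)// box// (f_lo lines).
Qed.

Lemma psi_cont a b m : a \in `]l, r[ -> b \in `]l, r[ ->
  f a + m * (b - a) \in `]lo, hi[ ->
  (psi K a (f a) z.1 z.2) @[z --> ((b, m) : R * R)] --> psi K a (f a) b m.
Proof.
move=> aI bI yI.
have N0 : 0 < gN K b (f a + m * (b - a)).
  by rewrite -gB_gN (lt_le_trans nu0)// box.
have B0 : 0 < gB K a (f a) b (f a + m * (b - a)).
  by rewrite (lt_le_trans nu0)// box// (f_lo lines).
have c1 : z.1 @[z --> ((b, m) : R * R)] --> b by exact: cvg_fst.
have c2 : z.2 @[z --> ((b, m) : R * R)] --> m by exact: cvg_snd.
have cu : z.1 - a @[z --> ((b, m) : R * R)] --> b - a by apply: cvgB => //; exact: cvg_cst.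
have cy : f a + z.2 * (z.1 - a) @[z --> ((b, m) : R * R)] --> f a + m * (b - a).
  by apply: cvgD; [exact: cvg_cst|exact: cvgM].
have cN : gN K z.1 (f a + z.2 * (z.1 - a)) @[z --> ((b, m) : R * R)] --> gN K b (f a + m * (b - a)).
  apply: cvgD; first exact: cvg_cst.
  apply: cvgM; first exact: cvg_cst.
  by under eq_fun do rewrite !expr2; rewrite !expr2; apply: cvgD; exact: cvgM.
have cB : gB K a (f a) z.1 (f a + z.2 * (z.1 - a)) @[z --> ((b, m) : R * R)] --> gB K a (f a) b (f a + m * (b - a)).
  apply: cvgD; first exact: cvg_cst.
  apply: cvgM; first exact: cvg_cst.
  by apply: cvgD; apply: cvgM => //; exact: cvg_cst.
rewrite /psi; apply: cvgM.
  by under eq_fun do rewrite !expr2; rewrite !expr2; exact: cvgM.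
apply: cvgV.
  by rewrite mulf_neq0 ?gt_eqF ?sqrtr_gt0// ltr_wpDl// mulr_ge0// sqrtr_ge0.
apply: cvgM; first exact: cvg_sqrt.
apply: cvgD => //; apply: cvgM; first exact: cvg_cst.
exact: cvg_sqrt.
Qed.

Lemma der_slope a b : a \in `]l, r[ -> b \in `]l, r[ -> a < b ->
  der (slope f a) b (((b - a) * df b - (f b - f a)) / (b - a) ^+ 2).
Proof.
move=> aI bI ab; have fb := fd bI.
have ba : b - a != 0 by rewrite subr_eq0 gt_eqF.
by rewrite /slope; der_auto => //; rewrite /=; field.
Qed.

(** By [carea_incr], the area grows like [psi] on the chord times the increment of the slope.
    Continuity of [psi] in the end point and the slope makes the relative error small, and
    [der_little] applies with the slope as [m]. *)
Lemma der_carea a b : a \in `]l, r[ -> b \in `]l, r[ -> a < b ->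
  der (carea K f a) b (carea_d2 K f df a b).
Proof.
move=> aI bI ab; have dS := der_slope aI bI ab.
have line_b : f a + slope f a b * (b - a) = f b by rewrite -f_line.
have ba : b - a != 0 by rewrite subr_eq0 gt_eqF.
apply: (@der_eq _ _ _ (psi K a (f a) b (slope f a b) * (((b - a) * df b - (f b - f a)) / (b - a) ^+ 2))); last first.
  rewrite /psi /= line_b /carea_d2 -/(mden K f a b); field.
  by rewrite ba !gt_eqF// ?sqrtr_gt0 ?mden_gt0// gN_gt0.
apply: (der_little dS) => e e0.
set P := psi K a (f a) b (slope f a b).
have bJ : f a + slope f a b * (b - a) \in `]lo, hi[ by rewrite line_b (f_lo lines).
have [b' b'I bb'] := in_itv_midr bI.
have P0 : 0 < P.
  have /andP[] // := psi_bounds nu0 box lines aI bI ab aI bI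
    (ltW (df_lt_slope fd df_incr aI bI ab)) (ltW (slope_lt_df fd df_incr aI bI ab)).
(* Capping by [P] keeps the lower bound [P - e'] nonnegative, as [carea_incr] demands. *)
pose e' := Num.min e P.
have e'0 : 0 < e' by rewrite lt_min e0.
have ee : e' <= e by rewrite ge_min lexx.
have eP : e' <= P by rewrite ge_min lexx orbT.
have /cvgrPdist_le /(_ _ e'0) := psi_cont aI bI bJ.
case=> -[U V] /= [/nbhs_ballP[d1 /= d10 hU] /nbhs_ballP[d2 /= d20 hV]] UV.
have close x k : `|b - x| < d1 -> `|slope f a b - k| < d2 -> `|P - psi K a (f a) x k| <= e'.
  by move=> xb km; apply: (UV (x, k)); split; [exact: hU|exact: hV].
have cslope := der_cont dS.
have near_slope : \forall c \near b, `|slope f a b - slope f a c| < d2.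
  by move/cvgrPdist_lt : cslope; exact.
have near_b : \forall c \near b, `|b - c| < d1.
  by exists d1.
have near_I : \forall c \near b, c \in `]l, r[ by exact: near_in_itvoo.
have near_a : \forall c \near b, a < c.
  have bi : b \in `]a, b'[ by rewrite in_itv/= ab.
  by apply: filterS (near_in_itvoo bi) => c; rewrite in_itv/= => /andP[].
near=> c.
have cI : c \in `]l, r[ by near: c.
have ac : a < c by near: c.
have cb : `|b - c| < d1 by near: c.
have cs : `|slope f a b - slope f a c| < d2 by near: c.
apply: (@le_trans _ _ (e' * `|slope f a c - slope f a b|)); last by rewrite ler_wpM2r.
have key x y : a < x -> x < y -> x \in `]l, r[ -> y \in `]l, r[ -> `|b - x| < d1 -> `|b - y| < d1 ->
    `|slope f a b - slope f a x| < d2 -> `|slope f a b - slope f a y| < d2 ->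
    `|carea K f a y - carea K f a x - P * (slope f a y - slope f a x)| <= e' * (slope f a y - slope f a x).
  move=> ax xy xI yI bx by_ sx sy.
  have c10 : 0 <= P - e' by rewrite subr_ge0.
  have bnd k : slope f a x <= k -> k <= slope f a y ->
      P - e' <= psi K a (f a) x k /\ psi K a (f a) y k <= P + e'.
    move=> k1 k2; have sk : `|slope f a b - k| < d2.
      move: k1 k2 sx sy; clear; rewrite !ltr_norml => ? ? /andP[? ?] /andP[? ?].
      by apply/andP; split; lra.
    move: (close x k bx sk) (close y k by_ sk); clear; rewrite !ler_norml.
    by move=> /andP[? ?] /andP[? ?]; split; lra.
  have /andP[h1 h2] := carea_incr nu0 box fd df_incr lines aI yI ax xy c10 bnd.
  exact: norm_bound h1 h2.
have [bc|cb'|->] := ltgtP b c.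
- rewrite [X in _ <= _ * X]ger0_norm; last by rewrite subr_ge0 ltW// (slope_lt fd df_incr aI cI ab bc).
  by apply: key => //; rewrite subrr normr0.
- rewrite -normrN [X in _ <= _ * X]distrC [X in _ <= _ * X]ger0_norm; last first.
    by rewrite subr_ge0 ltW// (slope_lt fd df_incr aI bI ac cb').
  rewrite [X in `|X| <= _](_ : _ = carea K f a b - carea K f a c - P * (slope f a b - slope f a c)); last by ring.
  by apply: key => //; rewrite subrr normr0.
- by rewrite !subrr mulr0 normr0 subr0 normr0 mulr0.
Unshelve. all: by end_near.
Qed.

Lemma carea_d2_gt0 a b : a \in `]l, r[ -> b \in `]l, r[ -> a < b ->
  0 < carea_d2 K f df a b.
Proof.
move=> aI bI ab; rewrite /carea_d2 divr_gt0//.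
  rewrite subr_gt0 -(slope_mul f ab) mulrC ltr_pM2l ?subr_gt0//.
  exact: (slope_lt_df fd df_incr).
by rewrite mulr_gt0 ?sqrtr_gt0 ?gN_gt0// mden_gt0.
Qed.

Lemma carea_d1_lt0 a b : a \in `]l, r[ -> b \in `]l, r[ -> a < b ->
  carea_d1 K f df a b < 0.
Proof.
move=> aI bI ab; rewrite /carea_d1 -oppr_gt0 -mulNr divr_gt0//.
  rewrite oppr_gt0 subr_lt0 -(slope_mul f ab) mulrC ltr_pM2r ?subr_gt0//.
  exact: (df_lt_slope fd df_incr).
by rewrite mulr_gt0 ?sqrtr_gt0 ?gN_gt0// mden_gt0.
Qed.

End Deriv.

Lemma mden_sym K f a b : mden K f a b = mden K f b a.
Proof. by rewrite /mden /gB mulrC; congr (_ + _); ring. Qed.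

(** The reflection of the abscissa exchanges the two ends of a cap, so the derivative in the left
    end will follow from the one in the right end. *)
Lemma setting_reflect K l r lo hi nu f df : setting K l r lo hi nu f df ->
  setting K (- r) (- l) lo hi nu (fun x => f (- x)) (fun x => - df (- x)).
Proof.
have IN x : x \in `]- r, - l[ -> - x \in `]l, r[.
  by rewrite !in_itv/= => /andP[? ?]; apply/andP; split; lra.
case=> nu0 box fd incr lines; split => //.
- move=> x x' y y' /IN xI /IN x'I yJ y'J.
  by have := box _ _ _ _ xI x'I yJ y'J; rewrite /gB mulrNN.
- move=> x /IN xI; have dN : der (fun y : R => - y) x (-1) by der_auto.
  by have := der_comp (fd _ xI) dN; rewrite mulrN1.
- by move=> x y /IN xI /IN yI xy; rewrite ltrN2 incr// ltrN2.
- move=> a x xi /IN aI /IN xI /IN xiI; have := lines _ _ _ aI xI xiI.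
  by rewrite (_ : - df (- xi) * (x - a) = df (- xi) * (- x - - a)); last by ring.
Qed.

Lemma cap_reflect K l r lo hi nu f df a b : setting K l r lo hi nu f df ->
  a \in `]l, r[ -> b \in `]l, r[ -> a < b ->
  carea K (fun x => f (- x)) (- b) (- a) = carea K f a b.
Proof.
move=> S aI bI ab; rewrite /carea; congr fine.
rewrite -(@garea_flip1 _ K (cap f a b)).
- congr garea; apply/funext => z; apply/propext; rewrite /flip1 /cap/=.
  have -> : f (- - b) + slope (fun x => f (- x)) (- b) (- a) * (z.1 - - b) =
      f a + slope f a b * (- z.1 - a).
    rewrite /slope !opprK; field.
    by rewrite subr_eq0 gt_eqF//= addrC subr_eq0 gt_eqF.
  by split; move=> [[? ?] ?]; split => //; split; lra.
- exact: (measurable_cap (@set_der _ _ _ _ _ _ _ _ S)).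
- exact: (cap_pos (set_nu S) (@set_box _ _ _ _ _ _ _ _ S) (@set_der _ _ _ _ _ _ _ _ S) (@set_lines _ _ _ _ _ _ _ _ S)).
Qed.

Lemma der_carea1 K l r lo hi nu f df a b : setting K l r lo hi nu f df ->
  a \in `]l, r[ -> b \in `]l, r[ -> a < b ->
  der (fun x => carea K f x b) a (carea_d1 K f df a b).
Proof.
move=> S aI bI ab; have S' := setting_reflect S.
have IN x : x \in `]l, r[ -> - x \in `]- r, - l[.
  by rewrite !in_itv/= => /andP[? ?]; apply/andP; split; lra.
have ba : - b < - a by rewrite ltrN2.
have d := der_carea S' (IN _ bI) (IN _ aI) ba.
have dN : der (fun x : R => - x) a (-1) by der_auto.
have d' := der_comp d dN.
have -> : carea_d1 K f df a b = carea_d2 K (fun x => f (- x)) (fun x => - df (- x)) (- b) (- a) * -1.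
  rewrite /carea_d1 /carea_d2 !opprK /gN sqrrN.
  have -> : mden K (fun x => f (- x)) (- b) (- a) = mden K f a b.
    by rewrite mden_sym /mden /gN /gB !opprK !sqrrN mulrNN.
  rewrite mulrN1 -mulNr; congr (_ / _); ring.
apply: cvg_der; apply: cvg_trans (der_cvg d').
apply: near_eq_cvg; apply: nbhs_dnbhs.
have near_b : \forall h \near (0 : R), h + a \in `]l, b[.
  have ai : a \in `]l, b[ by rewrite in_itv/= ab andbT; move: aI; rewrite in_itv/= => /andP[].
  have c : h + a @[h --> (0 : R)] --> a.
    by rewrite -[X in _ --> X]add0r; apply: cvgD; [exact: cvg_id|exact: cvg_cst].
  exact: (c _ (near_in_itvoo ai)).
apply: filterS near_b => h; rewrite in_itv/= => /andP[lh hb].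
have hI : h + a \in `]l, r[ by rewrite in_itv/= lh (lt_trans hb)//; move: bI; rewrite in_itv/= => /andP[].
by rewrite (cap_reflect S hI bI hb) (cap_reflect S aI bI ab).
Qed.

End CapDerivative.

(** * Level sets of the cap area *)

Section Level.
Context {R : realType}.
Variables (K l r lo hi nu : R) (f df T dT : R -> R).
Hypothesis S : setting K l r lo hi nu f df.
Hypothesis df_cont : forall x, x \in `]l, r[ -> {for x, continuous df}.
Hypothesis Td : forall x, x \in `]l, r[ -> der T x (dT x).
Hypothesis level : forall a1 b1 a2 b2, a1 \in `]l, r[ -> b1 \in `]l, r[ ->
  a2 \in `]l, r[ -> b2 \in `]l, r[ -> a1 < b1 -> a2 < b2 ->
  carea K f a1 b1 = carea K f a2 b2 -> T b1 - T a1 = T b2 - T a2.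

Let between a b x : a \in `]l, r[ -> b \in `]l, r[ -> a <= x -> x <= b -> x \in `]l, r[.
Proof. exact: itv_between. Qed.

Let seg_sub a b : a \in `]l, r[ -> b \in `]l, r[ -> forall x, x \in `[a, b] -> x \in `]l, r[.
Proof. by move=> aI bI x; rewrite in_itv/= => /andP[]; exact: between. Qed.

Lemma carea_MVT2 a c d : a \in `]l, r[ -> d \in `]l, r[ -> a < c -> c < d ->
  exists2 xi, c < xi < d & carea K f a d - carea K f a c = carea_d2 K f df a xi * (d - c).
Proof.
move=> aI dI ac cd; have cI := between aI dI (ltW ac) (ltW cd).
have D x : x \in `[c, d] -> der (carea K f a) x (carea_d2 K f df a x).
  move=> xcd; apply: (der_carea S) => //; first exact: (seg_sub cI dI).
  by move: xcd; rewrite in_itv/= => /andP[? _]; exact: lt_le_trans ac _.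
have [||xi xicd e] := @MVT _ (carea K f a) (carea_d2 K f df a) c d cd.
- by move=> x xcd; exact/D/subset_itv_oo_cc.
- by apply: derivable_within_continuous => x /D [].
by exists xi => //; move: xicd; rewrite in_itv.
Qed.

Lemma carea_MVT1 a c d : a \in `]l, r[ -> d \in `]l, r[ -> a < c -> c < d ->
  exists2 xi, a < xi < c & carea K f c d - carea K f a d = carea_d1 K f df xi d * (c - a).
Proof.
move=> aI dI ac cd; have cI := between aI dI (ltW ac) (ltW cd).
have D x : x \in `[a, c] -> der (fun x => carea K f x d) x (carea_d1 K f df x d).
  move=> xac; apply: (der_carea1 S) => //; first exact: (seg_sub aI cI).
  by move: xac; rewrite in_itv/= => /andP[_ ?]; exact: le_lt_trans cd.
have [||xi xiac e] := @MVT _ (fun x => carea K f x d) (fun x => carea_d1 K f df x d) a c ac.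
- by move=> x xac; exact/D/subset_itv_oo_cc.
- by apply: derivable_within_continuous => x /D [].
by exists xi => //; move: xiac; rewrite in_itv.
Qed.

(** Moving the left end to the right shrinks the cap, moving the right end to the right enlarges it.
    After a small move of [a], the intermediate value theorem yields the [b'] that restores the
    area. *)
Lemma level_step a b e : a \in `]l, r[ -> b \in `]l, r[ -> a < b -> 0 < e ->
  exists a' b', [/\ a < a' < a + e, b < b' < b + e, a' < b, b' \in `]l, r[ & carea K f a' b' = carea K f a b].
Proof.
move=> aI bI ab e0.
have [b1 b1I bb1] := in_itv_midr bI.
pose b2 := Num.min b1 (b + e / 2).
have bb2 : b < b2 by rewrite lt_min bb1/= ltrDl divr_gt0.
have b2e : b2 < b + e by rewrite gt_min ltrD2l [X in _ || X](_ : _ = true) ?orbT//; lra.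
have b2I : b2 \in `]l, r[ by apply: (between bI b1I (ltW bb2)); rewrite ge_min lexx.
have ab2 := lt_trans ab bb2.
have up : carea K f a b < carea K f a b2.
  have [xi /andP[bxi xib2] h] := carea_MVT2 aI b2I ab bb2.
  rewrite -subr_gt0 h mulr_gt0 ?subr_gt0//; apply: (carea_d2_gt0 S) => //.
    exact: (between bI b2I (ltW bxi) (ltW xib2)).
  exact: lt_trans bxi.
have cont := der_cont (der_carea1 S aI b2I ab2).
have near1 : \forall a' \near a, carea K f a b < carea K f a' b2.
  by move: cont => /cvgr_gt; apply.
have near2 : \forall a' \near a, a' \in `]l, Num.min b (a + e)[.
  apply: near_in_itvoo; rewrite in_itv/= lt_min ab ltrDl e0/= andbT.
  by move: aI; rewrite in_itv/= => /andP[].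
have [d /= d0 hd] : \forall a' \near a, carea K f a b < carea K f a' b2 /\ a' \in `]l, Num.min b (a + e)[.
  by apply: filterS2 near1 near2 => x ? ?; split.
pose a' := a + d / 2.
have aa' : a < a' by rewrite ltrDl divr_gt0.
have [h1] : carea K f a b < carea K f a' b2 /\ a' \in `]l, Num.min b (a + e)[.
  by apply: hd; rewrite /= opprD addNKr normrN gtr0_norm ?divr_gt0//; lra.
rewrite in_itv/= lt_min => /and3P[la' a'b a'e].
have a'I : a' \in `]l, r[ by exact: (between aI bI (ltW aa') (ltW a'b)).
have down : carea K f a' b < carea K f a b.
  have [xi /andP[axi xia'] h] := carea_MVT1 aI bI aa' a'b.
  have xiI := between aI a'I (ltW axi) (ltW xia').
  rewrite -subr_lt0 h; rewrite nmulr_rlt0 ?subr_gt0//; apply: (carea_d1_lt0 S) => //.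
  exact: lt_trans a'b.
have cseg : {within `[b, b2], continuous (carea K f a')}.
  apply: derivable_within_continuous => x xb.
  have xI := seg_sub bI b2I xb.
  have a'x : a' < x by move: xb; rewrite in_itv/= => /andP[? _]; exact: lt_le_trans a'b _.
  by case: (der_carea S a'I xI a'x).
have [|b' b'in e'] := @IVT _ (carea K f a') b b2 (carea K f a b) (ltW bb2) cseg.
  have h2 := ltW (lt_trans down h1).
  by rewrite (min_idPl h2) (max_idPr h2) !ltW.
exists a', b'; move: (b'in); rewrite in_itv/= => /andP[bb' b'b2].
split => //; first by rewrite aa'.
  rewrite (le_lt_trans b'b2 b2e) andbT lt_neqAle bb' andbT.
  by apply/eqP => bb; move: e' down; rewrite -bb => ->; rewrite ltxx.
exact: (seg_sub bI b2I).
Qed.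

Lemma cvg_gN (u v : nat -> R) (x y : R) : u @ \oo --> x -> v @ \oo --> y ->
  gN K (u n) (v n) @[n --> \oo] --> gN K x y.
Proof.
move=> ux vy; apply: cvgD; first exact: cvg_cst.
apply: cvgM; first exact: cvg_cst.
by under eq_fun do rewrite !expr2; rewrite !expr2; apply: cvgD; exact: cvgM.
Qed.

Lemma cvg_mden (u v : nat -> R) (x y : R) : x \in `]l, r[ -> y \in `]l, r[ ->
  u @ \oo --> x -> v @ \oo --> y ->
  mden K f (u n) (v n) @[n --> \oo] --> mden K f x y.
Proof.
move=> xI yI ux vy.
have fu : f (u n) @[n --> \oo] --> f x.
  by apply: continuous_cvg => //; exact: (der_cont (@set_der _ _ _ _ _ _ _ _ _ S x xI)).
have fv : f (v n) @[n --> \oo] --> f y.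
  by apply: continuous_cvg => //; exact: (der_cont (@set_der _ _ _ _ _ _ _ _ _ S y yI)).
apply: cvgD.
  by apply: cvgM; apply: cvg_sqrt; exact: cvg_gN.
apply: cvgD; first exact: cvg_cst.
by apply: cvgM; [exact: cvg_cst|apply: cvgD; exact: cvgM].
Qed.

Lemma cvg_carea_d (u v : nat -> R) (x y : R) : x \in `]l, r[ -> y \in `]l, r[ ->
  u @ \oo --> x -> v @ \oo --> y ->
  (carea_d1 K f df (u n) (v n) @[n --> \oo] --> carea_d1 K f df x y) /\
  (carea_d2 K f df (u n) (v n) @[n --> \oo] --> carea_d2 K f df x y).
Proof.
move=> xI yI ux vy.
have fu : f (u n) @[n --> \oo] --> f x.
  by apply: continuous_cvg => //; exact: (der_cont (@set_der _ _ _ _ _ _ _ _ _ S x xI)).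
have fv : f (v n) @[n --> \oo] --> f y.
  by apply: continuous_cvg => //; exact: (der_cont (@set_der _ _ _ _ _ _ _ _ _ S y yI)).
have du : df (u n) @[n --> \oo] --> df x by apply: continuous_cvg => //; exact: df_cont.
have dv : df (v n) @[n --> \oo] --> df y by apply: continuous_cvg => //; exact: df_cont.
have m0 := mden_gt0 S xI yI.
have cm := cvg_mden xI yI ux vy.
split; apply: cvgM.
- by apply: cvgB; [apply: cvgM => //|]; exact: cvgB.
- apply: cvgV; first by rewrite gt_eqF// mulr_gt0// sqrtr_gt0 (gN_gt0 S).
  by apply: cvgM => //; apply: cvg_sqrt; exact: cvg_gN.
- by apply: cvgB; [apply: cvgM => //|]; exact: cvgB.
- apply: cvgV; first by rewrite gt_eqF// mulr_gt0// sqrtr_gt0 (gN_gt0 S).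
  by apply: cvgM => //; apply: cvg_sqrt; exact: cvg_gN.
Qed.

Lemma quot_cvg (h : R -> R) (dh x : R) (u : nat -> R) : der h x dh ->
  (forall n, u n != x) -> u @ \oo --> x ->
  (h (u n) - h x) / (u n - x) @[n --> \oo] --> dh.
Proof.
move=> /der_cvg dhx ux cu.
have /cvgr_dnbhsP/(_ (fun n => u n - x)) := dhx.
have c0 : u n - x @[n --> \oo] --> 0 by apply/subr_cvg0.
have n0 n : u n - x != 0 by rewrite subr_eq0.
move=> /(_ (conj n0 c0)); rewrite /comp.
by under eq_fun do rewrite subrK mulrC.
Qed.

(** Caps of the same area, given by [level_step], tend to the cap over [a] and [b]. The changes of
    area due to the two ends compensate, and the increments of [T] at the two ends agree.
    Eliminating the increments of the ends leaves a relation between difference quotients and mean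
    values, whose limit is the claim. *)
Lemma level_eq a b : a \in `]l, r[ -> b \in `]l, r[ -> a < b ->
  dT b * carea_d1 K f df a b + dT a * carea_d2 K f df a b = 0.
Proof.
move=> aI bI ab.
pose e (n : nat) : R := n.+1%:R^-1.
have e0 n : 0 < e n by rewrite invr_gt0.
have /choice[u Hu] : forall n, exists ab' : R * R,
    [/\ a < ab'.1 < a + e n, b < ab'.2 < b + e n, ab'.1 < b, ab'.2 \in `]l, r[
      & carea K f ab'.1 ab'.2 = carea K f a b].
  by move=> n; have [a' [b' h]] := level_step aI bI ab (e0 n); exists (a', b').
pose ua n := (u n).1; pose ub n := (u n).2.
have ce : e @ \oo --> (0 : R) by exact: cvg_harmonic.
have sq x (v : nat -> R) : (forall n, x < v n < x + e n) -> v @ \oo --> x.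
  move=> xv; apply: (@squeeze_cvgr _ _ _ _ (fun=> x) (fun n => x + e n)).
  - by apply: nearW => n; have /andP[? ?] := xv n; rewrite !ltW.
  - exact: cvg_cst.
  - by rewrite -[X in _ --> X]addr0; apply: cvgD => //; exact: cvg_cst.
have cua : ua @ \oo --> a by apply: sq => n; case: (Hu n).
have cub : ub @ \oo --> b by apply: sq => n; case: (Hu n).
have aua n : a < ua n by have [/andP[]] := Hu n.
have bub n : b < ub n by have [_ /andP[]] := Hu n.
have uab n : ua n < b by have [] := Hu n.
have ubI n : ub n \in `]l, r[ by have [] := Hu n.
have uaI n : ua n \in `]l, r[ by apply: (between aI bI); exact: ltW.
have /choice[xi Hxi] : forall n, exists x, b < x < ub n /\
    carea K f a (ub n) - carea K f a b = carea_d2 K f df a x * (ub n - b).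
  by move=> n; have [x ? ?] := carea_MVT2 aI (ubI n) ab (bub n); exists x.
have /choice[zeta Hz] : forall n, exists x, a < x < ua n /\
    carea K f (ua n) (ub n) - carea K f a (ub n) = carea_d1 K f df x (ub n) * (ua n - a).
  move=> n; have [x ? ?] := carea_MVT1 aI (ubI n) (aua n) (lt_trans (uab n) (bub n)).
  by exists x.
have cxi : xi @ \oo --> b.
  apply: sq => n; have [/andP[? h] _] := Hxi n; apply/andP; split => //.
  by apply: (lt_trans h); have [_ /andP[]] := Hu n.
have czeta : zeta @ \oo --> a.
  apply: sq => n; have [/andP[? h] _] := Hz n; apply/andP; split => //.
  by apply: (lt_trans h); have [/andP[]] := Hu n.
pose qb n := (T (ub n) - T b) / (ub n - b).
pose qa n := (T (ua n) - T a) / (ua n - a).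
have key n : qb n * carea_d1 K f df (zeta n) (ub n) + qa n * carea_d2 K f df a (xi n) = 0.
  have ua0 : ua n - a != 0 by rewrite subr_eq0 gt_eqF.
  have ub0 : ub n - b != 0 by rewrite subr_eq0 gt_eqF.
  have [_ h1] := Hxi n; have [_ h2] := Hz n.
  have hS : carea K f (ua n) (ub n) = carea K f a b by have [] := Hu n.
  have hT := level aI bI (uaI n) (ubI n) ab (lt_trans (uab n) (bub n)) (esym hS).
  have e1 : carea_d2 K f df a (xi n) = (carea K f a (ub n) - carea K f a b) / (ub n - b).
    by rewrite h1 mulfK.
  have e2 : carea_d1 K f df (zeta n) (ub n) = (carea K f a b - carea K f a (ub n)) / (ua n - a).
    by rewrite -hS h2 mulfK.
  have e3 : T (ua n) - T a = T (ub n) - T b by move: hT; lra.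
  rewrite e1 e2 /qa /qb e3; field.
  by rewrite ua0 ub0.
have L : qb n * carea_d1 K f df (zeta n) (ub n) + qa n * carea_d2 K f df a (xi n) @[n --> \oo]
    --> dT b * carea_d1 K f df a b + dT a * carea_d2 K f df a b.
  have cqb : qb @ \oo --> dT b.
    by apply: (quot_cvg (Td bI)) => // n; rewrite gt_eqF.
  have cqa : qa @ \oo --> dT a.
    by apply: (quot_cvg (Td aI)) => // n; rewrite gt_eqF.
  apply: cvgD; apply: cvgM => //.
    by have [] := cvg_carea_d aI bI czeta cub.
  by have [] := @cvg_carea_d (fun=> a) xi a b aI bI (cvg_cst _) cxi.
have Z : (fun n => qb n * carea_d1 K f df (zeta n) (ub n) + qa n * carea_d2 K f df a (xi n)) = fun=> 0.
  by apply/funext => n; exact: key.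
rewrite Z in L.
by have := cvg_unique _ L (cvg_cst _); apply.
Qed.

End Level.

(** * The pencil of conics tangent to the graph at two points *)

Section Conic.
Context {R : realType}.

Definition lform (u x : 'rV[R]_3) : R := (x *m u^T) 0 0.

Lemma lformE u x : lform u x = u 0 0 * x 0 0 + u 0 1 * x 0 1 + u 0 ord_max * x 0 ord_max.
Proof. by rewrite /lform mxE sum3 !mxE; ring. Qed.

Lemma bilin_outer (u v x : 'rV[R]_3) : bilin (u^T *m v) x x = lform u x * lform v x.
Proof.
rewrite /bilin mulmxA -mulmxA mxE big_ord1; congr (_ * _).
by rewrite /lform !mxE !sum3 !mxE; ring.
Qed.

Definition conic_mx (u v w : 'rV[R]_3) (c : R) : 'M[R]_3 :=
  u^T *m v + v^T *m u - c *: (w^T *m w).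

Lemma conic_mx_sym u v w c : (conic_mx u v w c)^T = conic_mx u v w c.
Proof.
rewrite /conic_mx linearB /= linearD /= linearZ /= !trmx_mul !trmxK.
by rewrite [X in X - _]addrC.
Qed.

Lemma bilin_conic u v w c x :
  bilin (conic_mx u v w c) x x = 2 * lform u x * lform v x - c * lform w x ^+ 2.
Proof.
have e (A B : 'M[R]_3) : bilin (A + B) x x = bilin A x x + bilin B x x.
  by rewrite /bilin mulmxDr mulmxDl mxE.
have eZ k (A : 'M[R]_3) : bilin (k *: A) x x = k * bilin A x x.
  by rewrite /bilin -scalemxAr -scalemxAl mxE.
by rewrite /conic_mx !e -scaleNr eZ !bilin_outer; ring.
Qed.

(* The pencil of conics tangent to the curve at the points over [a] and [b] is
   [la * lb = c * lab ^ 2]; the relations for the three pairs of points say that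
   the member of the pencil through the point over [x] is tangent to the curve
   there, so that [c] is a first integral. *)
Lemma pencil_conic (l r : R) (f df w : R -> R) a b :
  a \in `]l, r[ -> b \in `]l, r[ -> a < b ->
  (forall x, x \in `]l, r[ -> der f x (df x)) ->
  (forall x y, x \in `]l, r[ -> y \in `]l, r[ -> x < y -> df x < df y) ->
  (forall x, x \in `]l, r[ -> w x != 0) ->
  (forall x y, x \in `]l, r[ -> y \in `]l, r[ -> x < y ->
    w x * ((y - x) * df x - (f y - f x)) + w y * ((y - x) * df y - (f y - f x)) = 0) ->
  exists C : 'M[R]_3, [/\ C != 0, C^T = C &
    forall x, x \in `]a, b[ -> bilin C (row3 1 x (f x)) (row3 1 x (f x)) = 0].
Proof.
move=> aI bI ab fd dfi w0 rel.
pose s := slope f a b.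
pose la x := f x - f a - df a * (x - a).
pose lb x := f x - f b - df b * (x - b).
pose lab x := f a + s * (x - a) - f x.
have sub x : x \in `]a, b[ -> x \in `]l, r[.
  by rewrite in_itv/= => /andP[? ?]; apply: (itv_between aI bI); exact: ltW.
have lab0 x : x \in `]a, b[ -> 0 < lab x.
  move=> xab; have xI := sub x xab; move: xab; rewrite in_itv/= => /andP[ax xb].
  rewrite /lab subr_gt0 (f_line f ax) line_cmp//.
  exact: (slope_lt fd dfi).
pose phi x := la x * lb x / lab x ^+ 2.
have dphi x : x \in `]a, b[ -> der phi x 0.
  move=> xab; have xI := sub x xab; have l0 := lab0 x xab.
  have fx := fd x xI.
  have d1 : der la x (df x - df a) by rewrite /la; der_auto => /=; ring.
  have d2 : der lb x (df x - df b) by rewrite /lb; der_auto => /=; ring.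
  have d3 : der lab x (s - df x) by rewrite /lab; der_auto => /=; ring.
  rewrite /phi; der_auto; first by rewrite expf_neq0// gt_eqF.
  rewrite /=.
  move: xab; rewrite in_itv/= => /andP[ax xb].
  have r1 := rel a b aI bI ab; have r2 := rel a x aI xI ax; have r3 := rel x b xI bI xb.
  have wa := w0 a aI; have wb := w0 b bI; have wx := w0 x xI.
  set P1 := (b - a) * df a - (f b - f a) in r1.
  set P2 := (b - a) * df b - (f b - f a) in r1.
  set Q1 := (x - a) * df a - (f x - f a) in r2.
  set Q2 := (x - a) * df x - (f x - f a) in r2.
  set R1 := (b - x) * df x - (f b - f x) in r3.
  set R2 := (b - x) * df b - (f b - f x) in r3.
  (* Each relation determines a ratio of two weights, and the product of the three ratios is free of
     weights. *)
  have Y : Q1 * R1 * P2 + Q2 * R2 * P1 = 0.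
    apply: (@mulfI _ (w a * w b * w x)); first by rewrite !mulf_neq0.
    rewrite mulr0.
    have e1 : w a * P1 = - (w b * P2) by move: r1; lra.
    have e2 : w a * Q1 = - (w x * Q2) by move: r2; lra.
    have e3 : w x * R1 = - (w b * R2) by move: r3; lra.
    transitivity ((w a * Q1) * (w x * R1) * (w b * P2) + (w x * Q2) * (w b * R2) * (w a * P1)); first by ring.
    by rewrite e1 e2 e3; ring.
  (* This is the numerator of the derivative of [phi]; multiplied by [b - a], it is the opposite of
     the left side of [Y]. *)
  have X : (df x - df a) * lb x * lab x + la x * (df x - df b) * lab x - 2 * la x * lb x * (s - df x) = 0.
    apply: (@mulIf _ (b - a)); first by rewrite subr_eq0 gt_eqF.
    rewrite mul0r -[RHS]oppr0 -[X in _ = - X]Y /la /lb /lab /s /slope /P1 /P2 /Q1 /Q2 /R1 /R2.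
    by field; rewrite subr_eq0 gt_eqF.
  have l0' : lab x != 0 by rewrite gt_eqF.
  transitivity (((df x - df a) * lb x * lab x + la x * (df x - df b) * lab x - 2 * la x * lb x * (s - df x)) / lab x ^+ 3).
    by field.
  by rewrite X mul0r.
pose mid := (a + b) / 2.
have midab : mid \in `]a, b[ by rewrite in_itv/= midf_lt// midf_lt.
have phic x : x \in `]a, b[ -> phi x = phi mid.
  move=> xab.
  have MV y z : y \in `]a, b[ -> z \in `]a, b[ -> y < z -> phi z = phi y.
    move=> yab zab yz.
    have sub' t : t \in `[y, z] -> t \in `]a, b[.
      move: yab zab; rewrite !in_itv/= => /andP[? ?] /andP[? ?] /andP[? ?].
      by apply/andP; split; lra.
    have [||t _ e] := @MVT _ phi (fun=> 0) y z yz.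
    - by move=> t tyz; exact/dphi/sub'/subset_itv_oo_cc.
    - by apply: derivable_within_continuous => t /sub' /dphi [].
    by apply/eqP; rewrite -subr_eq0 e mul0r.
  have [xm|xm|->//] := ltgtP x mid; first by rewrite (MV x mid).
  by rewrite (MV mid x).
pose u : 'rV[R]_3 := row3 (df a * a - f a) (- df a) 1.
pose v : 'rV[R]_3 := row3 (df b * b - f b) (- df b) 1.
pose t : 'rV[R]_3 := row3 (f a - s * a) s (- 1).
have uE x y : lform u (row3 1 x y) = y - f a - df a * (x - a).
  by rewrite lformE !row3E; ring.
have vE x y : lform v (row3 1 x y) = y - f b - df b * (x - b).
  by rewrite lformE !row3E; ring.
have tE x y : lform t (row3 1 x y) = f a + s * (x - a) - y.
  by rewrite lformE !row3E; ring.
exists (conic_mx u v t (2 * phi mid)); split.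
(* At the midpoint of the chord the form of the chord vanishes, whereas both tangent forms are
   positive there by strict convexity. So the quadratic form is not zero. *)
- apply/eqP => C0.
  have := bilin_conic u v t (2 * phi mid) (row3 1 mid (f a + s * (mid - a))).
  rewrite C0 uE vE tE subrr expr0n/= mulr0 subr0 /bilin mulmx0 mul0mx mxE => /esym/eqP.
  have da := df_lt_slope fd dfi aI bI ab; have db := slope_lt_df fd dfi aI bI ab.
  have e1 : f a + s * (mid - a) - f a - df a * (mid - a) = (s - df a) * ((b - a) / 2).
    by rewrite /mid; field.
  have sb : s * (b - a) = f b - f a by rewrite /s slope_mul.
  have e2 : f a + s * (mid - a) - f b - df b * (mid - b) = (df b - s) * ((b - a) / 2).
    rewrite (_ : f b = f a + s * (b - a)); last by rewrite sb; ring.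
    by rewrite /mid; field.
  rewrite e1 e2; apply/negP.
  have h : 0 < (b - a) / 2 by rewrite divr_gt0// subr_gt0.
  by rewrite !mulf_neq0// ?gt_eqF// subr_gt0.
- exact: conic_mx_sym.
- move=> x xab; rewrite bilin_conic uE vE tE -/(la x) -/(lb x) -/(lab x) -(phic x xab).
  rewrite /phi; field.
  by rewrite gt_eqF// lab0.
Qed.

Lemma level_conic (K l r lo hi nu : R) (f df T dT : R -> R) a b :
  setting K l r lo hi nu f df ->
  (forall x, x \in `]l, r[ -> {for x, continuous df}) ->
  (forall x, x \in `]l, r[ -> der T x (dT x)) ->
  (forall x, x \in `]l, r[ -> dT x != 0) ->
  (forall a1 b1 a2 b2, a1 \in `]l, r[ -> b1 \in `]l, r[ ->
    a2 \in `]l, r[ -> b2 \in `]l, r[ -> a1 < b1 -> a2 < b2 ->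
    carea K f a1 b1 = carea K f a2 b2 -> T b1 - T a1 = T b2 - T a2) ->
  a \in `]l, r[ -> b \in `]l, r[ -> a < b ->
  exists C : 'M[R]_3, [/\ C != 0, C^T = C &
    forall x, x \in `]a, b[ -> bilin C (row3 1 x (f x)) (row3 1 x (f x)) = 0].
Proof.
move=> S cdf Td dT0 lev aI bI ab.
pose w x := (dT x * Num.sqrt (gN K x (f x)))^-1.
have sN x : x \in `]l, r[ -> Num.sqrt (gN K x (f x)) != 0.
  by move=> xI; rewrite gt_eqF// sqrtr_gt0 (gN_gt0 S).
apply: (@pencil_conic l r f df w a b aI bI ab (@set_der _ _ _ _ _ _ _ _ _ S)
  (@set_incr _ _ _ _ _ _ _ _ _ S)).
  by move=> x xI; rewrite invr_neq0// mulf_neq0// ?dT0 ?sN.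
move=> x y xI yI xy; have := level_eq S cdf Td lev xI yI xy.
have m0 : mden K f x y != 0 by rewrite gt_eqF// (mden_gt0 S).
move=> h; apply: (@mulfI _ (dT x * dT y / mden K f x y)).
  by rewrite !mulf_neq0 ?dT0 ?invr_neq0.
rewrite mulr0 -[RHS]h /w /carea_d1 /carea_d2; field.
by rewrite m0 !dT0 ?sN.
Qed.

End Conic.

(** * Regions cut off by chords *)

Section Topo.
Context {R : realType}.
Implicit Types (K x y : R) (G : geometry) (p q : 'rV[R]_3) (P : 'M[R]_3).

Lemma cvg_rV3 (T : Type) (F : set_system T) {FF : Filter F} (u : T -> 'rV[R]_3) (l : 'rV[R]_3) :
  (forall j, u t 0 j @[t --> F] --> l 0 j) -> u @ F --> l.
Proof.
move=> ul; apply/cvgrPdist_le => e e0.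
have H j : \forall t \near F, `|l 0 j - u t 0 j| <= e.
  by move/cvgrPdist_le : (ul j); exact.
near=> t.
have h0 : `|l 0 0 - u t 0 0| <= e by near: t; exact: H.
have h1 : `|l 0 1 - u t 0 1| <= e by near: t; exact: H.
have h2 : `|l 0 ord_max - u t 0 ord_max| <= e by near: t; exact: H.
rewrite /Num.Def.normr/= mx_normrE (bigmax_le _ (ltW e0))//= => -[i j] _.
by rewrite (ord1 i) !mxE; elim/ord3_ind: j.
Unshelve. all: by end_near.
Qed.

Lemma crd_cont P k q : {for q, continuous (crd P k)}.
Proof.
have h i : p 0 i * P i k @[p --> q] --> q 0 i * P i k.
  by apply: cvgM; [exact: coord_continuous|exact: cvg_cst].
rewrite (_ : crd P k = fun p => p 0 0 * P 0 k + p 0 1 * P 1 k + p 0 ord_max * P ord_max k).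
  exact: (cvgD (cvgD (h 0) (h 1)) (h ord_max)).
by apply/funext => p; rewrite crdE.
Qed.

Lemma cvg_crd P k (T : Type) (F : set_system T) {FF : Filter F} (u : T -> 'rV[R]_3) (l : 'rV[R]_3) :
  u @ F --> l -> crd P k (u t) @[t --> F] --> crd P k l.
Proof. by move=> ul; apply: continuous_cvg => //; exact: crd_cont. Qed.

(* The point of the surface over the point [(x, y)] of the gnomonic chart. *)
Definition lift K P x y : 'rV[R]_3 :=
  (Num.sqrt (gN K x y))^-1 *: (row3 1 x y *m P^T).

Lemma crd_row3 P (a b c : R) : P *m P^T = 1%:M ->
  (crd P 0 (row3 a b c *m P^T) = a) * (crd P 1 (row3 a b c *m P^T) = b) *
  (crd P ord_max (row3 a b c *m P^T) = c).
Proof.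
move=> /mulmx1C PP.
by do !split; rewrite /crd -mulmxA PP mulmx1 row3E.
Qed.

Lemma crdZ P k (a : R) p : crd P k (a *: p) = a * crd P k p.
Proof. by rewrite /crd -scalemxAl mxE. Qed.

Lemma crdD P k p q : crd P k (p + q) = crd P k p + crd P k q.
Proof. by rewrite /crd mulmxDl mxE. Qed.

Lemma crdB P k p q : crd P k (p - q) = crd P k p - crd P k q.
Proof. by rewrite /crd mulmxBl !mxE. Qed.

Lemma crd_inj P p q : P *m P^T = 1%:M ->
  crd P 0 p = crd P 0 q -> crd P 1 p = crd P 1 q -> crd P ord_max p = crd P ord_max q -> p = q.
Proof.
move=> PP h0 h1 h2; rewrite -[p]mulmx1 -[q]mulmx1 -PP !mulmxA; congr (_ *m _).
by apply/rowP; elim/ord3_ind; [exact: h0|exact: h1|exact: h2].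
Qed.

Section Frame.
Variables (G : geometry) (P : 'M[R]_3).
Hypothesis FP : frame G P.
Local Notation K := (curvature R G).
Local Notation c0 := (crd P 0).
Local Notation c1 := (crd P 1).
Local Notation c2 := (crd P ord_max).
Local Notation psi := (lift K P).

Lemma crd_lift x y : (c0 (psi x y) = (Num.sqrt (gN K x y))^-1) *
  (c1 (psi x y) = (Num.sqrt (gN K x y))^-1 * x) *
  (c2 (psi x y) = (Num.sqrt (gN K x y))^-1 * y).
Proof.
by rewrite /lift !crdZ !(crd_row3 _ _ _ (frame_orth FP)) mulr1.
Qed.

Lemma lift_c0 x y : 0 < gN K x y -> 0 < c0 (psi x y).
Proof. by move=> N0; rewrite crd_lift invr_gt0 sqrtr_gt0. Qed.

Lemma lift_ratio x y : 0 < gN K x y ->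
  (c1 (psi x y) / c0 (psi x y) = x) * (c2 (psi x y) / c0 (psi x y) = y).
Proof.
move=> N0; have s0 : Num.sqrt (gN K x y) != 0 by rewrite gt_eqF ?sqrtr_gt0.
by rewrite !crd_lift; split; field.
Qed.

Lemma lift_surface x y : 0 < gN K x y -> surface G (psi x y).
Proof.
move=> N0; apply/(frame_surface FP); first exact: lift_c0.
have s0 : Num.sqrt (gN K x y) != 0 by rewrite gt_eqF ?sqrtr_gt0.
rewrite !crd_lift; apply: (@mulIf _ (Num.sqrt (gN K x y) ^+ 2)); first by rewrite expf_neq0.
have := sqr_sqrtr (ltW N0); set s := Num.sqrt _ in s0 * => e; rewrite mul1r [RHS]e.
by rewrite /gN; field.
Qed.

Lemma surface_gN p : surface G p -> 0 < c0 p ->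
  gN K (c1 p / c0 p) (c2 p / c0 p) = (c0 p ^+ 2)^-1.
Proof.
move=> Sp p0; have := (frame_surface FP p0).1 Sp => h.
rewrite -[RHS]mul1r -h /gN; field.
by rewrite gt_eqF.
Qed.

Lemma surface_lift p : surface G p -> 0 < c0 p ->
  psi (c1 p / c0 p) (c2 p / c0 p) = p.
Proof.
move=> Sp p0; have p0' : c0 p != 0 by rewrite gt_eqF.
have s : Num.sqrt (gN K (c1 p / c0 p) (c2 p / c0 p)) = (c0 p)^-1.
  by rewrite surface_gN// -exprVn sqrtr_sqr ger0_norm// invr_ge0 ltW.
apply: (crd_inj (frame_orth FP)); rewrite crd_lift s invrK//; by field.
Qed.

Lemma surface_gN_gt0 p : surface G p -> 0 < c0 p ->
  0 < gN K (c1 p / c0 p) (c2 p / c0 p).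
Proof. by move=> Sp p0; rewrite surface_gN// invr_gt0 exprn_gt0. Qed.

Lemma cvg_lift (T : Type) (F : set_system T) {FF : Filter F} (u v : T -> R) x y :
  0 < gN K x y -> u @ F --> x -> v @ F --> y ->
  psi (u t) (v t) @[t --> F] --> psi x y.
Proof.
move=> N0 ux vy.
have cN : gN K (u t) (v t) @[t --> F] --> gN K x y.
  apply: cvgD; first exact: cvg_cst.
  apply: cvgM; first exact: cvg_cst.
  by under eq_fun do rewrite !expr2; rewrite !expr2; apply: cvgD; exact: cvgM.
have cs : (Num.sqrt (gN K (u t) (v t)))^-1 @[t --> F] --> (Num.sqrt (gN K x y))^-1.
  by apply: cvgV; [rewrite gt_eqF ?sqrtr_gt0|exact: cvg_sqrt].
have e j a b : psi a b 0 j = (Num.sqrt (gN K a b))^-1 * (P j 0 + a * P j 1 + b * P j ord_max).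
  by rewrite /lift !mxE sum3 !row3E !mxE mul1r.
apply: cvg_rV3 => j; rewrite e; under eq_fun do rewrite e.
apply: cvgM => //; apply: cvgD; last by apply: cvgM => //; exact: cvg_cst.
by apply: cvgD; [exact: cvg_cst|apply: cvgM => //; exact: cvg_cst].
Qed.

End Frame.

Lemma connected_sign (A : set 'rV[R]_3) (F : 'rV[R]_3 -> R) (q : 'rV[R]_3) :
  connected A -> (forall p, A p -> {for p, continuous F}) ->
  (forall p, A p -> F p != 0) -> A q -> 0 < F q -> forall p, A p -> 0 < F p.
Proof.
move=> cA cF F0 Aq Fq p Ap; rewrite lt_neqAle eq_sym F0//= leNgt; apply/negP => Fp.
have cFA : connected (F @` A).
  apply: connected_continuous_connected => //.
  by apply: continuous_in_subspaceT => x /set_mem; exact: cF.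
have /connected_intervalP iFA := cFA.
have [x Ax Fx] : (F @` A) 0.
  by apply: (iFA (F p) (F q)); [exists p|exists q|rewrite !ltW].
by have := F0 x Ax; rewrite Fx eqxx.
Qed.

End Topo.

Section Convex.
Context {R : realType}.
Variables (L M : R) (f df : R -> R).
Hypothesis fd : forall x, x \in `]L, M[ -> der f x (df x).
Hypothesis df_incr : forall x y, x \in `]L, M[ -> y \in `]L, M[ -> x < y -> df x < df y.

Definition secant (f : R -> R) a b x := f a + slope f a b * (x - a).

Lemma secant_l a b : secant f a b a = f a.
Proof. by rewrite /secant subrr mulr0 addr0. Qed.

Lemma secant_r a b : a < b -> secant f a b b = f b.
Proof. by move=> ab; rewrite /secant slope_mul//; ring. Qed.

Lemma secantB a b x : a < b ->
  (secant f a b x - f x) * (b - a) = (f b - f x) * (x - a) - (f x - f a) * (b - x).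
Proof.
move=> ab; rewrite /secant mulrBl mulrDl mulrAC slope_mul//; ring.
Qed.

Lemma conv3 u v w : u \in `]L, M[ -> w \in `]L, M[ -> u < v -> v < w ->
  (f v - f u) * (w - v) < (f w - f v) * (v - u).
Proof.
move=> uI wI uv vw; have uw := lt_trans uv vw.
have := slope_lt fd df_incr uI wI uv vw.
rewrite -(ltr_pM2r (_ : 0 < (v - u) * (w - u))); last by rewrite mulr_gt0 ?subr_gt0.
rewrite mulrA slope_mul// mulrCA slope_mul// => h.
by rewrite -subr_gt0; move: h; rewrite -subr_gt0; congr (_ < _); ring.
Qed.

Lemma secant_gt a b x : a \in `]L, M[ -> b \in `]L, M[ -> a < x -> x < b ->
  f x < secant f a b x.
Proof.
move=> aI bI ax xb; have ab := lt_trans ax xb.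
rewrite -subr_gt0 -(pmulr_lgt0 _ (_ : 0 < b - a)) ?subr_gt0// secantB// subr_gt0.
exact: conv3.
Qed.

(** Outside []a, b[] the strictly convex graph lies on or above the line through its two points.
    This later confines the component cut off by a chord to the abscissas between [a] and [b]. *)
Lemma secant_itv a b x : a \in `]L, M[ -> b \in `]L, M[ -> x \in `]L, M[ -> a < b ->
  f x < secant f a b x -> a < x < b.
Proof.
move=> aI bI xI ab; rewrite -subr_gt0 -(pmulr_lgt0 _ (_ : 0 < b - a)) ?subr_gt0// secantB//.
move=> h; rewrite !ltNge; apply/andP; split; apply/negP.
  rewrite le_eqVlt => /predU1P[xa|xa]; first by move: h; rewrite xa; lra.
  by have := conv3 xI bI xa ab; lra.
rewrite le_eqVlt => /predU1P[xa|xa]; first by move: h; rewrite xa; lra.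
by have := conv3 aI xI ab xa; lra.
Qed.

End Convex.

Section Sheet.
Context {R : realType}.
Implicit Types (x y : R).

Lemma star_connected (E : set (R * R)) (z0 : R * R) : E z0 ->
  (forall (z : R * R) t, E z -> 0 <= t <= 1 ->
     E (z0.1 + t * (z.1 - z0.1), z0.2 + t * (z.2 - z0.2))) -> connected E.
Proof.
move=> Ez0 star.
pose sg (z : R * R) (t : R) : R * R := (z0.1 + t * (z.1 - z0.1), z0.2 + t * (z.2 - z0.2)).
have -> : E = \bigcup_(z in E) (sg z @` `[0, 1]%classic).
  apply/seteqP; split => [z Ez|z [z1 Ez1 [t t01 <-]]].
    exists z => //; exists 1; first by rewrite /= in_itv/= ler01 lexx.
    by rewrite /sg !mul1r ![_ + (_ - _)]addrC !subrK -surjective_pairing.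
  by apply: star => //; move: t01; rewrite /= in_itv.
apply: bigcup_connected.
  exists z0 => z Ez; exists 0; first by rewrite /= in_itv/= ler01 lexx.
  by rewrite /sg !mul0r !addr0 -surjective_pairing.
move=> z Ez; apply: connected_continuous_connected; first exact: segment_connected.
have c (u v t : R) : u + s * v @[s --> t] --> u + t * v.
  by apply: cvgD; [exact: cvg_cst|apply: cvgM; [exact: cvg_id|exact: cvg_cst]].
by apply: continuous_subspaceT => t; exact: (cvg_pair (c _ _ t) (c _ _ t)).
Qed.

Lemma convex_comb (a b x y t : R) : a < x < b -> a < y < b -> 0 <= t <= 1 ->
  a < x + t * (y - x) < b.
Proof.
move=> /andP[ax xb] /andP[ay yb] /andP[t0 t1].
rewrite (_ : x + _ = (1 - t) * x + t * y); last by ring.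
have [->|tN0] := eqVneq t 0; first by rewrite subr0 mul1r mul0r addr0 ax.
have t0' : 0 < t by rewrite lt_neqAle eq_sym tN0.
apply/andP; split; rewrite -subr_gt0.
  rewrite (_ : _ - _ = (1 - t) * (x - a) + t * (y - a)); last by ring.
  by rewrite ltr_wpDl ?mulr_ge0 ?mulr_gt0 ?subr_ge0 ?subr_gt0// ltW.
rewrite (_ : _ - _ = (1 - t) * (b - x) + t * (b - y)); last by ring.
by rewrite ltr_wpDl ?mulr_ge0 ?mulr_gt0 ?subr_ge0 ?subr_gt0// ltW.
Qed.

Lemma rect_connected (a b c d : R) : a < b -> c < d ->
  connected ([set z | (a < z.1 < b) /\ (c < z.2 < d)] : set (R * R)).
Proof.
move=> ab cd; apply: (@star_connected _ ((a + b) / 2, (c + d) / 2)) => /=.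
  by split; apply/andP; split; lra.
by move=> z t [z1 z2] t01; split; apply: convex_comb => //; apply/andP; split; lra.
Qed.

Variables (G : geometry) (P : 'M[R]_3).
Local Notation K := (curvature R G).

(** Points near the graph of [f], with the height above it measured in units of [h]: a constant [h]
    yields strips, the gap to a secant yields caps. *)
Definition sheet (f h : R -> R) (z : R * R) : 'rV[R]_3 :=
  lift K P z.1 (f z.1 + z.2 * h z.1).

Lemma sheet_cont (f h : R -> R) (z : R * R) :
  {for z.1, continuous f} -> {for z.1, continuous h} ->
  0 < gN K z.1 (f z.1 + z.2 * h z.1) -> {for z, continuous (sheet f h)}.
Proof.
move=> cf ch N0; apply: cvg_lift => //; first exact: cvg_fst.
have c1 (k : R -> R) : {for z.1, continuous k} -> k w.1 @[w --> z] --> k z.1.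
  by move=> ck; apply: continuous_cvg => //; exact: cvg_fst.
by apply: cvgD; [exact: c1|apply: cvgM; [exact: cvg_snd|exact: c1]].
Qed.

End Sheet.

Section Chord.
Context {R : realType}.
Implicit Types (x y : R) (p q : 'rV[R]_3).
Variables (G : geometry) (P : 'M[R]_3).
Hypothesis FP : frame G P.
Local Notation K := (curvature R G).
Local Notation c0 := (crd P 0).
Local Notation c1 := (crd P 1).
Local Notation c2 := (crd P ord_max).

Lemma surface_neq0 p : surface G p -> p != 0.
Proof.
move=> Sp; apply/eqP => p0; move: Sp; rewrite p0; case: (G); rewrite /= ?bilinQ ?mxE/=.
- by move/eqP; rewrite eq_sym oner_eq0.
- by rewrite !mulr0 !addr0 => /eqP; rewrite eq_sym oner_eq0.
- by rewrite ltxx => -[].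
Qed.

(** Nonnegative combinations of two points of the surface project from the origin onto the segment
    between their chart points. In the proof, [u'] and [v'] are the barycentric weights before
    normalization. *)
Lemma chord_lift a b ya yb : a < b -> 0 < gN K a ya -> 0 < gN K b yb ->
  (forall x, a <= x <= b -> 0 < gN K x (ya + (yb - ya) / (b - a) * (x - a))) ->
  chord G (lift K P a ya) (lift K P b yb) =
  [set lift K P x (ya + (yb - ya) / (b - a) * (x - a)) | x in `[a, b]%classic].
Proof.
move=> ab Na Nb Nx; have ba : b - a != 0 by rewrite subr_eq0 gt_eqF.
have sa : Num.sqrt (gN K a ya) != 0 by rewrite gt_eqF ?sqrtr_gt0.
have sb : Num.sqrt (gN K b yb) != 0 by rewrite gt_eqF ?sqrtr_gt0.
apply/seteqP; split => p.
  move=> [Sp [u [v [u0 v0 ep]]]].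
  pose u' := u / Num.sqrt (gN K a ya); pose v' := v / Num.sqrt (gN K b yb).
  have u'0 : 0 <= u' by rewrite divr_ge0 ?sqrtr_ge0.
  have v'0 : 0 <= v' by rewrite divr_ge0 ?sqrtr_ge0.
  have e0 : c0 p = u' + v' by rewrite ep crdD (crdZ _ _ u) (crdZ _ _ v) !(crd_lift FP).
  have e1 : c1 p = u' * a + v' * b by rewrite ep crdD (crdZ _ _ u) (crdZ _ _ v) !(crd_lift FP) /u' /v' !mulrA.
  have e2 : c2 p = u' * ya + v' * yb by rewrite ep crdD (crdZ _ _ u) (crdZ _ _ v) !(crd_lift FP) /u' /v' !mulrA.
  (* Both weights cannot vanish, since the surface does not contain the origin. *)
  have p0 : 0 < c0 p.
    rewrite lt_neqAle eq_sym {2}e0 addr_ge0// andbT.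
    apply: contraNneq (surface_neq0 Sp); rewrite e0 => /eqP.
    rewrite paddr_eq0// => /andP[/eqP u'e /eqP v'e].
    apply/eqP/(crd_inj (frame_orth FP)); rewrite ?e0 ?e1 ?e2 u'e v'e;
      by rewrite /crd mul0mx mxE; ring.
  have p0' : c0 p != 0 by rewrite gt_eqF.
  exists (c1 p / c0 p); first rewrite /= in_itv/= ler_pdivlMr// ler_pdivrMr// e0 e1.
    have h1 : 0 <= v' * (b - a) by rewrite mulr_ge0// subr_ge0 ltW.
    have h2 : 0 <= u' * (b - a) by rewrite mulr_ge0// subr_ge0 ltW.
    by apply/andP; split; lra.
  rewrite -[RHS](surface_lift FP)//; congr (lift _ _ _ _).
  by rewrite e1 e2 e0; field; rewrite ba -e0 p0'.
move=> [x]; rewrite /= in_itv/= => xab <-; have N0 := Nx _ xab.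
set y := ya + _ in N0 *; have s0 : Num.sqrt (gN K x y) != 0 by rewrite gt_eqF ?sqrtr_gt0.
split; first exact: (lift_surface FP).
exists (Num.sqrt (gN K a ya) * ((b - x) / (b - a)) / Num.sqrt (gN K x y)).
exists (Num.sqrt (gN K b yb) * ((x - a) / (b - a)) / Num.sqrt (gN K x y)).
have ba0 : 0 <= b - a by rewrite subr_ge0 ltW.
move/andP: xab => [ax xb]; split.
- by rewrite !(divr_ge0, mulr_ge0) ?sqrtr_ge0// subr_ge0.
- by rewrite !(divr_ge0, mulr_ge0) ?sqrtr_ge0// subr_ge0.
set wa := _ * _ / _; set wb := _ * _ / _.
apply: (crd_inj (frame_orth FP)); rewrite crdD (crdZ _ _ wa) (crdZ _ _ wb) !(crd_lift FP) /y /wa /wb.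
- by field; rewrite ba s0 sa sb.
- by field; rewrite ba s0 sa sb.
- by field; rewrite ba s0 sa sb.
Qed.

Lemma chord_secant (f : R -> R) a b : a < b -> 0 < gN K a (f a) -> 0 < gN K b (f b) ->
  (forall x, a <= x <= b -> 0 < gN K x (secant f a b x)) ->
  chord G (lift K P a (f a)) (lift K P b (f b)) =
  [set lift K P x (secant f a b x) | x in `[a, b]%classic].
Proof. by move=> ab Na Nb Nx; rewrite chord_lift. Qed.

End Chord.

(** * The convex side of the germ *)

Section Side.
Context {R : realType}.
Implicit Types (x y : R) (p q : 'rV[R]_3).
Variables (G : geometry) (P : 'M[R]_3).
Hypothesis FP : frame G P.
Local Notation K := (curvature R G).
Local Notation c0 := (crd P 0).
Local Notation X p := (crd P 1 p / crd P 0 p).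
Local Notation Y p := (crd P ord_max p / crd P 0 p).
Variables (L M : R) (f df : R -> R).
Hypothesis fd : forall x, x \in `]L, M[ -> der f x (df x).
Hypothesis df_incr : forall x y, x \in `]L, M[ -> y \in `]L, M[ -> x < y -> df x < df y.
Variables (l r e : R) (D Gam V : set 'rV[R]_3).
Hypothesis lr : l < r.
Hypothesis lrLM : forall x, x \in `]l, r[ -> x \in `]L, M[.
Hypothesis e0 : 0 < e.
Hypothesis DS : forall p, D p -> [/\ surface G p, 0 < c0 p & X p \in `]L, M[].
Hypothesis DGam : forall p, D p -> (Gam p <-> Y p = f (X p)).
Hypothesis Dstrip : forall x (t : R), x \in `]l, r[ -> - e < t < e ->
  0 < gN K x (f x + t) /\ D (lift K P x (f x + t)).

(** For [K = -1] this is the convexity of the unit disk. *)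
Lemma gN_mid a ya b yb : 0 < gN K a ya -> 0 < gN K b yb ->
  0 < gN K ((a + b) / 2) ((ya + yb) / 2).
Proof.
have [K1|->] : 0 <= K \/ K = -1.
- by case: (G) => /=; [left|left; exact: ler01|right].
- by move=> _ _; rewrite /gN ltr_wpDr// mulr_ge0// addr_ge0// sqr_ge0.
rewrite /gN !expr2 => Na Nb.
by have := sqr_ge0 (a - b); have := sqr_ge0 (ya - yb); rewrite !expr2; nra.
Qed.

Definition above p := Y p - f (X p).

Lemma crd_ratio_cont k q : c0 q != 0 -> crd P k p / c0 p @[p --> q] --> crd P k q / c0 q.
Proof.
move=> q0; have h j : crd P j p @[p --> q] --> crd P j q by apply: crd_cont.
exact: (cvgM (h k) (cvgV q0 (h 0))).
Qed.

Lemma above_cont q : c0 q != 0 -> X q \in `]L, M[ -> {for q, continuous above}.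
Proof.
move=> q0 qI; have h1 := crd_ratio_cont (k := 1) q0.
have h2 := crd_ratio_cont (k := ord_max) q0.
exact: (cvgB h2 (continuous_cvg _ (der_cont (fd qI)) h1)).
Qed.

Lemma above_lift x y : 0 < gN K x y -> above (lift K P x y) = y - f x.
Proof. by move=> N0; rewrite /above !(lift_ratio FP). Qed.

Lemma above_neq0 p : (D `\` Gam) p -> above p != 0.
Proof.
move=> [Dp Gp]; apply/eqP => /eqP; rewrite subr_eq0 => /eqP h.
by apply: Gp; apply/DGam.
Qed.

Lemma connected_above (C : set 'rV[R]_3) q : connected C -> C `<=` D `\` Gam -> C q ->
  (0 < above q -> forall p, C p -> 0 < above p) /\
  (above q < 0 -> forall p, C p -> above p < 0).
Proof.
move=> cC CD Cq.
have cont p : C p -> {for p, continuous above}.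
  by move=> /CD[/DS[_ /lt0r_neq0 p0 pI] _]; exact: above_cont.
have neq p : C p -> above p != 0 by move=> /CD; exact: above_neq0.
split => aq p Cp; first exact: (connected_sign cC cont neq Cq aq).
pose F z := - above z.
have contF z : C z -> {for z, continuous F} by move=> /cont h; exact: (cvgN h).
have neqF z : C z -> F z != 0 by move=> /neq; rewrite oppr_eq0.
have Fq : 0 < F q by rewrite oppr_gt0.
by have := connected_sign cC contF neqF Cq Fq Cp; rewrite oppr_gt0.
Qed.

Let strip (c d : R) : set 'rV[R]_3 :=
  sheet G P f (cst 1) @` [set z | (l < z.1 < r) /\ (c < z.2 < d)].

Lemma strip_connected c d : - e <= c -> c < d -> d <= e -> connected (strip c d).
Proof.
move=> ec cd de; apply: connected_continuous_connected; first exact: rect_connected.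
apply: continuous_in_subspaceT => z /set_mem[z1 /andP[z2 z3]].
have zI : z.1 \in `]l, r[ by rewrite in_itv.
have [|N0 _] := @Dstrip z.1 z.2 zI.
  by rewrite (le_lt_trans ec)// (lt_le_trans z3).
apply: sheet_cont; last by rewrite mulr1.
  exact: (der_cont (fd (lrLM zI))).
exact: cst_continuous.
Qed.

Lemma strip_sub c d : - e <= c -> d <= e -> 0 <= c \/ d <= 0 -> strip c d `<=` D `\` Gam.
Proof.
move=> ec de cd0 p [z [z1 /andP[z2 z3]] <-].
have zI : z.1 \in `]l, r[ by rewrite in_itv.
have [|N0 Dz] := @Dstrip z.1 z.2 zI.
  by rewrite (le_lt_trans ec)// (lt_le_trans z3).
rewrite /sheet mulr1; split => // /(DGam Dz).
by rewrite !(lift_ratio FP)// => h; case: cd0; lra.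
Qed.

Hypothesis VP : convex_side G D Gam V.

Let strip_mem c d x t : x \in `]l, r[ -> c < t < d -> strip c d (lift K P x (f x + t)).
Proof. by move=> xI td; exists (x, t) => //=; rewrite /sheet mulr1. Qed.

Lemma component_strip c d x t : - e <= c -> d <= e -> 0 <= c \/ d <= 0 ->
  x \in `]l, r[ -> c < t < d ->
  strip c d `<=` connected_component (D `\` Gam) (lift K P x (f x + t)).
Proof.
move=> ec de cd0 xI td; have sp := strip_mem xI td.
apply: connected_component_max => //; first exact: strip_sub.
by apply: strip_connected => //; case/andP: td; exact: lt_trans.
Qed.

(** The strips above and below the graph lie in different components, so [V] is one of these two. If
    it were the lower one, it would contain two points slightly below the graph on either side of
    [m]. By strict convexity their chord passes above the graph over [m], against geodesic
    convexity. *)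
Lemma convex_side_above :
  [/\ exists q, V = connected_component (D `\` Gam) q,
     forall p, V p -> D p /\ 0 < above p &
     forall x (t : R), x \in `]l, r[ -> 0 < t < e -> V (lift K P x (f x + t))].
Proof.
have [V' [VV' cV gV]] := VP.
have inI z : l < z -> z < r -> z \in `]l, r[ by move=> lz zr; rewrite in_itv/= lz zr.
have [lm mr] : l < (l + r) / 2 /\ (l + r) / 2 < r by have h := lr; split; lra.
set m := (l + r) / 2 in lm mr *.
have mI := inI _ lm mr.
have e0' := e0; have up : 0 < e / 2 < e by apply/andP; split; lra.
have dn : - e < - (e / 2) < 0 by apply/andP; split; lra.
pose cc := connected_component (D `\` Gam).
pose pu := lift K P m (f m + e / 2); pose pd := lift K P m (f m + - (e / 2)).
have [Nu Du] : 0 < gN K m (f m + e / 2) /\ D pu by apply: Dstrip => //; apply/andP; split; lra.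
have [Nd Dd] : 0 < gN K m (f m + - (e / 2)) /\ D pd by apply: Dstrip => //; apply/andP; split; lra.
have le_e : - e <= 0 by lra.
have Su : (D `\` Gam) pu by apply: (strip_sub le_e (lexx _) (or_introl (lexx _))); exact: strip_mem.
have Sd : (D `\` Gam) pd.
  by apply: (strip_sub (lexx _) (ltW e0) (or_intror (lexx _))); exact: strip_mem.
have au : 0 < above pu by rewrite above_lift//; lra.
have ad : above pd < 0 by rewrite above_lift//; lra.
have ccu p : cc pu p -> 0 < above p.
  have [h _] := connected_above (@component_connected _ _ pu) (@connected_component_sub _ _ pu)
    (connected_component_refl Su).
  exact: h.
have ccd p : cc pd p -> above p < 0.
  have [_ h] := connected_above (@component_connected _ _ pd) (@connected_component_sub _ _ pd)
    (connected_component_refl Sd).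
  exact: h.
have [Vu|Vu] : V = cc pu \/ V' = cc pu.
  have : components (D `\` Gam) (cc pu) by exists pu.
  by rewrite cV => -[->|->]; [left|right].
  split; first by exists pu.
    by move=> p; rewrite Vu => h; split; [case: (connected_component_sub h)|exact: ccu].
  move=> x t xI tI; rewrite Vu; apply: (component_strip le_e (lexx _) (or_introl (lexx _)) mI up).
  exact: strip_mem.
exfalso.
have Vd p : V p <-> cc pd p.
  suff -> : V = cc pd by [].
  have : components (D `\` Gam) (cc pd) by exists pd.
  rewrite cV => -[->//|]; rewrite Vu => /= h.
  have : cc pd pd by exact: connected_component_refl.
  move=> hd; have := hd; rewrite {1}h => /ccu /(lt_trans (ccd _ hd)); by rewrite ltxx.
move: Vd; clear Vu cV VV' => Vd.
pose a := (l + m) / 2; pose b := (m + r) / 2.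
have aI : a \in `]l, r[ by apply: inI; rewrite /a; lra.
have bI : b \in `]l, r[ by apply: inI; rewrite /b; lra.
have am : a < m by rewrite /a /m; lra.
have mb : m < b by rewrite /b /m; lra.
have gap : f m < (f a + f b) / 2.
  have := conv3 fd df_incr (lrLM aI) (lrLM bI) am mb.
  rewrite (_ : m - a = b - m); last by rewrite /a /b /m; lra.
  by rewrite ltr_pM2r ?subr_gt0//; lra.
pose t := Num.min (e / 2) (((f a + f b) / 2 - f m) / 2).
have t0 : 0 < t by rewrite lt_min; apply/andP; split; lra.
have [te tg] : t <= e / 2 /\ t <= ((f a + f b) / 2 - f m) / 2 by rewrite !ge_min !lexx orbT.
have tI : - e < - t < 0 by apply/andP; split; lra.
have tI' : - e < - t < e by apply/andP; split; lra.
have Vlow x : x \in `]l, r[ -> V (lift K P x (f x + - t)).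
  move=> xI; apply/Vd.
  apply: (component_strip (lexx _) (ltW e0) (or_intror (lexx _)) mI dn).
  exact: strip_mem.
have [Na _] := Dstrip aI tI'; have [Nb _] := Dstrip bI tI'.
have := gN_mid Na Nb.
have -> : (a + b) / 2 = m by rewrite /a /b /m; lra.
have -> : (f a + - t + (f b + - t)) / 2 = (f a + f b) / 2 - t by lra.
set y := _ - t => Nm.
have sa : Num.sqrt (gN K a (f a + - t)) != 0 by rewrite gt_eqF ?sqrtr_gt0.
have sb : Num.sqrt (gN K b (f b + - t)) != 0 by rewrite gt_eqF ?sqrtr_gt0.
have sm : Num.sqrt (gN K m y) != 0 by rewrite gt_eqF ?sqrtr_gt0.
have Vm : V (lift K P m y).
  apply: (gV _ _ (Vlow _ aI) (Vlow _ bI)); split; first exact: (lift_surface FP).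
  exists (2^-1 * Num.sqrt (gN K a (f a + - t)) / Num.sqrt (gN K m y)).
  exists (2^-1 * Num.sqrt (gN K b (f b + - t)) / Num.sqrt (gN K m y)).
  split; [by rewrite !(divr_ge0, mulr_ge0) ?sqrtr_ge0 ?invr_ge0|
    by rewrite !(divr_ge0, mulr_ge0) ?sqrtr_ge0 ?invr_ge0|].
  set wa := _ * _ / _; set wb := _ * _ / _.
  apply: (crd_inj (frame_orth FP)); rewrite crdD (crdZ _ _ wa) (crdZ _ _ wb) !(crd_lift FP) /wa /wb.
  - by field; rewrite sm sa sb.
  - by rewrite {1}/m /a /b /m; field; rewrite sm sa sb.
  - by set q := Num.sqrt (gN K m y) in sm *; rewrite /y; field; rewrite sm sa sb.
by move: Vm => /Vd/ccd; rewrite above_lift// /y; lra.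
Qed.

End Side.

(** * The cap as the region cut off by its chord *)

Section Cut.
Context {R : realType}.
Notation mR := (measurableTypeR R).
Implicit Types (x y : R) (p q : 'rV[R]_3).
Variables (G : geometry) (P : 'M[R]_3).
Hypothesis FP : frame G P.
Local Notation K := (curvature R G).
Local Notation c0 := (crd P 0).
Local Notation X p := (crd P 1 p / crd P 0 p).
Local Notation Y p := (crd P ord_max p / crd P 0 p).
Variables (L M : R) (f df : R -> R).
Hypothesis fd : forall x, x \in `]L, M[ -> der f x (df x).
Hypothesis df_incr : forall x y, x \in `]L, M[ -> y \in `]L, M[ -> x < y -> df x < df y.
Variables (l r e lo hi nu : R) (D V : set 'rV[R]_3).
Hypothesis lrLM : forall x, x \in `]l, r[ -> x \in `]L, M[.
Hypothesis DS : forall p, D p -> [/\ surface G p, 0 < c0 p & X p \in `]L, M[].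
Hypothesis VD : forall p, V p -> D p /\ 0 < above P f p.
Hypothesis Vup : forall x (t : R), x \in `]l, r[ -> 0 < t < e -> V (lift K P x (f x + t)).
Hypothesis S : setting K l r lo hi nu f df.
Hypothesis hilo : hi - lo <= e.
Variables (a b : R).
Hypothesis aI : a \in `]l, r[.
Hypothesis bI : b \in `]l, r[.
Hypothesis ab : a < b.

Let nu0 := set_nu S.
Let box := @set_box _ _ _ _ _ _ _ _ _ S.
Let fdS := @set_der _ _ _ _ _ _ _ _ _ S.
Let incrS := @set_incr _ _ _ _ _ _ _ _ _ S.
Let lines := @set_lines _ _ _ _ _ _ _ _ _ S.
Let sec := secant f a b.
Let W := frameset G P (cap f a b).
Let reg := sheet G P f (fun x => sec x - f x).
Let itv x : a <= x <= b -> x \in `]l, r[.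
Proof. by move=> /andP[ax xb]; exact: (itv_between aI bI ax xb). Qed.

Let box_gN x y : x \in `]l, r[ -> y \in `]lo, hi[ -> 0 < gN K x y.
Proof. by move=> xI yI; rewrite -gB_gN (lt_le_trans nu0)// box. Qed.

Let sec_box x : a <= x <= b -> sec x \in `]lo, hi[.
Proof.
move=> /itv xI; have [xi /andP[x1 x2] es] := slope_df fdS aI bI ab.
by rewrite /sec /secant es; apply: lines => //; exact: (itv_between aI bI (ltW x1) (ltW x2)).
Qed.

Let reg_box (z : R * R) : a <= z.1 <= b -> 0 <= z.2 <= 1 ->
  f z.1 + z.2 * (sec z.1 - f z.1) \in `]lo, hi[.
Proof.
move=> z1 z2; rewrite in_itv/=; apply: convex_comb => //.
  by have := f_lo lines (itv z1); rewrite in_itv.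
by have := sec_box z1; rewrite in_itv.
Qed.

Let reg_gN (z : R * R) : a <= z.1 <= b -> 0 <= z.2 <= 1 ->
  0 < gN K z.1 (f z.1 + z.2 * (sec z.1 - f z.1)).
Proof. by move=> z1 z2; apply: box_gN; [exact: itv|exact: reg_box]. Qed.

Let reg_cont (z : R * R) : a <= z.1 <= b -> 0 <= z.2 <= 1 -> {for z, continuous reg}.
Proof.
move=> z1 z2; have cf := der_cont (fdS (itv z1)).
apply: sheet_cont => //; last exact: reg_gN.
apply: cvgB => //; apply: cvgD; first exact: cvg_cst.
by apply: cvgM; [exact: cvg_cst|apply: cvgB; [exact: cvg_id|exact: cvg_cst]].
Qed.

Let sec_gt x : a < x < b -> f x < sec x.
Proof. by move=> /andP[ax xb]; exact: (secant_gt fdS incrS aI bI ax xb). Qed.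

(** Writing the cap as the image of an open rectangle gives its connectedness and, through the
    compact closed rectangle, a bound for its closure. *)
Let W_reg : W = reg @` [set z | (a < z.1 < b) /\ (0 < z.2 < 1)].
Proof.
apply/seteqP; split => p.
  move=> [Sp p0 [/= [aX Xb] [fY Ys]]].
  have Xab : a < X p < b by rewrite aX Xb.
  have g0 : 0 < sec (X p) - f (X p) by rewrite subr_gt0 sec_gt.
  exists (X p, (Y p - f (X p)) / (sec (X p) - f (X p))) => /=.
    split; first by rewrite aX Xb.
    apply/andP; split; first by rewrite divr_gt0// subr_gt0.
    by rewrite ltr_pdivrMr// mul1r ltrD2r.
  rewrite /reg /sheet/= divfK ?gt_eqF// addrC subrK.
  exact: (surface_lift FP Sp p0).
move=> [z [z1 /andP[z2 z3]] <-]; have /andP[az zb] := z1.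
have z1' : a <= z.1 <= b by rewrite !ltW.
have z2' : 0 <= z.2 <= 1 by rewrite !ltW.
have N0 := reg_gN z1' z2'; have g0 : 0 < sec z.1 - f z.1 by rewrite subr_gt0 sec_gt.
split; [exact: (lift_surface FP N0)|exact: (lift_c0 FP N0)|].
rewrite !(lift_ratio FP N0) /cap/=; split => //; split; first by rewrite ltrDl mulr_gt0.
rewrite -/(sec _) -/(secant f a b z.1) -/sec -subr_gt0.
rewrite (_ : _ - _ = (1 - z.2) * (sec z.1 - f z.1)); last by ring.
by rewrite mulr_gt0// subr_gt0.
Qed.

Let chordE : chord G (lift K P a (f a)) (lift K P b (f b)) =
  [set lift K P x (sec x) | x in `[a, b]%classic].
Proof.
have ge x : a <= x <= b -> 0 < gN K x (sec x) by move=> xab; exact: (box_gN (itv xab) (sec_box xab)).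
rewrite (chord_secant FP ab)//.
  by apply: box_gN => //; exact: (f_lo lines aI).
by apply: box_gN => //; exact: (f_lo lines bI).
Qed.

Let W_V : W `<=` V `\` chord G (lift K P a (f a)) (lift K P b (f b)).
Proof.
rewrite W_reg chordE => p [z [z1 /andP[z2 z3]] <-]; have /andP[az zb] := z1.
have z1' : a <= z.1 <= b by rewrite !ltW.
have z2' : 0 <= z.2 <= 1 by rewrite !ltW.
have N0 := reg_gN z1' z2'; have g0 : 0 < sec z.1 - f z.1 by rewrite subr_gt0 sec_gt.
split.
  (* A point of the cap is above the graph by less than [hi - lo], which is at most [e]; hence it
     lies in the strip covered by [Vup]. *)
  apply: Vup; first exact: itv.
  rewrite mulr_gt0//= (le_lt_trans (ler_piMl (ltW g0) (ltW z3)))//.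
  have := f_lo lines (itv z1'); have := sec_box z1'; have := hilo.
  by rewrite !in_itv/= => h /andP[_ h1] /andP[h2 _]; lra.
move=> [x xab]; have {}xab : a <= x <= b by move: xab; rewrite /= in_itv.
have Nx : 0 < gN K x (sec x) by exact: (box_gN (itv xab) (sec_box xab)).
move=> h; have h1 : x = z.1.
  by rewrite -[LHS](lift_ratio FP Nx).1 h (lift_ratio FP N0).
have h2 : sec x = f z.1 + z.2 * (sec z.1 - f z.1).
  by rewrite -[LHS](lift_ratio FP Nx).2 h (lift_ratio FP N0).
have : 0 < (1 - z.2) * (sec z.1 - f z.1) by rewrite mulr_gt0// subr_gt0.
by move: h2; rewrite h1; lra.
Qed.

Let W_connected : connected W.
Proof.
rewrite W_reg; apply: connected_continuous_connected.
  by apply: rect_connected => //; exact: ltr01.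
apply: continuous_in_subspaceT => z /set_mem[/andP[z1 z2] /andP[z3 z4]].
by apply: reg_cont; rewrite !ltW.
Qed.

Definition below p := sec (X p) - Y p.

Let below_cont q : c0 q != 0 -> {for q, continuous below}.
Proof.
move=> q0; have h1 := crd_ratio_cont (k := 1) q0.
have h2 := crd_ratio_cont (k := ord_max) q0.
have cs : {for X q, continuous sec}.
  apply: cvgD; first exact: cvg_cst.
  by apply: cvgM; [exact: cvg_cst|apply: cvgB; [exact: cvg_id|exact: cvg_cst]].
exact: (cvgB (continuous_cvg _ cs h1) h2).
Qed.

(** On such a set [above] is positive, and [below] cannot vanish: by [secant_itv] a zero would lie
    between [a] and [b], hence on the chord. So [below] keeps the sign it has at [q]. *)
Let W_max (C : set 'rV[R]_3) q : connected C -> C q -> W q ->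
  C `<=` V `\` chord G (lift K P a (f a)) (lift K P b (f b)) -> C `<=` W.
Proof.
move=> cC Cq Wq CV.
have inC p : C p -> [/\ surface G p, 0 < c0 p, X p \in `]L, M[ & 0 < above P f p].
  by move=> /CV[/VD[/DS[? ? ?] ?] _].
have trap p : C p -> 0 <= below p -> a < X p < b.
  move=> /inC[_ _ XI ap] bp.
  apply: (secant_itv fd df_incr (lrLM aI) (lrLM bI) XI ab).
  by move: ap bp; rewrite /above /below /sec subr_gt0 subr_ge0; exact: lt_le_trans.
have b0 p : C p -> 0 < below p.
  apply: (@connected_sign _ C below q) => //.
  - by move=> z /inC[_ /lt0r_neq0 z0 _ _]; exact: below_cont.
  - move=> z Cz; apply/eqP => bz; have /andP[h1 h2] : a < X z < b by apply: trap => //; rewrite bz.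
    case: (CV _ Cz) => _; apply; rewrite chordE; have [Sz z0 _ _] := inC z Cz.
    exists (X z); first by rewrite /= in_itv/= !ltW.
    by rewrite -[RHS](surface_lift FP Sz z0); congr lift; apply/eqP; rewrite -subr_eq0 -/(below z) bz.
  - by case: Wq => _ _ [_ []]; rewrite /below subr_gt0.
move=> p Cp; have [Sp p0 XI ap] := inC p Cp; have bp := b0 p Cp.
have /andP[h1 h2] := trap p Cp (ltW bp); split => //; split => //; split.
  by move: ap; rewrite /above subr_gt0.
by move: bp; rewrite /below subr_gt0.
Qed.

Let W_component : components (V `\` chord G (lift K P a (f a)) (lift K P b (f b))) W.
Proof.
pose m := (a + b) / 2; have [am mb] : a < m /\ m < b by rewrite /m; have := ab; split; lra.
have Wq : W (reg (m, 2^-1)).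
  rewrite W_reg; exists (m, 2^-1) => //=; split; first by rewrite am mb.
  by rewrite invr_gt0 ltr0n invf_lt1 ?ltr1n.
exists (reg (m, 2^-1)); first exact: W_V.
apply/seteqP; split; last exact: connected_component_max.
apply: (@W_max _ (reg (m, 2^-1))) => //.
- exact: component_connected.
- by apply: connected_component_refl; exact: W_V.
- exact: connected_component_sub.
Qed.

Let Wclosure : closure W `<=` reg @` (`[a, b]%classic `*` `[0, 1]%classic).
Proof.
have : closed (reg @` (`[a, b]%classic `*` `[0, 1]%classic)).
  apply: compact_closed; first exact: norm_hausdorff.
  apply: continuous_compact; last by apply: compact_setX; exact: segment_compact.
  apply: continuous_in_subspaceT => z /set_mem[]; rewrite /= !in_itv => z1 z2.
  exact: reg_cont.
move=> /closure_id ->; apply: closureS; rewrite W_reg.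
move=> p [z [/andP[z1 z2] /andP[z3 z4]] <-]; exists z => //.
by split; rewrite /= in_itv/= !ltW.
Qed.

Let arc := [set lift K P x (f x) | x in `[a, b]%classic].

Let W_open q : W q -> exists2 N, nbhs q N & N `&` surface G `<=` W.
Proof.
move=> [Sq q0 [[h1 h2] [h3 h4]]]; have qN0 := lt0r_neq0 q0.
have c0c : c0 p @[p --> q] --> c0 q by apply: crd_cont.
have Xc := crd_ratio_cont (k := 1) qN0.
have XI : X q \in `]l, r[ by apply: itv; rewrite !ltW.
have Ac := above_cont fd qN0 (lrLM XI).
have Bc := below_cont qN0.
have A0 : 0 < above P f q by rewrite subr_gt0.
have B0 : 0 < below q by rewrite subr_gt0.
exists [set p | [/\ 0 < c0 p, a < X p < b, 0 < above P f p & 0 < below p]].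
  near=> p; split; near: p.
  - exact: (cvgr_gt _ c0c).
  - by near do (apply/andP; split); [exact: (cvgr_gt _ Xc)|exact: (cvgr_lt _ Xc)].
  - exact: (cvgr_gt _ Ac).
  - exact: (cvgr_gt _ Bc).
move=> p [[p0 /andP[aX Xb] ap bp] Sp]; split => //; split => //; split.
  by move: ap; rewrite /above subr_gt0.
by move: bp; rewrite /below subr_gt0.
Unshelve. all: by end_near.
Qed.

Let edge_boundary (z : R * R) : a <= z.1 <= b -> 0 <= z.2 <= 1 ->
  ~ W (reg z) -> boundary_in (surface G) W (reg z).
Proof.
move=> z1 z2 nW; split; last first.
  by apply: subset_closure; split => //; exact: (lift_surface FP (reg_gN z1 z2)).
(* The segment from a point of the closed rectangle to its centre stays in the open rectangle for
   [0 < t < 1]. *)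
pose u (t : R) : R * R := (z.1 + t * ((a + b) / 2 - z.1), z.2 + t * (2^-1 - z.2)).
have cu : u t @[t --> 0^'+] --> z.
  have c (v w : R) : v + t * w @[t --> 0^'+] --> v.
    have : v + t * w @[t --> 0^'+] --> v + 0 * w.
      apply: cvg_at_right_filter; apply: cvgD; first exact: cvg_cst.
      by apply: cvgM; [exact: cvg_id|exact: cvg_cst].
    by rewrite mul0r addr0.
  by rewrite [z in _ --> z]surjective_pairing; exact: (cvg_pair (c _ _) (c _ _)).
have cr : reg (u t) @[t --> 0^'+] --> reg z.
  have rc : reg w @[w --> z] --> reg z by exact: (reg_cont z1 z2).
  by have := cvg_comp _ _ cu rc; apply.
apply: (closed_cvg _ (@closed_closure _ W) _ _ cr).
near=> t; apply: subset_closure; rewrite W_reg; exists (u t) => //=.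
have t0 : 0 < t by [].
have t1 : t < 1 by near: t; exact: nbhs_right_lt.
have in_seg (v w c : R) : v <= c <= w -> v < w -> v < c + t * ((v + w) / 2 - c) < w.
  move=> /andP[vc cw] vw; apply/andP; split; rewrite -subr_gt0.
    rewrite (_ : _ - _ = (1 - t) * (c - v) + t * ((w - v) / 2)); last by field.
    by rewrite ltr_wpDl ?mulr_ge0 ?mulr_gt0 ?divr_gt0 ?subr_ge0 ?subr_gt0// ltW.
  rewrite (_ : _ - _ = (1 - t) * (w - c) + t * ((w - v) / 2)); last by field.
  by rewrite ltr_wpDl ?mulr_ge0 ?mulr_gt0 ?divr_gt0 ?subr_ge0 ?subr_gt0// ltW.
split; first exact: in_seg.
by have := in_seg 0 1 z.2 z2 ltr01; rewrite add0r mul1r.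
Unshelve. all: by end_near.
Qed.

Let W_boundary : boundary_in (surface G) W =
  chord G (lift K P a (f a)) (lift K P b (f b)) `|` arc.
Proof.
rewrite chordE; apply/seteqP; split => q.
  move=> [/Wclosure[z [/= z1 z2] <-] cl]; move: z1 z2; rewrite !in_itv/= => z1 z2.
  have nW : ~ W (reg z).
    by move=> /W_open[N Nq NW]; have [p [[Sp nWp] Np]] := cl N Nq; apply: nWp; exact: NW.
  have zab : z.1 \in `[a, b] by rewrite in_itv.
  have [e2|z20] := eqVneq z.2 0.
    by right; exists z.1 => //; rewrite /reg /sheet e2 mul0r addr0.
  have [e2|z21] := eqVneq z.2 1.
    by left; exists z.1 => //; rewrite /reg /sheet e2 mul1r addrC subrK.
  (* The lateral edges of the rectangle collapse to the end points of the arc, where the secant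
     meets the graph. *)
  have [e1|z1a] := eqVneq z.1 a.
    by right; exists z.1 => //; rewrite /reg /sheet e1 /sec secant_l subrr mulr0 addr0.
  have [e1|z1b] := eqVneq z.1 b.
    by right; exists z.1 => //; rewrite /reg /sheet e1 /sec secant_r// subrr mulr0 addr0.
  exfalso; apply: nW; rewrite W_reg; exists z => //=.
  move/andP: z1 => [h1 h2]; move/andP: z2 => [h3 h4].
  by rewrite !lt_neqAle h1 h2 h3 h4 z21 z1b eq_sym z1a eq_sym z20.
have edge (z : R * R) : a <= z.1 <= b -> 0 <= z.2 <= 1 -> z.2 = 0 \/ z.2 = 1 ->
    boundary_in (surface G) W (reg z).
  move=> z1 z2 z01; apply: edge_boundary => // -[_ _].
  rewrite !(lift_ratio FP (reg_gN z1 z2)) /cap/= -/(secant f a b z.1) -/sec => -[_ []].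
  by case: z01 => ->; [rewrite mul0r addr0 ltxx|rewrite mul1r addrC subrK ltxx].
move=> [[x xab <-]|[x xab <-]]; move: xab; rewrite /= in_itv/= => xab.
  have := edge (x, 1) xab; rewrite /reg /sheet/= mul1r addrC subrK; apply.
    by rewrite lexx ler01.
  by right.
have := edge (x, 0) xab; rewrite /reg /sheet/= mul0r addr0; apply.
  by rewrite lexx ler01.
by left.
Qed.

Lemma cap_cut_region : cut_region G V (lift K P a (f a)) (lift K P b (f b))
  [set lift K P x (f x) | x in `[a, b]%classic] (frameset G P (cap f a b)).
Proof. by split; [exact: W_component|exact: W_boundary]. Qed.

Lemma cap_area : area G (frameset G P (cap f a b)) = (carea K f a b)%:E.
Proof.
have lr : l < r by move: aI; rewrite in_itv/= => /andP[]; exact: lt_trans.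
have lohi : lo < hi by have := f_lo lines aI; rewrite in_itv/= => /andP[]; exact: lt_trans.
rewrite (frame_area FP (measurable_cap fdS aI bI) lr lohi).
- exact: (careaE nu0 box fdS incrS lines).
- by move=> x y; exact: box_gN.
move=> z [[az zb] [fz zs]]; have z1 : a <= z.1 <= b by rewrite !ltW.
split; first exact: itv.
have := f_lo lines (itv z1); have := sec_box z1; rewrite !in_itv/= => /andP[_ h1] /andP[h2 _].
by rewrite (lt_trans h2 fz) (lt_trans zs h1).
Qed.

End Cut.

(** * Small geodesic disks in a frame *)

Section Disk.
Context {R : realType}.
Implicit Types (x y : R) (p q O : 'rV[R]_3).
Variables (G : geometry) (P : 'M[R]_3).
Hypothesis FP : frame G P.
Local Notation K := (curvature R G).
Local Notation c0 := (crd P 0).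
Local Notation X p := (crd P 1 p / crd P 0 p).

Lemma ratio_close (p0 p1 o0 o1 e : R) : 0 < p0 -> 0 < o0 -> 0 < e ->
  (p1 * o0 - o1 * p0) ^+ 2 < (e * (p0 * o0)) ^+ 2 -> `|p1 / p0 - o1 / o0| < e.
Proof.
move=> p00 o00 e0 h; have po : 0 < p0 * o0 by rewrite mulr_gt0.
rewrite (_ : _ - _ = (p1 * o0 - o1 * p0) / (p0 * o0)); last first.
  by field; rewrite !gt_eqF.
rewrite normrM normfV (gtr0_norm po) ltr_pdivrMr// -ltr_sqr ?nnegrE ?normr_ge0 ?(ltW (mulr_gt0 e0 po))//.
by rewrite real_normK ?num_real.
Qed.

(** The ambient form defining disks has to control chart abscissas, that is $(p_1 o_0 - o_1 p_0)^2$.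
    The comparison is by Cauchy-Schwarz on the sphere, direct in the plane, and by an exact identity
    on the hyperbolic plane, where coordinate 0 is at least 1. *)
Lemma disk_close O (e : R) : surface G O -> 0 < c0 O -> 0 < e ->
  exists2 r0 : R, 0 < r0 & forall (r : R) p, 0 < r -> r < r0 -> disk G O r p ->
    0 < c0 p /\ `|X p - X O| < e.
Proof.
move=> SO o0 e0.
have bil p : bilin (Q R G) (p - O) (p - O) =
    (crd P 1 p - crd P 1 O) ^+ 2 + (crd P ord_max p - crd P ord_max O) ^+ 2 +
    K * (c0 p - c0 O) ^+ 2 by rewrite (frame_bilin FP) !crdB !expr2.
have hO := (frame_surface FP o0).1 SO.
have rr (r s : R) : 0 < r -> r < s -> r ^+ 2 < s ^+ 2.
  by move=> r0 rs; rewrite ltr_pXn2r// ?nnegrE ltW// (lt_trans r0).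
have [GS|[[K0|K1] GS]] : K = 1 \/ ((K = 0 \/ K = -1) /\ G <> Spherical).
- by case: (G) => /=; [right; split; [left|]|left|right; split; [right|]].
(* The first bound keeps coordinate 0 of [p] above half that of [O]; the second one then suffices
   for [ratio_close]. *)
- pose m := Num.min (c0 O / 2) (e * (c0 O / 2 * c0 O)).
  exists m.
    by rewrite lt_min !mulr_gt0 ?divr_gt0.
  move=> r p r0 rm [_]; rewrite bil GS mul1r => hq.
  have [m1 m2] : m <= c0 O / 2 /\ m <= e * (c0 O / 2 * c0 O) by rewrite !ge_min !lexx orbT.
  have p0 : c0 O / 2 < c0 p.
    have h : (c0 p - c0 O) ^+ 2 < (c0 O / 2) ^+ 2.
      apply: le_lt_trans (rr _ _ r0 (lt_le_trans rm m1)); apply: le_trans (ltW hq).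
      by rewrite lerDr addr_ge0// sqr_ge0.
    rewrite ltNge; apply/negP => pO; move: h; apply/negP; rewrite -leNgt -(sqrrN (_ - _)).
    by rewrite ler_pXn2r ?nnegrE //; lra.
  have p00 : 0 < c0 p by rewrite (lt_trans _ p0)// divr_gt0.
  split => //; apply: ratio_close => //.
  have h1 : r ^+ 2 < (e * (c0 p * c0 O)) ^+ 2.
    apply: rr => //; apply: lt_le_trans rm _; apply: le_trans m2 _.
    by rewrite ler_pM2l// ler_pM2r// ltW.
  apply: le_lt_trans h1; apply: le_trans (ltW hq).
  move: hO; rewrite GS mul1r; move: (crd P 1 p) (crd P 1 O) (c0 p) (c0 O) (crd P ord_max p) (crd P ord_max O).
  clear; move=> p1 o1 p0 o0 p2 o2 hO.
  have e1 : o0 ^+ 2 + o1 ^+ 2 <= 1 by rewrite -hO lerD2l lerDl sqr_ge0.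
  have e2 : (p1 * o0 - o1 * p0) ^+ 2 <= ((p1 - o1) ^+ 2 + (p0 - o0) ^+ 2) * (o0 ^+ 2 + o1 ^+ 2).
    rewrite -subr_ge0 (_ : _ - _ = ((p1 - o1) * o1 + (p0 - o0) * o0) ^+ 2); last by ring.
    exact: sqr_ge0.
  apply: le_trans e2 _; apply: (@le_trans _ _ ((p1 - o1) ^+ 2 + (p0 - o0) ^+ 2)).
    by rewrite ler_piMr// addr_ge0// sqr_ge0.
  by have := sqr_ge0 (p2 - o2); lra.
- exists e => // r p r0 re [Sp]; rewrite bil K0 mul0r addr0 => hq.
  have p0 := frame_pos FP GS Sp; have hp := (frame_surface FP p0).1 Sp.
  have one q : surface G q -> 0 < c0 q -> c0 q = 1.
    move=> Sq q0; have := (frame_surface FP q0).1 Sq; rewrite K0 mul0r addr0 => /eqP.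
    by rewrite sqrf_eq1 => /orP[/eqP//|/eqP h]; move: q0; rewrite h; lra.
  split => //; apply: ratio_close => //; rewrite (one _ Sp p0) (one _ SO o0) !mulr1.
  apply: le_lt_trans (rr _ _ r0 re); apply: le_trans (ltW hq).
  by rewrite lerDl sqr_ge0.
- exists e => // r p r0 re [Sp]; rewrite bil K1 => hq.
  have p0 := frame_pos FP GS Sp; have hp := (frame_surface FP p0).1 Sp.
  have one q : surface G q -> 0 < c0 q -> 1 <= c0 q.
    move=> Sq q0; have := (frame_surface FP q0).1 Sq; rewrite K1 mulN1r => h.
    rewrite -(ler_pXn2r (_ : 0 < 2)%N) ?nnegrE ?ler01 ?(ltW q0)// expr1n.
    by have := sqr_ge0 (crd P 1 q); have := sqr_ge0 (crd P ord_max q); lra.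
  split => //; apply: ratio_close => //.
  have po : 1 <= c0 p * c0 O by rewrite (le_trans (one _ Sp p0))// ler_peMr ?(ltW p0)// one.
  have hre := rr _ _ r0 re; move: hO hp; rewrite K1 => hO hp; move: po hq hO hp hre.
  move: (crd P 1 p) (crd P 1 O) (c0 p) (c0 O) (crd P ord_max p) (crd P ord_max O).
  clear; move=> p1 o1 p0 o0 p2 o2 po hq hO hp hre.
  set q := _ + _ + _ in hq.
  (* The identity holds modulo the surface equations of the two points; the difference is written as
     a combination of these equations. *)
  have id : (p1 * o0 - o1 * p0) ^+ 2 + (p2 * o0 - o2 * p0) ^+ 2 = q * (p0 * o0) - (p0 - o0) ^+ 2.
    apply/eqP; rewrite -subr_eq0; apply/eqP.
    transitivity ((1 - (p0 ^+ 2 + -1 * (p1 ^+ 2 + p2 ^+ 2))) * (o0 ^+ 2 - p0 * o0) +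
      (1 - (o0 ^+ 2 + -1 * (o1 ^+ 2 + o2 ^+ 2))) * (p0 ^+ 2 - p0 * o0)).
      by rewrite /q; ring.
    by rewrite hp hO subrr !mul0r addr0.
  have h2 : (p1 * o0 - o1 * p0) ^+ 2 <= q * (p0 * o0).
    by have := sqr_ge0 (p2 * o0 - o2 * p0); have := sqr_ge0 (p0 - o0); lra.
  have po0 : 0 < p0 * o0 by lra.
  apply: le_lt_trans h2 _; rewrite exprMn.
  apply: (@lt_le_trans _ _ (e ^+ 2 * (p0 * o0))); first by rewrite ltr_pM2r// (lt_trans hq hre).
  by rewrite ler_wpM2l ?sqr_ge0// expr2 ler_peMr// ltW.
Qed.

End Disk.

(** * The germ as a graph in the gnomonic chart *)

Section Germ.
Context {R : realType}.
Implicit Types (s : R) (p q u v w : 'rV[R]_3) (P : 'M[R]_3) (g : R -> 'rV[R]_3).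

Lemma der_crd P k g s : derivable g s 1 ->
  der (fun t => crd P k (g t)) s (crd P k (derive1 g s)).
Proof.
move=> dg; have h j : der (fun t => g t 0 j) s (derive1 g s 0 j).
  have /derivable_mxP/(_ 0 j) dj := dg.
  by rewrite derive1E derive_mx// mxE -derive1E; exact: derivable_der.
have -> : (fun t => crd P k (g t)) = fun t => g t 0 0 * P 0 k + g t 0 1 * P 1 k + g t 0 ord_max * P ord_max k.
  by apply/funext => t; rewrite crdE.
apply: der_eq; first by der_auto.
by rewrite /= crdE; ring.
Qed.

Lemma derivable_cvg g s : derivable g s 1 -> g t @[t --> s] --> g s.
Proof.
move=> dg; apply: cvg_rV3 => j; have /derivable_mxP/(_ 0 j) dj := dg.
exact: (der_cont (derivable_der dj)).
Qed.

Definition det3 P u v w := crd P 0 u * (crd P 1 v * crd P ord_max w - crd P ord_max v * crd P 1 w)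
  - crd P 1 u * (crd P 0 v * crd P ord_max w - crd P ord_max v * crd P 0 w)
  + crd P ord_max u * (crd P 0 v * crd P 1 w - crd P 1 v * crd P 0 w).
(** Numerator of the derivative of [crd P k / crd P 0] along a curve at the point [u] with velocity
    [v]. *)
Definition dnum P k u v := crd P k v * crd P 0 u - crd P k u * crd P 0 v.

Lemma dnum_det P u v w :
  dnum P ord_max u w * dnum P 1 u v - dnum P ord_max u v * dnum P 1 u w = crd P 0 u * det3 P u v w.
Proof. by rewrite /dnum /det3; ring. Qed.

(** The Gram matrix of the three vectors has determinant $K d^2$. Expanding it with [uu = K] and
    [uv = 0], then multiplying by [K], gives the formula. *)
Lemma gram_alg (K x0 x1 x2 y0 y1 y2 z0 z1 z2 : R) : K * K = 1 ->
  let uu := x1 * x1 + x2 * x2 + K * (x0 * x0) in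
  let uv := x1 * y1 + x2 * y2 + K * (x0 * y0) in
  let vv := y1 * y1 + y2 * y2 + K * (y0 * y0) in
  let vw := y1 * z1 + y2 * z2 + K * (y0 * z0) in
  let ww := z1 * z1 + z2 * z2 + K * (z0 * z0) in
  let uw := x1 * z1 + x2 * z2 + K * (x0 * z0) in
  uu = K -> uv = 0 ->
  vv * (ww - K * uw ^+ 2) - vw ^+ 2 =
  (x0 * (y1 * z2 - y2 * z1) - x1 * (y0 * z2 - y2 * z0) + x2 * (y0 * z1 - y1 * z0)) ^+ 2.
Proof.
move=> KK uu uv vv vw ww uw huu huv; set d := _ - _ + _.
have hd : K * d ^+ 2 = uu * (vv * ww - vw ^+ 2) - uv * (uv * ww - vw * uw) + uw * (uv * vw - vv * uw).
  by rewrite /d /uu /uv /vv /vw /ww /uw; ring.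
rewrite -[RHS]mul1r -KK -mulrA hd huu huv.
transitivity (K * K * (vv * ww - vw ^+ 2) - K * (uw ^+ 2 * vv)); last by ring.
by rewrite KK; ring.
Qed.

(** Ties the geodesic curvature to the determinant of position, velocity and acceleration. The
    equations assumed are that of the surface and its first two derivatives along the curve; in the
    Euclidean case they make coordinate 0 of the velocity and of the acceleration vanish. *)
Lemma gram_det G P u v w : frame G P -> 0 < crd P 0 u ->
  crd P 0 u ^+ 2 + curvature R G * (crd P 1 u ^+ 2 + crd P ord_max u ^+ 2) = 1 ->
  crd P 0 u * crd P 0 v + curvature R G * (crd P 1 u * crd P 1 v + crd P ord_max u * crd P ord_max v) = 0 ->
  crd P 0 v ^+ 2 + crd P 0 u * crd P 0 w + curvature R G *
    (crd P 1 v ^+ 2 + crd P ord_max v ^+ 2 + (crd P 1 u * crd P 1 w + crd P ord_max u * crd P ord_max w)) = 0 ->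
  gram G v (w - (curvature R G * bilin (Q R G) w u) *: u) = det3 P u v w ^+ 2.
Proof.
move=> FP u0; rewrite /gram !(frame_bilin FP) !crdB !(crdZ _ _ _ u) /det3.
have [K0|KK] : curvature R G = 0 \/ curvature R G * curvature R G = 1.
  by case: (G) => /=; [left|right; rewrite mulr1|right; rewrite mulrNN mulr1].
  rewrite K0 !mul0r !addr0 => h0 h1 h2.
  have v0 : crd P 0 v = 0 by move/eqP : h1; rewrite mulf_eq0 (gt_eqF u0)/= => /eqP.
  have w0 : crd P 0 w = 0.
    by move/eqP : h2; rewrite v0 expr0n/= add0r mulf_eq0 (gt_eqF u0)/= => /eqP.
  rewrite v0 w0.
  transitivity (crd P 0 u ^+ 2 * (crd P 1 v * crd P ord_max w - crd P ord_max v * crd P 1 w) ^+ 2).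
    by rewrite h0; ring.
  by ring.
move: KK; set K := curvature R G.
move: (crd P 0 u) (crd P 1 u) (crd P ord_max u) => x0 x1 x2.
move: (crd P 0 v) (crd P 1 v) (crd P ord_max v) => y0 y1 y2.
move: (crd P 0 w) (crd P 1 w) (crd P ord_max w) => z0 z1 z2.
move=> KK h0 h1 _.
rewrite -(@gram_alg K x0 x1 x2 y0 y1 y2 z0 z1 z2 KK).
- set uw := z1 * x1 + _ + _.
  have huu : x1 * x1 + x2 * x2 + K * (x0 * x0) = K.
    rewrite -[RHS]mulr1 -h0 mulrDr [K * (K * _)]mulrA KK; ring.
  have huv : x1 * y1 + x2 * y2 + K * (x0 * y0) = 0.
    rewrite -[RHS](mulr0 K) -h1 mulrDr [K * (K * _)]mulrA KK; ring.
  have -> : y1 * (z1 - K * uw * x1) + y2 * (z2 - K * uw * x2) + K * (y0 * (z0 - K * uw * x0)) =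
    y1 * z1 + y2 * z2 + K * (y0 * z0).
    transitivity (y1 * z1 + y2 * z2 + K * (y0 * z0) - K * uw * (x1 * y1 + x2 * y2 + K * (x0 * y0))).
      by ring.
    by rewrite huv mulr0 subr0.
  congr (_ * _ - _).
  transitivity (z1 * z1 + z2 * z2 + K * (z0 * z0) - 2 * K * uw * uw + K * K * uw ^+ 2 *
     (x1 * x1 + x2 * x2 + K * (x0 * x0))); first by rewrite /uw; ring.
  by rewrite huu KK /uw; ring.
- rewrite -[RHS]mulr1 -h0 mulrDr [K * (K * _)]mulrA KK; ring.
- rewrite -[RHS](mulr0 K) -h1 mulrDr [K * (K * _)]mulrA KK; ring.
Qed.

Lemma der_near_cst (F : R -> R) (c s d : R) : (\forall t \near s, F t = c) -> der F s d -> d = 0.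
Proof.
move=> Fc Fd; have h : der (fun _ => c) s d by exact: (near_eq_is_derive Fc Fd).
by rewrite -(der_derive1 h) (der_derive1 (der_cst c s)).
Qed.

Lemma dnum_swap P u v : (dnum (P *m swap_mx) 1 u v = dnum P ord_max u v) *
  (dnum (P *m swap_mx) ord_max u v = dnum P 1 u v).
Proof. by rewrite /dnum !crd_swap. Qed.

Lemma dnum_sign P e d u v : (dnum (P *m sign_mx e d) 1 u v = e * dnum P 1 u v) *
  (dnum (P *m sign_mx e d) ord_max u v = d * dnum P ord_max u v).
Proof. by rewrite /dnum !crd_sign; split; ring. Qed.

(** Numerator of the derivative of the chart slope [dnum P ord_max / dnum P 1] along the curve.
    Where the abscissa increases, its positivity means that the graph is strictly convex. *)
Definition turn P u v w :=
  dnum P ord_max u w * dnum P 1 u v - dnum P ord_max u v * dnum P 1 u w.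

(** A swap makes the abscissa move if the velocity was vertical; one sign then makes it increase,
    and the other sign makes the graph convex. *)
Lemma orient_frame G P u v w : frame G P -> 0 < crd P 0 u -> turn P u v w != 0 ->
  exists P', [/\ frame G P', 0 < crd P' 0 u, 0 < dnum P' 1 u v & 0 < turn P' u v w].
Proof.
move=> FP u0 t0.
have [P1 [F1 u1 d1 t1]] : exists P1, [/\ frame G P1, 0 < crd P1 0 u,
    dnum P1 1 u v != 0 & turn P1 u v w != 0].
  have [d0|d0] := eqVneq (dnum P 1 u v) 0; last by exists P.
  exists (P *m swap_mx); split; [exact: frame_swap|by rewrite crd_swap| |].
    rewrite dnum_swap; apply: contraNneq t0 => n0.
    by rewrite /turn d0 n0 mulr0 mul0r subr0.
  apply: contraNneq t0; rewrite /turn !dnum_swap => /eqP.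
  by rewrite subr_eq0 => /eqP h; rewrite mulrC -h mulrC subrr.
have [e e1 ed] := sign_mul d1.
have [|d dd dt] := @sign_mul _ (e * turn P1 u v w).
  by rewrite mulf_neq0//; case: e1 => ->; rewrite ?oppr_eq0 oner_eq0.
exists (P1 *m sign_mx e d); split.
- exact: frame_sign.
- by rewrite crd_sign.
- by rewrite dnum_sign.
- by rewrite /turn !dnum_sign; move: dt; congr (_ < _); rewrite /turn; ring.
Qed.

Lemma cvg_dnum P k (T : Type) (F : set_system T) {FF : Filter F} (U V : T -> 'rV[R]_3) u v :
  U @ F --> u -> V @ F --> v -> dnum P k (U t) (V t) @[t --> F] --> dnum P k u v.
Proof.
move=> Uu Vv; have hu j : crd P j (U t) @[t --> F] --> crd P j u by exact: cvg_crd.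
have hv j : crd P j (V t) @[t --> F] --> crd P j v by exact: cvg_crd.
exact: (cvgB (cvgM (hv k) (hu 0)) (cvgM (hu k) (hv 0))).
Qed.

Definition germ_point G P g s : Prop :=
  [/\ surface G (g s), 0 < crd P 0 (g s), derivable g s 1, derivable (derive1 g) s 1 &
      0 < dnum P 1 (g s) (derive1 g s) /\
      0 < turn P (g s) (derive1 g s) (derive1 (derive1 g) s)].

(** Differentiating the surface equation twice along the curve supplies the hypotheses of
    [gram_det]; a vanishing determinant would make the geodesic curvature zero. *)
Lemma germ_turn G P g : frame G P -> 0 < crd P 0 (g 0) ->
  C2_regular_germ G g -> strictly_convex_germ G g ->
  turn P (g 0) (derive1 g 0) (derive1 (derive1 g) 0) != 0.
Proof.
move=> FP g0 hC hk.
have [_ dg0 ddg0 _ _] := nbhs_singleton hC.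
have c0c : crd P 0 (g t) @[t --> (0 : R)] --> crd P 0 (g 0).
  exact: (der_cont (der_crd P 0 dg0)).
have N1 : \forall s \near (0 : R), [/\ 0 < crd P 0 (g s), surface G (g s),
    derivable g s 1 & derivable (derive1 g) s 1].
  near=> s; have [h1 h2 h3 _ _] : [/\ surface G (g s), derivable g s 1, derivable (derive1 g) s 1,
    {for s, continuous (derive1n 2 g)} & derive1 g s != 0] by near: s.
  by split => //; near: s; exact: (cvgr_gt _ c0c).
have C1 : \forall s \near (0 : R), crd P 0 (g s) ^+ 2 +
    curvature R G * (crd P 1 (g s) ^+ 2 + crd P ord_max (g s) ^+ 2) = 1.
  by apply: filterS N1 => s [h0 /(frame_surface FP h0)].
have C2 : \forall s \near (0 : R), crd P 0 (g s) * crd P 0 (derive1 g s) + curvature R G *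
    (crd P 1 (g s) * crd P 1 (derive1 g s) + crd P ord_max (g s) * crd P ord_max (derive1 g s)) = 0.
  near=> s; have Cs : \forall t \near s, crd P 0 (g t) ^+ 2 +
    curvature R G * (crd P 1 (g t) ^+ 2 + crd P ord_max (g t) ^+ 2) = 1.
    by near: s; exact: (near_join C1).
  have [_ _ dg _] : [/\ 0 < crd P 0 (g s), surface G (g s),
    derivable g s 1 & derivable (derive1 g) s 1] by near: s.
  have d0 := der_crd P 0 dg; have d1 := der_crd P 1 dg; have d2 := der_crd P ord_max dg.
  apply: (mulfI (_ : (2 : R) != 0)); first by rewrite pnatr_eq0.
  rewrite mulr0; apply: (der_near_cst Cs).
  apply: der_eq; first by der_auto.
  by rewrite /=; ring.
have d0 := der_crd P 0 dg0; have d1 := der_crd P 1 dg0; have d2 := der_crd P ord_max dg0.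
have e0 := der_crd P 0 ddg0; have e1 := der_crd P 1 ddg0; have e2 := der_crd P ord_max ddg0.
have C3 : crd P 0 (derive1 g 0) ^+ 2 + crd P 0 (g 0) * crd P 0 (derive1 (derive1 g) 0) + curvature R G *
    (crd P 1 (derive1 g 0) ^+ 2 + crd P ord_max (derive1 g 0) ^+ 2 +
     (crd P 1 (g 0) * crd P 1 (derive1 (derive1 g) 0) +
      crd P ord_max (g 0) * crd P ord_max (derive1 (derive1 g) 0))) = 0.
  apply: (der_near_cst C2); apply: der_eq; first by der_auto.
  rewrite /=; move: (derive1 g 0) (derive1 (derive1 g) 0) (g 0) => v w u.
  by move: (crd P 0 w) (crd P 1 w) (crd P ord_max w) => w0 w1 w2; ring.
have := gram_det FP g0 (nbhs_singleton C1) (nbhs_singleton C2) C3.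
have := nbhs_singleton hk; rewrite /geod_curvature /cov_acc => k0 gd.
rewrite /turn dnum_det mulf_neq0 ?(gt_eqF g0)//; apply/eqP => det0.
move: k0; rewrite (_ : derive1n 2 g 0 = derive1 (derive1 g) 0)// gd det0 expr0n/= sqrtr0 mul0r.
by rewrite ltxx.
Unshelve. all: by end_near.
Qed.

(** Positivity at 0 spreads by continuity; for [turn] this rests on the continuity of the second
    derivative of [g]. *)
Lemma germ_frame G g : C2_regular_germ G g -> strictly_convex_germ G g ->
  exists2 P, frame G P & \forall s \near (0 : R), germ_point G P g s.
Proof.
move=> hC hk; have [Sg0 dg0 ddg0 cdd _] := nbhs_singleton hC.
have [P1 F1 p1] := exists_frame Sg0.
have [P [FP p0 dP tP]] := orient_frame F1 p1 (germ_turn F1 p1 hC hk).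
exists P => //.
have cg : g t @[t --> (0 : R)] --> g 0 := derivable_cvg dg0.
have cg' : derive1 g t @[t --> (0 : R)] --> derive1 g 0 := derivable_cvg ddg0.
have cg2 : derive1 (derive1 g) t @[t --> (0 : R)] --> derive1 (derive1 g) 0 by exact: cdd.
have cc : crd P 0 (g t) @[t --> (0 : R)] --> crd P 0 (g 0) by exact: (cvg_crd cg).
have cd : dnum P 1 (g t) (derive1 g t) @[t --> (0 : R)] --> dnum P 1 (g 0) (derive1 g 0).
  exact: (cvg_dnum cg cg').
have ct : turn P (g t) (derive1 g t) (derive1 (derive1 g) t) @[t --> (0 : R)] -->
    turn P (g 0) (derive1 g 0) (derive1 (derive1 g) 0).
  exact: (cvgB (cvgM (cvg_dnum cg cg2) (cvg_dnum cg cg'))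
    (cvgM (cvg_dnum cg cg') (cvg_dnum cg cg2))).
near=> s; have [h1 h2 h3 _ _] : [/\ surface G (g s), derivable g s 1, derivable (derive1 g) s 1,
    {for s, continuous (derive1n 2 g)} & derive1 g s != 0] by near: s.
split; [exact: h1| |exact: h2|exact: h3|split].
- by near: s; exact: (cvgr_gt _ cc).
- by near: s; exact: (cvgr_gt _ cd).
- by near: s; exact: (cvgr_gt _ ct).
Unshelve. all: by end_near.
Qed.

End Germ.

(** * Inverse of the abscissa and choice of a small interval *)

Section Local.
Context {R : realType}.

Lemma der_incr (u w : R) (h dh : R -> R) :
  (forall s, s \in `]u, w[ -> der h s (dh s) /\ 0 < dh s) ->
  forall s t, s \in `]u, w[ -> t \in `]u, w[ -> s < t -> h s < h t.
Proof.
move=> hd s t sI tI st.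
have [xi /andP[x1 x2] e] := slope_df (fun z zI => (hd z zI).1) sI tI st.
rewrite -subr_gt0 -(slope_mul h st) e mulr_gt0 ?subr_gt0//.
by apply: (hd _ _).2; exact: (itv_between sI tI (ltW x1) (ltW x2)).
Qed.

(** The margins [u' < u] and [w < w'] keep the end points inside the domain of differentiability, as
    the intermediate value theorem on the closed interval needs. *)
Lemma incr_inverse (u w u' w' : R) (X dX : R -> R) : u' < u -> u < w -> w < w' ->
  (forall s, s \in `]u', w'[ -> der X s (dX s) /\ 0 < dX s) ->
  exists sg : R -> R, [/\ forall s, s \in `]u, w[ -> (X s \in `]X u, X w[) /\ sg (X s) = s,
    forall x, x \in `]X u, X w[ -> (sg x \in `]u, w[) /\ X (sg x) = x &
    forall x, x \in `]X u, X w[ -> der sg x (dX (sg x))^-1].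
Proof.
move=> u'u uw ww' Xd; have incr := der_incr Xd.
have inI s : u <= s -> s <= w -> s \in `]u', w'[.
  by move=> us sw; rewrite in_itv/= (lt_le_trans u'u us) (le_lt_trans sw ww').
have uI : u \in `]u', w'[ by apply: inI => //; exact: ltW.
have wI : w \in `]u', w'[ by apply: inI => //; exact: ltW.
have sub s : s \in `]u, w[ -> s \in `]u', w'[.
  by rewrite in_itv/= => /andP[us sw]; apply: inI; exact: ltW.
have XI s : s \in `]u, w[ -> X s \in `]X u, X w[.
  move=> sI; have sI' := sub _ sI; move: sI; rewrite !in_itv/= => /andP[us sw].
  by rewrite !incr.
have inj s t : s \in `]u, w[ -> t \in `]u, w[ -> X s = X t -> s = t.
  move=> /sub sI /sub tI e; have [st|ts|//] := ltgtP s t.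
    by have := incr _ _ sI tI st; rewrite e ltxx.
  by have := incr _ _ tI sI ts; rewrite e ltxx.
pose sg x := xget 0 [set s | (s \in `]u, w[) /\ X s = x].
have sgX s : s \in `]u, w[ -> sg (X s) = s.
  move=> sI; rewrite /sg; case: xgetP => [t _ [tI e]|/(_ s)[]//].
  exact: inj.
have sgI x : x \in `]X u, X w[ -> (sg x \in `]u, w[) /\ X (sg x) = x.
  rewrite in_itv/= => /andP[ux xw].
  have cX : {within `[u, w], continuous X}.
    apply: derivable_within_continuous => s; rewrite in_itv/= => /andP[us sw].
    by have [[]] := Xd s (inI s us sw).
  have [|c + Xc] := IVT (ltW uw) cX (v := x).
    have Xuw := incr _ _ uI wI uw.
    by rewrite /Order.min /Order.max Xuw !ltW.
  rewrite in_itv/= => /andP[uc cw].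
  have cI : c \in `]u, w[.
    rewrite in_itv/= !lt_neqAle uc cw !andbT; apply/andP; split; apply/eqP => e.
      by move: ux; rewrite -Xc -e ltxx.
    by move: xw; rewrite -Xc e ltxx.
  by rewrite -Xc sgX.
exists sg; split => // [s sI|x xI]; first by split; [exact: XI|exact: sgX].
have [sI Xs] := sgI x xI; have [dX1 dX0] := Xd _ (sub _ sI).
rewrite -{1}Xs; apply: is_derive_inverse => //; last by rewrite gt_eqF.
  by apply: filterS (near_in_itvoo sI) => s; exact: sgX.
apply: filterS (near_in_itvoo sI) => s /sub /Xd[sd _].
exact: (der_cont sd).
Qed.

Lemma near_ball (Q : R -> Prop) (x0 : R) : (\forall x \near x0, Q x) ->
  \forall h \near 0^'+, forall x, `|x - x0| < h -> Q x.
Proof.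
move=> /nbhs_ballP[e /= e0 H]; near=> h; move=> x xh; apply: H.
rewrite -ball_normE/= distrC (lt_trans xh)//.
Unshelve. all: by end_near.
Qed.

Lemma near_box (Q : R * R -> Prop) (x0 y0 : R) : (\forall z \near (x0, y0), Q z) ->
  exists2 e : R, 0 < e & forall x y, `|x - x0| < e -> `|y - y0| < e -> Q (x, y).
Proof.
move=> /nbhs_ballP[e /= e0 H]; exists e => // x y xe ye; apply: H.
by split; rewrite -ball_normE/= distrC.
Qed.

Lemma near_right0 (Q : R -> Prop) : (\forall p \near 0^'+, Q p) ->
  exists2 p0 : R, 0 < p0 & forall p, 0 < p -> p < p0 -> Q p.
Proof.
move=> /nbhs_ballP[e /= e0 H]; exists e => // p p0 pe; apply: H => //.
by rewrite -ball_normE/= sub0r normrN gtr0_norm.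
Qed.

Lemma gB_box (K x0 y0 : R) : 0 < gN K x0 y0 -> exists2 e : R, 0 < e &
  forall x x' y y', `|x - x0| < e -> `|x' - x0| < e -> `|y - y0| < e -> `|y' - y0| < e ->
    gN K x0 y0 / 2 <= gB K x y x' y'.
Proof.
move=> N0; pose z0 := ((x0, y0), (x0, y0)).
have c : gB K z.1.1 z.1.2 z.2.1 z.2.2 @[z --> z0] --> gN K x0 y0.
  rewrite -gB_gN; have c1 : z.1 @[z --> z0] --> (x0, y0) by exact: cvg_fst.
  have c2 : z.2 @[z --> z0] --> (x0, y0) by exact: cvg_snd.
  have c11 : z.1.1 @[z --> z0] --> x0 by exact: (cvg_comp _ _ c1 cvg_fst).
  have c12 : z.1.2 @[z --> z0] --> y0 by exact: (cvg_comp _ _ c1 cvg_snd).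
  have c21 : z.2.1 @[z --> z0] --> x0 by exact: (cvg_comp _ _ c2 cvg_fst).
  have c22 : z.2.2 @[z --> z0] --> y0 by exact: (cvg_comp _ _ c2 cvg_snd).
  exact: (cvgD (cvg_cst _) (cvgM (cvg_cst _) (cvgD (cvgM c11 c21) (cvgM c12 c22)))).
have /nbhs_ballP[e /= e0 H] : \forall z \near z0, gN K x0 y0 / 2 < gB K z.1.1 z.1.2 z.2.1 z.2.2.
  by apply: (cvgr_gt _ c); rewrite gtr_pMr// invf_lt1 ?ltr1n.
exists e => // x x' y y' hx hx' hy hy'; apply: ltW; apply: (H ((x, y), (x', y'))).
by split; split; rewrite -ball_normE/= distrC.
Qed.

Lemma small_line (B h e2 : R) : 0 < B -> h < e2 / (4 * B) -> B * (2 * h) < e2 / 2.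
Proof. by move=> B0; rewrite ltr_pdivlMr ?mulr_gt0//; lra. Qed.

(** Arithmetic of the bound [carea_le]: [u] is the width of a cap, [k] the gap between chord slope
    and tangent slope, [c] the lower bound of the denominator. *)
Lemma small_cap (u h B c p0 k : R) : 0 < u -> u <= 2 * h -> 0 < h -> h < 1 -> 0 < B -> 0 < c ->
  h < p0 * c / (8 * B) -> 0 < k -> k <= 2 * B -> u ^+ 2 / c * k < p0.
Proof.
move=> u0 uh h0 h1 B0 c0 hp k0 kB; rewrite mulrAC ltr_pdivrMr//.
have u2 : u ^+ 2 <= 4 * h.
  have : u * u <= (2 * h) * 2 by apply: ler_pM; lra.
  by rewrite expr2; lra.
apply: (@le_lt_trans _ _ (4 * h * (2 * B))); first by apply: ler_pM; [exact: sqr_ge0|exact: ltW|exact: u2|exact: kB].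
by move: hp; rewrite ltr_pdivlMr ?mulr_gt0//; lra.
Qed.

(** The box is chosen before the interval: continuity of [gB] and the height [e] allowed by the
    strip fix [lo], [hi] and [nu]. Then [h] is taken so small that all chords and tangents stay in
    the box and that caps have area below [p0]; near [x0] slopes are bounded by [B]. *)
Lemma local_setting (K L M x0 e p0 : R) (f df : R -> R) : x0 \in `]L, M[ ->
  (forall x, x \in `]L, M[ -> der f x (df x)) ->
  (forall x y, x \in `]L, M[ -> y \in `]L, M[ -> x < y -> df x < df y) ->
  {for x0, continuous df} -> 0 < gN K x0 (f x0) -> 0 < e -> 0 < p0 ->
  exists lo hi nu : R, hi - lo <= e /\
    \forall h \near 0^'+, [/\ setting K (x0 - h) (x0 + h) lo hi nu f df,
      forall x : R, x \in `]x0 - h, x0 + h[ -> x \in `]L, M[ &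
      forall a b : R, a \in `]x0 - h, x0 + h[ -> b \in `]x0 - h, x0 + h[ -> a < b ->
        carea K f a b < p0].
Proof.
move=> x0I fd incr cdf N0 e0 p00; have [e1 e10 box1] := gB_box N0.
pose e2 := Num.min e1 (e / 2); pose nu := gN K x0 (f x0) / 2.
have e20 : 0 < e2 by rewrite lt_min e10 divr_gt0.
have [e21 e2e] : e2 <= e1 /\ e2 <= e / 2 by rewrite !ge_min !lexx orbT.
have nu0 : 0 < nu by rewrite divr_gt0.
exists (f x0 - e2), (f x0 + e2), nu; split; first by move: e2e; lra.
pose B := `|df x0| + 1; have B0 : 0 < B by rewrite ltr_wpDl.
pose c := Num.sqrt nu * nu; have c0 : 0 < c by rewrite mulr_gt0 ?sqrtr_gt0.
near=> h.
have h0 : 0 < h by [].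
have h1 : h < 1 by near: h; exact: nbhs_right_lt.
have he1 : h < e1 by near: h; exact: nbhs_right_lt.
have he2 : h < e2 / (4 * B) by near: h; apply: nbhs_right_lt; rewrite divr_gt0// mulr_gt0.
have hp : h < p0 * c / (8 * B) by near: h; apply: nbhs_right_lt; rewrite divr_gt0 // mulr_gt0.
have hLM x : `|x - x0| < h -> x \in `]L, M[.
  move: x; near: h; apply: near_ball; exact: near_in_itvoo.
have hf x : `|x - x0| < h -> `|f x - f x0| < e2 / 2.
  move: x; near: h; apply: near_ball.
  have /cvgrPdist_lt/(_ (e2 / 2)) := der_cont (fd _ x0I); rewrite divr_gt0// => /(_ isT).
  by apply: filterS => x; rewrite distrC.
have hdf x : `|x - x0| < h -> `|df x| < B.
  move: x; near: h; apply: near_ball.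
  have /cvgrPdist_lt/(_ 1 ltr01) := cdf; apply: filterS => x; rewrite distrC => hx.
  rewrite -[df x](subrK (df x0)) addrC (le_lt_trans (ler_normD _ _))//.
  by rewrite /B ltrD2l.
have itvE x : x \in `]x0 - h, x0 + h[ -> `|x - x0| < h.
  by rewrite in_itv/= -ltr_distl.
have S : setting K (x0 - h) (x0 + h) (f x0 - e2) (f x0 + e2) nu f df.
  have yE y : y \in `]f x0 - e2, f x0 + e2[ -> `|y - f x0| < e1.
    by rewrite in_itv/= -ltr_distl => yI; exact: lt_le_trans yI e21.
  split => //.
  - move=> x x' y y' /itvE xI /itvE x'I /yE yI /yE y'I.
    by apply: box1 => //; exact: (lt_trans _ he1).
  - by move=> x /itvE/hLM; exact: fd.
  - by move=> x y /itvE/hLM xI /itvE/hLM yI; exact: incr.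
  - move=> a x xi /itvE aI /itvE xI /itvE xiI.
    have d1 : `|x - a| < 2 * h.
      rewrite (_ : x - a = (x - x0) - (a - x0)); last by ring.
      by rewrite (le_lt_trans (ler_normB _ _))// mulr_natl mulr2n ltrD.
    have d2 : `|df xi * (x - a)| < e2 / 2.
      rewrite normrM.
      have h3 : `|df xi| * `|x - a| <= B * (2 * h).
        by apply: ler_pM => //; apply: ltW => //; exact: hdf.
      exact: le_lt_trans h3 (small_line B0 he2).
    rewrite in_itv/= -ltr_distl addrAC (le_lt_trans (ler_normD _ _))//.
    by rewrite [ltRHS]splitr ltrD// hf.
split => // [x /itvE/hLM//|a b aI bI ab].
have [nu0' box fdS incrS lines] := S.
apply: le_lt_trans (carea_le nu0' box fdS incrS lines aI bI ab) _.
have [xi /andP[x1 x2] sxi] := slope_df fdS aI bI ab.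
have xiI := itv_between aI bI (ltW x1) (ltW x2).
have ba0 : 0 < b - a by rewrite subr_gt0.
have ba : b - a <= 2 * h.
  rewrite (_ : b - a = (b - x0) - (a - x0)); last by ring.
  rewrite (le_trans (ler_norm _))// (le_trans (ler_normB _ _))// mulr_natl mulr2n lerD//.
    by rewrite ltW// itvE.
  by rewrite ltW// itvE.
have k0 : 0 < slope f a b - df a by rewrite sxi subr_gt0 incrS.
apply: (small_cap ba0 ba h0 h1 B0 c0 hp k0).
rewrite (le_trans (ler_norm _))// (le_trans (ler_normB _ _))// mulr_natl mulr2n sxi lerD//.
  by rewrite ltW// hdf// itvE.
by rewrite ltW// hdf// itvE.
Unshelve. all: by end_near.
Qed.

End Local.

Definition abscissa (R : realType) (P : 'M[R]_3) (g : R -> 'rV[R]_3) (s : R) : R :=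
  crd P 1 (g s) / crd P 0 (g s).

Section Graph.
Context {R : realType}.
Variables (G : geometry) (P : 'M[R]_3) (g : R -> 'rV[R]_3) (a0 : R).
Hypothesis FP : frame G P.
Hypothesis gp : forall s : R, s \in `]- a0, a0[ -> germ_point G P g s.
Local Notation K := (curvature R G).
Local Notation X := (abscissa P g).
Let Y s := crd P ord_max (g s) / crd P 0 (g s).

(** The slope of the graph is the quotient of the two [dnum] along the curve, and [turn] is the
    numerator of its derivative. Strict monotonicity and continuity of [df] are read there, without
    a second derivative of [f]. *)
Lemma germ_graph (a : R) : 0 < a -> a < a0 -> exists sg dsg f df : R -> R,
  [/\ (forall s : R, s \in `]- a, a[ -> (X s \in `]X (- a), X a[) /\ sg (X s) = s),
      (forall x, x \in `]X (- a), X a[ -> [/\ sg x \in `]- a, a[, X (sg x) = x,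
         0 < gN K x (f x) & g (sg x) = lift K P x (f x)]),
      (forall x, x \in `]X (- a), X a[ -> der sg x (dsg x) /\ 0 < dsg x) &
      [/\ (forall x, x \in `]X (- a), X a[ -> der f x (df x)),
         (forall x y, x \in `]X (- a), X a[ -> y \in `]X (- a), X a[ -> x < y -> df x < df y) &
         (forall x, x \in `]X (- a), X a[ -> {for x, continuous df})]].
Proof.
move=> a_gt0 a_lt.
pose dd k s := dnum P k (g s) (derive1 g s).
have Xd k s : s \in `]- a0, a0[ ->
    der (fun s => crd P k (g s) / crd P 0 (g s)) s (dd k s / crd P 0 (g s) ^+ 2).
  move=> /gp[_ p0 dg _ _]; have n0 := lt0r_neq0 p0.
  have h0 := der_crd P 0 dg; have hk := der_crd P k dg.
  apply: der_eq; first by der_auto.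
  rewrite /= /dd /dnum; move: (derive1 g s) => v; by field.
have X1 s : s \in `]- a0, a0[ -> der X s (dd 1 s / crd P 0 (g s) ^+ 2) /\
    0 < dd 1 s / crd P 0 (g s) ^+ 2.
  move=> sI; split; first exact: (Xd 1).
  by have [_ p0 _ _ [d0 _]] := gp sI; rewrite divr_gt0// exprn_gt0.
have md s : s \in `]- a0, a0[ -> der (fun s => dd ord_max s / dd 1 s) s
    (turn P (g s) (derive1 g s) (derive1 (derive1 g) s) / dd 1 s ^+ 2) /\
    0 < turn P (g s) (derive1 g s) (derive1 (derive1 g) s) / dd 1 s ^+ 2.
  move=> /gp[_ p0 dg ddg [d0 t0]]; split; last by rewrite divr_gt0// exprn_gt0.
  have n0 := lt0r_neq0 d0; rewrite -/(dd 1 s) in n0.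
  have e0 := der_crd P 0 dg; have e1 := der_crd P 1 dg; have e2 := der_crd P ord_max dg.
  have f0 := der_crd P 0 ddg; have f1 := der_crd P 1 ddg; have f2 := der_crd P ord_max ddg.
  move: n0; rewrite /dd /dnum => n0; apply: der_eq; first by der_auto.
  rewrite /= /turn /dnum; move: n0.
  move: (derive1 g s) (derive1 (derive1 g) s) (g s) => v w u n0.
  move: n0; move: (crd P 0 u) (crd P 1 u) (crd P ord_max u) (crd P 0 v) (crd P 1 v) (crd P ord_max v)
    (crd P 0 w) (crd P 1 w) (crd P ord_max w) => u0 u1 u2 v0 v1 v2 w0 w1 w2 n0.
  by field.
have lt1 : - a0 < - a by rewrite ltrN2.
have lt2 : - a < a by rewrite gt0_cp.
have [sg [sgX sgI sgd]] := incr_inverse lt1 lt2 a_lt X1.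
have sub s : s \in `]- a, a[ -> s \in `]- a0, a0[.
  by rewrite !in_itv/= => /andP[h1 h2]; rewrite (lt_trans lt1 h1) (lt_trans h2 a_lt).
pose dsg x := (dd 1 (sg x) / crd P 0 (g (sg x)) ^+ 2)^-1.
have sgd' x : x \in `]X (- a), X a[ -> der sg x (dsg x) /\ 0 < dsg x.
  move=> xI; split; first exact: sgd.
  by have [sI _] := sgI x xI; have [_ h] := X1 _ (sub _ sI); rewrite invr_gt0.
exists sg, dsg, (fun x => Y (sg x)), (fun x => dd ord_max (sg x) / dd 1 (sg x)); split => //.
- move=> x xI; have [sI Xs] := sgI x xI; have [Sg p0 _ _ _] := gp (sub _ sI).
  have h1 := surface_gN_gt0 FP Sg p0; have h2 := surface_lift FP Sg p0.
  by rewrite -/(X (sg x)) Xs in h1 h2; split.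
split.
- move=> x xI; have [sI Xs] := sgI x xI; have [h1 h2] := sgd' x xI.
  have hY := der_comp (Xd ord_max _ (sub _ sI)) h1; apply: (der_eq hY).
  have [_ p0 _ _ [d0 _]] := gp (sub _ sI).
  rewrite /dsg; move: (lt0r_neq0 p0) (lt0r_neq0 d0); rewrite -/(dd 1 (sg x)).
  move: (dd 1 (sg x)) (dd ord_max (sg x)) (crd P 0 (g (sg x))) => d n c hc hd.
  by field; rewrite hc hd.
- have sg_incr := der_incr sgd'; have m_incr := der_incr md.
  move=> x y xI yI xy; have [sI _] := sgI x xI; have [s'I _] := sgI y yI.
  by apply: m_incr; [exact: sub|exact: sub|exact: sg_incr].
- move=> x xI; have [sI _] := sgI x xI; have [h1 _] := sgd' x xI.
  exact: (der_cont (der_comp (md _ (sub _ sI)).1 h1)).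
Qed.

End Graph.

(** The cap over the left half of the interval has nonnegative area, and extending it to [b]
    strictly increases the area. *)
Lemma carea_gt0 (R : realType) (K l r lo hi nu : R) (f df : R -> R) a b :
  setting K l r lo hi nu f df -> a \in `]l, r[ -> b \in `]l, r[ -> a < b -> 0 < carea K f a b.
Proof.
move=> S aI bI ab; have [nu0 box fd incr lines] := S.
pose c := (a + b) / 2; have [ac cb] : a < c /\ c < b by rewrite /c; split; lra.
have cI := itv_between aI bI (ltW ac) (ltW cb).
have [xi /andP[x1 x2] e] := carea_MVT2 S aI bI ac cb.
have : 0 < carea K f a b - carea K f a c.
  rewrite e mulr_gt0 ?subr_gt0// (carea_d2_gt0 S)//; last exact: lt_trans x1.
  exact: (itv_between cI bI (ltW x1) (ltW x2)).
rewrite subr_gt0; apply: le_lt_trans; rewrite -lee_fin -(careaE nu0 box fd incr lines aI cI ac).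
by apply: integral_ge0 => z _; apply: pos_garea_ge0; exact: (cap_pos nu0 box fd lines aI cI ac).
Qed.

(** * Conclusion *)

Section Main.
Context {R : realType}.
Variables (G : geometry) (P : 'M[R]_3) (g : R -> 'rV[R]_3).
Hypothesis FP : frame G P.
Local Notation K := (curvature R G).

Lemma frame_conic (C : 'M[R]_3) p : surface G p -> 0 < crd P 0 p ->
  bilin C (row3 1 (crd P 1 p / crd P 0 p) (crd P ord_max p / crd P 0 p))
    (row3 1 (crd P 1 p / crd P 0 p) (crd P ord_max p / crd P 0 p)) = 0 ->
  conic G (P *m C *m P^T) p.
Proof.
move=> Sp p0 h; split => //=.
set q := row3 _ _ _ in h; have e : p *m P = crd P 0 p *: q.
  apply/rowP; elim/ord3_ind; rewrite [RHS]mxE /q row3E -/(crd P _ p).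
  - by rewrite mulr1.
  - by rewrite mulrC divfK ?gt_eqF.
  - by rewrite mulrC divfK ?gt_eqF.
have -> : bilin (P *m C *m P^T) p p = bilin C (p *m P) (p *m P).
  by rewrite /bilin trmx_mul !mulmxA.
rewrite e /bilin linearZ/= -!scalemxAl -scalemxAr scalerA mxE -/(bilin C q q).
by rewrite h mulr0.
Qed.

Lemma frame_mx_neq0 (C : 'M[R]_3) : C != 0 -> P *m C *m P^T != 0.
Proof.
move=> C0; apply: contra_neq C0 => h; have PP := mulmx1C (frame_orth FP).
have : P^T *m (P *m C *m P^T) *m P = C by rewrite !mulmxA PP mul1mx -mulmxA PP mulmx1.
by rewrite h mulmx0 mul0mx.
Qed.

(** The form defining the disk vanishes at [O] and is continuous along the lift, so a whole chart
    neighbourhood lifts into the disk. *)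
Lemma disk_near (f : R -> R) (O : 'rV[R]_3) (x0 r : R) : 0 < r -> surface G O ->
  {for x0, continuous f} -> 0 < gN K x0 (f x0) -> lift K P x0 (f x0) = O ->
  exists2 e : R, 0 < e & forall x t, `|x - x0| < e -> `|t| < e ->
    0 < gN K x (f x + t) /\ disk G O r (lift K P x (f x + t)).
Proof.
move=> r0 SO cf N0 eO; pose z0 : R * R := (x0, 0).
have c1 : z.1 @[z --> z0] --> x0 by exact: cvg_fst.
have c2 : z.2 @[z --> z0] --> (0 : R) by exact: cvg_snd.
have cfz : f z.1 + z.2 @[z --> z0] --> f x0.
  rewrite -[f x0]addr0; apply: cvgD => //.
  exact: (cvg_comp _ _ c1 cf).
have cN : gN K z.1 (f z.1 + z.2) @[z --> z0] --> gN K x0 (f x0).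
  exact: (cvgD (cvg_cst (1 : R)) (cvgM (cvg_cst K) (cvgD (cvgM c1 c1) (cvgM cfz cfz)))).
have cl : lift K P z.1 (f z.1 + z.2) @[z --> z0] --> O by rewrite -eO; exact: (cvg_lift N0 c1 cfz).
have cb : bilin (Q R G) (lift K P z.1 (f z.1 + z.2) - O) (lift K P z.1 (f z.1 + z.2) - O)
    @[z --> z0] --> (0 : R).
  have ck k : crd P k (lift K P z.1 (f z.1 + z.2) - O) @[z --> z0] --> (0 : R).
    rewrite (_ : 0 = crd P k (O - O)); last by rewrite subrr /crd mul0mx mxE.
    by apply: cvg_crd; apply: cvgB => //; exact: cvg_cst.
  have -> : (0 : R) = 0 * 0 + 0 * 0 + K * (0 * 0) by rewrite !mulr0 !addr0.
  under eq_fun do rewrite (frame_bilin FP).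
  exact: (cvgD (cvgD (cvgM (ck 1) (ck 1)) (cvgM (ck ord_max) (ck ord_max)))
    (cvgM (cvg_cst K) (cvgM (ck 0) (ck 0)))).
have : \forall z \near z0, 0 < gN K z.1 (f z.1 + z.2) /\
    disk G O r (lift K P z.1 (f z.1 + z.2)).
  near=> z; have Nz : 0 < gN K z.1 (f z.1 + z.2) by near: z; exact: (cvgr_gt _ cN).
  split => //; split; first exact: (lift_surface FP Nz).
  by near: z; apply: (cvgr_lt _ cb); rewrite exprn_gt0.
move=> /near_box[e e0 H]; exists e => // x t xe te; apply: (H x t xe).
by rewrite subr0.
Unshelve. all: by end_near.
Qed.

End Main.

Lemma ball_sub_itv (R : realType) (L M x0 e x : R) : x0 - e < x -> x < x0 + e ->
  e <= x0 - L -> e <= M - x0 -> x \in `]L, M[.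
Proof. by move=> ? ? ? ?; rewrite in_itv/=; apply/andP; split; lra. Qed.

Theorem theorem1p13 (R : realType) (G : geometry) (g : R -> 'rV[R]_3)
    (hC2 : C2_regular_germ G g)
    (hconvex : strictly_convex_germ G g)
    (hPoritsky : area_Poritsky G g) :
  exists C : 'M[R]_3,
    [/\ C != 0, C^T = C & \forall s \near (0 : R), conic G C (g s)].
Proof.
have [P FP gp] := germ_frame hC2 hconvex.
have [t ht hA] := hPoritsky.
have [a0 a0_gt0 near0] : exists2 a0 : R, 0 < a0 & forall s, s \in `]- a0, a0[ ->
    germ_point G P g s /\ [/\ derivable t s 1, {for s, continuous (derive1 t)} & derive1 t s != 0].
  have gt : \forall s \near (0 : R), germ_point G P g s /\
      [/\ derivable t s 1, {for s, continuous (derive1 t)} & derive1 t s != 0].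
    by apply: filterI.
  move: gt => /nbhs_ballP[a0 /= a00 H]; exists a0 => // s.
  rewrite in_itv/= => sI; apply: H; rewrite -ball_normE/= sub0r normrN ltr_norml.
  by [].
have [a1 a1_gt0 hA1] := near_right0 hA.
(* The choices follow the quantifiers of [area_Poritsky]: first the arc, then the radius [r], which
   yield [V], [b] and the bound [q0] on areas; only then the interval of abscissas, which depends on
   all of them. *)
pose a := Num.min a0 a1 / 2.
have m0 : 0 < Num.min a0 a1 by rewrite lt_min a0_gt0.
have a_gt0 : 0 < a by rewrite divr_gt0.
have am : a < Num.min a0 a1 by rewrite gtr_pMr// invf_lt1 ?ltr1n.
have [aa0 aa1] : a < a0 /\ a < a1 by move: am; rewrite lt_min => /andP[].
have [sg [dsg [f [df [sgX sgI sgd [fd incr cdf]]]]]] := germ_graph FP (fun s sI => (near0 s sI).1) a_gt0 aa0.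
have I0 : (0 : R) \in `]- a, a[ by rewrite in_itv/= oppr_lt0 a_gt0.
have subI s : s \in `]- a, a[ -> s \in `]- a0, a0[.
  rewrite !in_itv/= => /andP[h1 h2]; rewrite (lt_trans h2 aa0) andbT.
  by apply: lt_trans h1; rewrite ltrN2.
have [x0I sg0] := sgX 0 I0.
set X := abscissa P g in sgX sgI sgd fd incr cdf x0I sg0.
set L := X (- a) in sgX sgI sgd fd incr cdf x0I.
set M := X a in sgX sgI sgd fd incr cdf x0I.
pose x0 := X 0; rewrite -/x0 in x0I sg0.
have [_ _ N0 g0E] := sgI x0 x0I; rewrite sg0 in g0E.
have [[Sg0 p0 _ _ _] _] := near0 0 (subI 0 I0).
(* Within [e1] of [x0] all abscissas lie in []L, M[]. In a disk this small the arc is therefore the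
   whole graph of [f], which [DGam] needs. *)
pose e1 := Num.min (x0 - L) (M - x0).
have e10 : 0 < e1 by move: x0I; rewrite in_itv/= => /andP[? ?]; rewrite lt_min !subr_gt0; apply/andP.
have [r0 r00 hr0] := disk_close FP Sg0 p0 e10.
have [r1 r10 hr1] := near_right0 (hA1 a a_gt0 aa1).
pose r := Num.min r0 r1 / 2.
have mr0 : 0 < Num.min r0 r1 by rewrite lt_min r00.
have r_gt0 : 0 < r by rewrite divr_gt0.
have rm : r < Num.min r0 r1 by rewrite gtr_pMr// invf_lt1 ?ltr1n.
have [rr0 rr1] : r < r0 /\ r < r1 by move: rm; rewrite lt_min => /andP[].
have [V VP [b b0 hp]] := hr1 r r_gt0 rr1.
have [q0 q00 hq] := near_right0 hp.
have cf0 := der_cont (fd x0 x0I).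
have [e e0 strip] := disk_near FP r_gt0 Sg0 cf0 N0 (esym g0E).
have [lo [hi [nu [hilo near_h]]]] := local_setting x0I fd incr (cdf x0 x0I) N0 e0 q00.
have near_b : \forall h \near (0 : R)^'+, forall x, `|x - x0| < h -> `|sg x| < b.
  apply: near_ball; have /cvgrPdist_lt/(_ b b0) := der_cont (sgd x0 x0I).1.
  by apply: filterS => x; rewrite sg0 sub0r normrN.
have [h1 h10 hh] := near_right0 (filterI (filterI near_h near_b) (nbhs_right_lt e0)).
pose h := h1 / 2; have h_gt0 : 0 < h by rewrite divr_gt0.
have [|[[S subLM small] hsg] he] := hh h h_gt0; first by rewrite gtr_pMr// invf_lt1 ?ltr1n.
pose l := x0 - h; pose m := x0 + h; rewrite -/l -/m in S subLM small.
have lm : l < m by rewrite /l /m ltrD2l gt0_cp.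
have lmE x : x \in `]l, m[ -> `|x - x0| < h by rewrite in_itv/= -ltr_distl.
have DS p : disk G (g 0) r p ->
    [/\ surface G p, 0 < crd P 0 p & crd P 1 p / crd P 0 p \in `]L, M[].
  move=> Dp; have [Sp _] := Dp; have [pp] := hr0 r p r_gt0 rr0 Dp.
  rewrite -/(abscissa P g 0) -/X -/x0 ltr_distl => /andP[u1 u2]; split => //.
  have [v1 v2] : e1 <= x0 - L /\ e1 <= M - x0 by rewrite !ge_min !lexx orbT.
  exact: (ball_sub_itv u1 u2 v1 v2).
have DGam p : disk G (g 0) r p -> (g @` `]- a, a[) p <->
    crd P ord_max p / crd P 0 p = f (crd P 1 p / crd P 0 p).
  move=> /DS[Sp pp pI]; have [sI Xs Np gsE] := sgI _ pI; split.
    move=> [s /= sI' gs]; have [_] := sgX s sI'; rewrite /X /abscissa gs => es.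
    by move: gsE; rewrite es gs => pE; have := (lift_ratio FP Np).2; rewrite -pE.
  move=> hY; exists (sg (crd P 1 p / crd P 0 p)); first exact: sI.
  by rewrite gsE -hY (surface_lift FP Sp pp).
have Dstrip x u : x \in `]l, m[ -> - e < u < e ->
    0 < gN (curvature R G) x (f x + u) /\
    disk G (g 0) r (lift (curvature R G) P x (f x + u)).
  move=> /lmE xh ue; apply: strip; first exact: lt_trans xh he.
  by rewrite ltr_norml.
have [_ VD Vup] := convex_side_above FP fd incr lm subLM e0 DS DGam Dstrip VP.
have sg_lt a1' b1' : a1' \in `]l, m[ -> b1' \in `]l, m[ -> a1' < b1' ->
    [/\ - b < sg a1', sg a1' < sg b1' & sg b1' < b].
  move=> aI bI ab'; have sgi := der_incr sgd.
  have := hsg _ (lmE _ aI); have := hsg _ (lmE _ bI); rewrite !ltr_norml.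
  by move=> /andP[_ ->] /andP[-> _]; split => //; apply: sgi => //; exact: subLM.
have cut c d : c \in `]l, m[ -> d \in `]l, m[ -> c < d ->
    exists2 W, cut_region G V (g (sg c)) (g (sg d)) (g @` `[sg c, sg d]) W &
      area G W = (carea (curvature R G) f c d)%:E.
  move=> cI dI cd; exists (frameset G P (cap f c d)); last exact: (cap_area FP S cI dI cd).
  have := cap_cut_region FP fd incr subLM DS VD Vup S hilo cI dI cd.
  have [scI Xc _ <-] := sgI _ (subLM _ cI); have [sdI Xd' _ <-] := sgI _ (subLM _ dI).
  suff -> : [set lift (curvature R G) P x (f x) | x in `[c, d]%classic] =
    g @` `[sg c, sg d]%classic by [].
  have le_sg x y : x \in `]L, M[ -> y \in `]L, M[ -> (sg x <= sg y) = (x <= y).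
    move=> xI yI; have sgi := der_incr sgd; have [xy|yx|->] := ltgtP x y; last by rewrite lexx.
      by rewrite ltW// sgi.
    by rewrite leNgt sgi.
  apply/seteqP; split => p.
    move=> [x]; rewrite /= in_itv/= => /andP[cx xd] <-.
    have xI := subLM _ (itv_between cI dI cx xd); have [_ _ _ <-] := sgI _ xI.
    by exists (sg x) => //; rewrite /= in_itv/= !le_sg// ?cx ?xd// subLM.
  move=> [s]; rewrite /= in_itv/= => /andP[cs sd] <-.
  have sI := itv_between scI sdI cs sd.
  have [XI sgs] := sgX _ sI; have [_ _ _ gX] := sgI _ XI; rewrite sgs in gX.
  exists (X s); last by rewrite -gX.
  by rewrite /= in_itv/=; rewrite -sgs !le_sg ?(subLM _ cI) ?(subLM _ dI)// in cs sd; rewrite cs sd.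
pose T x := t (sg x).
(* Equal caps are cut off with the same area, and the constant [c] of the hypothesis depends on that
   area alone. *)
have level a1' b1' a2' b2' : a1' \in `]l, m[ -> b1' \in `]l, m[ ->
    a2' \in `]l, m[ -> b2' \in `]l, m[ -> a1' < b1' -> a2' < b2' ->
    carea (curvature R G) f a1' b1' = carea (curvature R G) f a2' b2' -> T b1' - T a1' = T b2' - T a2'.
  move=> a1I b1I a2I b2I ab1 ab2 hc.
  have [c Hc] := hq _ (carea_gt0 S a1I b1I ab1) (small _ _ a1I b1I ab1).
  have [u1 u2 u3] := sg_lt _ _ a1I b1I ab1; have [v1 v2 v3] := sg_lt _ _ a2I b2I ab2.
  have W1 := cut _ _ a1I b1I ab1; have W2 := cut _ _ a2I b2I ab2; rewrite -hc in W2.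
  by rewrite /T (Hc _ _ u1 u2 u3 W1) (Hc _ _ v1 v2 v3 W2) addrAC subrr add0r addrAC subrr add0r.
have tI x : x \in `]l, m[ -> [/\ derivable t (sg x) 1, {for sg x, continuous (derive1 t)} & derive1 t (sg x) != 0].
  by move=> /subLM/sgI[sI _ _ _]; have [_] := near0 _ (subI _ sI).
have TdE x : x \in `]l, m[ -> der T x (derive1 t (sg x) * dsg x).
  move=> xI; have [dt _ _] := tI x xI; have [ds _] := sgd x (subLM _ xI).
  exact: (der_comp (derivable_der dt) ds).
have T0 x : x \in `]l, m[ -> derive1 t (sg x) * dsg x != 0.
  move=> xI; have [_ _ dt] := tI x xI; have [_ ds] := sgd x (subLM _ xI).
  by rewrite mulf_neq0// gt_eqF.
have inI u : - h < u -> u < h -> x0 + u \in `]l, m[.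
  by move=> u1 u2; rewrite in_itv/= /l /m !ltrD2l u1.
(* Halving the interval places its ends inside []l, m[], where the tangents defining the pencil
   exist. *)
have h20 : 0 < h / 2 by rewrite divr_gt0.
have h2h : h / 2 < h by rewrite gtr_pMr// invf_lt1 ?ltr1n.
have aI : x0 + - (h / 2) \in `]l, m[ by apply: inI; [rewrite ltrN2|rewrite (lt_trans _ h_gt0)// oppr_lt0].
have bI : x0 + h / 2 \in `]l, m[ by apply: inI => //; rewrite (lt_trans _ h20)// oppr_lt0.
have ab' : x0 + - (h / 2) < x0 + h / 2 by rewrite ltrD2l gt0_cp.
have [C [C0 Csym HC]] := level_conic S (fun x xI => cdf x (subLM _ xI)) TdE T0 level aI bI ab'.
exists (P *m C *m P^T); split; first exact: (frame_mx_neq0 FP C0).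
  by rewrite !trmx_mul trmxK Csym mulmxA.
have cX : X s @[s --> (0 : R)] --> x0.
  have [_ _ dg _ _] := (near0 0 (subI 0 I0)).1.
  have k0 := der_cont (der_crd P 0 dg); have k1 := der_cont (der_crd P 1 dg).
  exact: (cvgM k1 (cvgV (lt0r_neq0 p0) k0)).
near=> s.
have sI : s \in `]- a, a[ by near: s; exact: near_in_itvoo.
have [[Sg pg _ _ _] _] := near0 s (subI s sI).
have [XI sgs] := sgX s sI; have [_ _ _ gX] := sgI _ XI; rewrite sgs in gX.
have Xab : X s \in `]x0 + - (h / 2), x0 + h / 2[.
  rewrite in_itv/= -ltr_distl; near: s; have /cvgrPdist_lt/(_ _ h20) := cX.
  by apply: filterS => s; rewrite distrC.
have [_ _ Ns _] := sgI _ XI.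
have fY : crd P ord_max (g s) / crd P 0 (g s) = f (X s).
  by rewrite gX (lift_ratio FP Ns).
by have hb := HC _ Xab; rewrite -fY in hb; exact: (frame_conic Sg pg hb).
Unshelve. all: by end_near.
Qed.
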